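(* Let $N\geq 3$, $a_1>0$ and $\psi\in C^2(\mathbb{R})$. Assume that there exist $2<k<2p$ such that $$1<p<\frac{(k+1)N+2}{N-2},$$ and $a(s)=a_1|s|^k+\psi(s)$ for $s\in\mathbb{R}$, with $$\inf_{s\geq 0}\psi(s)>0,\qquad \inf_{s\geq 0}\big(k\psi(s)-s\psi'(s)\big)\geq 0.$$ Furthermore, assume that $$\lim_{s\to+\infty}s^{\frac{2-k}{2}}\psi(s)=0,\qquad \lim_{s\to+\infty}s^{\frac{4-k}{2}}\psi'(s)=0,\qquad \lim_{s\to+\infty}s^{\frac{6-k}{2}}\psi''(s)=0.$$ Then there exists $m_0>0$ such that, for all $m\geq m_0$, the problem $$\begin{cases}-\mathrm{div}(a(u)Du)+\frac12 a'(u)|Du|^2+mu=u^p & \text{in } \mathbb{R}^N,\\ u>0 & \text{in } \mathbb{R}^N,\\ u \text{ is radially symmetric},\end{cases}$$ admits a unique solution $u\in X\cap C^2(\mathbb{R}^N)$, up to translations.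
   Context: $Du$ denotes the gradient of $u$, and $$X:=\big\{u\in H^1(\mathbb{R}^N):\ a(u)|Du|^2\in L^1(\mathbb{R}^N)\big\},$$ where functions are real valued. *)

(* Defs.v *)
From HB Require Import structures.
From mathcomp Require Import all_boot all_order all_algebra.
From mathcomp Require Import all_classical all_reals all_analysis.

Set Implicit Arguments.
Unset Strict Implicit.
Unset Printing Implicit Defensive.
Import Order.TTheory GRing.Theory Num.Theory.
Import numFieldNormedType.Exports.

Local Open Scope classical_set_scope.
Local Open Scope ring_scope.

Section measurable_rV.
Context (R : realType) (n : nat).

Let coord (i : 'I_n) (x : 'rV[R]_n) : measurableTypeR R := x 0 i.

Let rV_set0 : g_sigma_preimage coord set0.
Proof. exact: sigma_algebra0. Qed.

Let rV_setC A : g_sigma_preimage coord A -> g_sigma_preimage coord (~` A).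
Proof. exact: sigma_algebraC. Qed.

Let rV_bigcup (F : (set 'rV[R]_n)^nat) :
  (forall i, g_sigma_preimage coord (F i)) ->
  g_sigma_preimage coord (\bigcup_i (F i)).
Proof. exact: sigma_algebra_bigcup. Qed.

(* The product sigma-algebra, which is the Borel sigma-algebra of R^n. *)
HB.instance Definition _ := @isMeasurable.Build default_measure_display
  'rV[R]_n (g_sigma_preimage coord) rV_set0 rV_setC rV_bigcup.

Lemma measurable_coord (i : 'I_n) :
  measurable_fun setT (fun x : 'rV[R]_n => x 0 i : measurableTypeR R).
Proof.
move=> _ Y mY; rewrite setTI; apply: sub_sigma_algebra => /=.
rewrite -bigcup_seq/=; exists i => /=; first by rewrite mem_index_enum.
by exists Y => //; rewrite setTI.
Qed.

Lemma measurable_fun_rVP d (T : measurableType d) (f : T -> 'rV[R]_n) :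
  (forall i, measurable_fun setT (fun t => f t 0 i : measurableTypeR R)) ->
  measurable_fun setT f.
Proof.
move=> mf.
have H : g_sigma_preimage (fun i => coord i \o f) `<=` measurable.
  apply: smallest_sub; first exact: sigma_algebra_measurable.
  rewrite -bigcup_seq/=; apply: bigcup_sub => i _.
  by move=> A [B mB <-]; exact: mf.
rewrite g_sigma_preimage_comp in H.
by move=> _ A mA; apply: H; exists A.
Qed.

End measurable_rV.

Section lebesgue_rV_step.
Context (R : realType) (n : nat).
Context (mu : {sigma_finite_measure set 'rV[R]_n -> \bar R}).

Definition rV_cons (p : measurableTypeR R * 'rV[R]_n) : 'rV[R]_n.+1 :=
  row_mx (p.1)%:M p.2.

Definition rV_uncons (x : 'rV[R]_n.+1) : measurableTypeR R * 'rV[R]_n :=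
  (x 0 ord0, \row_i x 0 (lift ord0 i)).

Lemma rV_cons0 p : rV_cons p 0 ord0 = p.1.
Proof.
have -> : ord0 = lshift n (ord0 : 'I_1) by exact/val_inj.
by rewrite (row_mxEl (p.1)%:M p.2) mxE eqxx.
Qed.

Lemma rV_consS p (i : 'I_n) : rV_cons p 0 (lift ord0 i) = p.2 0 i.
Proof.
have -> : lift ord0 i = rshift 1 i by exact/val_inj.
by rewrite (row_mxEr (p.1)%:M p.2).
Qed.

Lemma rV_consK : cancel rV_cons rV_uncons.
Proof.
move=> [a x]; congr pair; first by rewrite rV_cons0.
by apply/rowP => i; rewrite mxE rV_consS.
Qed.

Lemma rV_unconsK : cancel rV_uncons rV_cons.
Proof.
move=> x; apply/rowP => j; have [i ->|->] := unliftP ord0 j.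
  by rewrite rV_consS mxE.
by rewrite rV_cons0.
Qed.

Lemma measurable_rV_cons : measurable_fun setT rV_cons.
Proof.
apply: measurable_fun_rVP => j; have [i ->|->] := unliftP ord0 j.
  under eq_fun do rewrite rV_consS.
  by apply: (measurableT_comp (measurable_coord i)).
under eq_fun do rewrite rV_cons0.
exact: measurable_fst.
Qed.

Lemma measurable_rV_uncons : measurable_fun setT rV_uncons.
Proof.
apply: measurable_fun_pair; first exact: measurable_coord.
apply: measurable_fun_rVP => i; under eq_fun do rewrite mxE.
exact: measurable_coord.
Qed.

Local Open Scope ereal_scope.

Definition lebesgue_rV_step : set 'rV[R]_n.+1 -> \bar R :=
  pushforward (@lebesgue_measure R \x mu) rV_cons.

Let step0 : lebesgue_rV_step set0 = 0.
Proof. by rewrite /lebesgue_rV_step /pushforward preimage_set0 measure0. Qed.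

Let step_ge0 A : 0 <= lebesgue_rV_step A.
Proof. by rewrite /lebesgue_rV_step /pushforward measure_ge0. Qed.

Let step_sigma_additive : semi_sigma_additive lebesgue_rV_step.
Proof.
exact: (@measure_semi_sigma_additive _ _ _
  (measure_function_pushforward__canonical__measure_function_Measure
    (@lebesgue_measure R \x mu) measurable_rV_cons)).
Qed.

HB.instance Definition _ := isMeasure.Build _ _ _ lebesgue_rV_step
  step0 step_ge0 step_sigma_additive.

Let step_sigma_finite : sigma_finite setT lebesgue_rV_step.
Proof.
have /sigma_finiteP[F [FT ndF Foo]] := sigma_finiteT (@lebesgue_measure R).
have /sigma_finiteP[G [GT ndG Goo]] := sigma_finiteT mu.
exists (fun k => rV_uncons @^-1` (F k `*` G k)).
  rewrite -preimage_bigcup -(@preimage_setT _ _ rV_uncons); congr (_ @^-1` _).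
  rewrite -setXTT FT GT predeqE => -[x y]; split.
    move=> [/= [i _ Fix] [j _ Gjy]]; exists (maxn i j) => //; split.
      by move: x Fix; exact/subsetPset/ndF/leq_maxl.
    by move: y Gjy; exact/subsetPset/ndG/leq_maxr.
  by move=> [i _ []/= ? ?]; split; exists i.
move=> k; have [mF Fk] := Foo k; have [mG Gk] := Goo k; split.
  rewrite -[X in measurable X]setTI; apply: measurable_rV_uncons => //.
  exact: measurableX.
rewrite /lebesgue_rV_step /pushforward -comp_preimage.
rewrite (_ : rV_uncons \o rV_cons = id); last exact/funext/rV_consK.
by rewrite preimage_id product_measure1E// lte_mul_pinfty// ge0_fin_numE.
Qed.

HB.instance Definition _ := Measure_isSigmaFinite.Build _ _ _ lebesgue_rV_step
  step_sigma_finite.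

End lebesgue_rV_step.

Section lebesgue_rV.
Context (R : realType).
Local Open Scope ereal_scope.

(* Lebesgue measure on R^n is built by iterated products: R^0 is a point and
   R^(n+1) is R x R^n. *)
Fixpoint lebesgue_rV (n : nat) : {sigma_finite_measure set 'rV[R]_n -> \bar R} :=
  match n with
  | 0%N => (\d_ (0%R : 'rV[R]_0) : {finite_measure set 'rV[R]_0 -> \bar R})
  | n'.+1 => lebesgue_rV_step (lebesgue_rV n')
  end.

Lemma lebesgue_rV_box n (A : 'I_n -> set (measurableTypeR R)) :
  (forall i, measurable (A i)) ->
  lebesgue_rV n [set x | forall i, A i (x 0%R i)] =
  \prod_(i < n) lebesgue_measure (A i).
Proof.
elim: n A => [|n ih] A mA.
  rewrite big_ord0 /= diracE mem_set//=; first by case.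
have mB : measurable [set x : 'rV[R]_n | forall i, A (lift ord0 i) (x 0%R i)].
  rewrite (_ : [set x | _] =
      \bigcap_(i : 'I_n) ((fun x : 'rV[R]_n => x 0%R i) @^-1` A (lift ord0 i))).
    apply: fin_bigcap_measurable => // i _.
    by rewrite -[X in measurable X]setTI; exact: measurable_coord.
  by apply/seteqP; split=> x /= h i; [move=> _|]; exact: h.
rewrite big_ord_recl -ih//.
rewrite -(product_measure1E (@lebesgue_measure R) (lebesgue_rV n))//.
rewrite /= /lebesgue_rV_step /pushforward; congr (_ _).
apply/seteqP; split=> [p h|p [h0 h]] /=.
  split=> [|i]; first by rewrite -rV_cons0; exact: h.
  by rewrite -rV_consS; exact: h.
move=> j; have [i ->|->] := unliftP ord0 j.
  by rewrite rV_consS; exact: h.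
by rewrite rV_cons0.
Qed.

End lebesgue_rV.

Section calculus.
Context (R : realType) (N : nat).
Implicit Types (f u phi : 'rV[R]_N -> R) (F G : 'rV[R]_N -> 'rV[R]_N).

(* The library norm on 'rV[R]_N is the sup norm. *)
Definition enorm (x : 'rV[R]_N) : R := Num.sqrt (\sum_(i < N) x 0 i ^+ 2).

Definition partial (i : 'I_N) f : 'rV[R]_N -> R := 'D_(delta_mx 0 i) f.

Definition grad f (x : 'rV[R]_N) : 'rV[R]_N := \row_i partial i f x.

Definition divergence F (x : 'rV[R]_N) : R :=
  \sum_(i < N) partial i (fun y => F y 0 i) x.

Fixpoint Ck (k : nat) f : Prop :=
  match k with
  | 0%N => continuous f
  | k'.+1 => continuous f /\ forall i,
      (forall x, derivable f x (delta_mx 0 i)) /\ Ck k' (partial i f)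
  end.

Definition test_function phi : Prop :=
  (forall k, Ck k phi) /\ compact (closure [set x | phi x != 0]).

Definition weak_gradient u G : Prop :=
  forall phi, test_function phi -> forall i : 'I_N,
    \int[lebesgue_rV R N]_x (u x * partial i phi x) =
    - \int[lebesgue_rV R N]_x (G x 0 i * phi x).

(* u belongs to H^1(R^N), with weak gradient G *)
Definition H1_gradient u G : Prop :=
  [/\ u \in Lfun (lebesgue_rV R N) 2%:E,
      forall i, (fun x => G x 0 i) \in Lfun (lebesgue_rV R N) 2%:E &
      weak_gradient u G].

Definition space_X (a : R -> R) u : Prop :=
  exists2 G, H1_gradient u G &
    (fun x => a (u x) * enorm (G x) ^+ 2) \in Lfun (lebesgue_rV R N) 1%:E.

(* The centre is free: the problem is invariant under translations, and its
   solutions are identified up to translations. *)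
Definition radially_symmetric u : Prop :=
  exists x0, forall x y, enorm (x - x0) = enorm (y - x0) -> u x = u y.

Definition solution (a : R -> R) (p m : R) u : Prop :=
  [/\ forall x, - divergence (fun y => a (u y) *: grad u y) x
        + 2^-1 * derive1 a (u x) * enorm (grad u x) ^+ 2 + m * u x = u x `^ p,
      forall x, 0 < u x &
      radially_symmetric u].

End calculus.

Definition C2_real (R : realType) (f : R -> R) : Prop :=
  [/\ forall s, derivable f s 1, forall s, derivable (derive1 f) s 1 &
      continuous (derive1n 2 f)].

(* Main.v *)
Require Import Defs.
From mathcomp Require Import all_boot all_order all_algebra.
From mathcomp Require Import all_classical all_reals all_analysis.
From mathcomp Require Import measurable_realfun.
From mathcomp Require Import ring lra.

(* Let R be the primitive of [sqrt a] vanishing at 0. For w = R(u) the equation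
   becomes [- Lap w = f(w)], where [f = (u ^ p - m u) / sqrt (a u)], and radial
   solutions correspond to [w' = - P], [P' = f(w) - (N - 1) P / r], [P(0) = 0].
   For m large the quotient [w f'(w) / f(w)] is nonincreasing where f > 0: the
   nondecreasing function [(1 + k/2) R(u) - u sqrt (a u)] >= 0 outweighs the
   terms which the assumptions on psi make small at infinity.

   Existence is by shooting on w(0). The solution with a large initial value
   crosses zero: since [q = (2p - k) / (k + 2)] is subcritical, Pohozaev's
   functional is otherwise too large at the point where w reaches a fixed level.
   A ground state decays exponentially, and so [u(x) = R^-1 (w |x|)] lies in X.

   For uniqueness, let b be the zero of f. On the range [w >= b] Pohozaev's
   identity makes [th = r P / w] increasing in r; comparing two ground states
   with [w1(0) > w2(0)] as functions of th gives [r1 P1 > r2 P2] at each level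
   of w between b and w2(0). The level functions [r_i] and [P_i] then cannot
   satisfy their differential equations both below and above the level b.

   Conversely, the profile of a solution has a bounded slope by the decay of the
   energy, and it tends to 0 since otherwise the set where u is bounded below
   would contain boxes of a fixed size arbitrarily far away, against u in L^2. *)

Import Order.TTheory GRing.Theory Num.Theory.
Import numFieldNormedType.Exports.

Local Open Scope classical_set_scope.
Local Open Scope ring_scope.

Set Implicit Arguments.
Unset Strict Implicit.
Unset Printing Implicit Defensive.

(** * Derivatives and continuity of real functions *)

(** The change of variable removes the quadratic gradient term: with [a = g ^ 2], the sum of the two
    terms containing [Du] is [g] times the radial operator acting on [P]. Since [R(u)] grows like
    [u ^ ((k + 2) / 2)] and [f] like [u ^ (p - k / 2)], [f(w)] grows like [w ^ q], and the upper
    bound on [p] says [q (N - 2) < N + 2]; below, [n] is [N - 1]. Largeness of [m] enters at one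
    point: the monotonicity of [w f' / f] rests on the behaviour of [psi] at infinity, hence is
    obtained only for [u] beyond some [U0], and the zero [m ^ (1 / (p - 1))] has to lie beyond [U0].
    This is why the properties of [f] are split: [nonlin0] serves existence, for any [m > 0], and
    [nonlin] adds what uniqueness uses. In the variable [th] the curves of two ground states obey
    equations in which [f] enters only through that quotient and through [r ^ 2 f / w], so that
    monotonicity orders them. Below the level [b] this tool is lost, and only signs of differences
    at equal levels remain. Picard iteration and continuous dependence are made global by cutting
    [f] off above the starting level. *)

Notation dv f x l := (is_derive x 1 f l).
(* A record rather than a notation, so that failing unifications do not unfold
   the filter statement. *)
Record cat (R : realType) (f : R -> R) (x : R) : Prop :=
  Cat { catE : {for x, continuous f} }.

Section calculus1.
Context (R : realType).
Implicit Types (f g : R -> R) (a b x y l : R).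

Lemma dv_eq {f x l l'} : dv f x l -> l = l' -> dv f x l'.
Proof. by move=> ? <-. Qed.

Lemma dv_cat f x l : dv f x l -> cat f x.
Proof. by move=> [df _]; constructor; apply/differentiable_continuous/derivable1_diffP. Qed.

Lemma dv_cst (c : R) x : dv (fun _ : R => c) x 0.
Proof. exact: is_derive_cst. Qed.

Lemma dv_id x : dv (fun y : R => y) x 1.
Proof. exact: is_derive_id. Qed.

Lemma dvD f g x l l' : dv f x l -> dv g x l' -> dv (fun y => f y + g y) x (l + l').
Proof. by move=> df dg; exact: is_deriveD. Qed.

Lemma dvN f x l : dv f x l -> dv (fun y => - f y) x (- l).
Proof. by move=> df; exact: is_deriveN. Qed.

Lemma dvB f g x l l' : dv f x l -> dv g x l' -> dv (fun y => f y - g y) x (l - l').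
Proof. by move=> df dg; exact: is_deriveB. Qed.

Lemma dvM f g x l l' :
  dv f x l -> dv g x l' -> dv (fun y => f y * g y) x (l * g x + f x * l').
Proof.
move=> df dg; apply: (dv_eq (is_deriveM df dg)).
by rewrite /GRing.scale/= addrC [g x * l]mulrC.
Qed.

Lemma dvX f n x l : dv f x l -> dv (fun y => f y ^+ n) x (n%:R * f x ^+ n.-1 * l).
Proof.
move=> df; elim: n => [|n IH].
  by under eq_fun do rewrite expr0; apply: (dv_eq (dv_cst _ _)); rewrite !mul0r.
under eq_fun do rewrite exprS.
apply: (dv_eq (dvM df IH)).
by case: n {IH} => [|n] /=; rewrite ?expr0 -?natr1 ?exprS; ring.
Qed.

Lemma dvV f x l : f x != 0 -> dv f x l -> dv (fun y => (f y)^-1) x (- l / f x ^+ 2).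
Proof.
move=> f0 df; apply: (dv_eq (is_deriveV f0 df)).
by rewrite /GRing.scale/= mulrC mulNr mulrN.
Qed.

Lemma dv_comp f g x l l' :
  dv f (g x) l -> dv g x l' -> dv (fun y => f (g y)) x (l * l').
Proof. by move=> df dg; exact: is_derive1_comp. Qed.

Lemma dv_near f g x l : (\forall y \near x, f y = g y) -> dv f x l -> dv g x l.
Proof.
move=> fg df.
exact: near_eq_is_derive df.
Qed.

Lemma dv_on f g x l (P : R -> Prop) : (\forall y \near x, P y) ->
  (forall y, P y -> f y = g y) -> dv f x l -> dv g x l.
Proof.
by move=> nP fg; apply: dv_near; near=> y; apply: fg; near: y.
Unshelve. all: by end_near. Qed.

Lemma near_gt x a : a < x -> \forall y \near x, a < y.
Proof. exact: lt_nbhsr. Qed.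

Lemma near_lt x a : x < a -> \forall y \near x, y < a.
Proof. exact: lt_nbhsl. Qed.

Lemma dv_expR f x l : dv f x l -> dv (fun y => expR (f y)) x (expR (f x) * l).
Proof. by move=> df; apply: (dv_comp (is_derive_expR _)). Qed.

Lemma dv_sqrt f x l : 0 < f x ->
  dv f x l -> dv (fun y => Num.sqrt (f y)) x (l / (2 * Num.sqrt (f x))).
Proof.
move=> f0 df; rewrite mulrC.
by apply: (dv_comp (is_derive1_sqrt f0)).
Qed.

Lemma dv_powR f (c : R) x l : 0 < f x ->
  dv f x l -> dv (fun y => f y `^ c) x (c * f x `^ (c - 1) * l).
Proof.
move=> f0 df.
by apply: (dv_comp (f := fun y => y `^ c)) => //; exact: is_derive1_powR.
Qed.

Lemma dv_div f g x l l' : g x != 0 -> dv f x l -> dv g x l' ->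
  dv (fun y => f y / g y) x ((l * g x - f x * l') / g x ^+ 2).
Proof.
move=> g0 df dg; apply: (dv_eq (dvM df (dvV g0 dg))).
by field.
Qed.

Lemma cat_cst (c : R) x : cat (fun _ : R => c) x.
Proof. by constructor; exact: cst_continuous. Qed.

Lemma cat_id x : cat (fun y : R => y) x.
Proof. by constructor; exact: cvg_id. Qed.

Lemma catD f g x : cat f x -> cat g x -> cat (fun y => f y + g y) x.
Proof. by move=> [cf] [cg]; constructor; apply: cvgD. Qed.

Lemma catN f x : cat f x -> cat (fun y => - f y) x.
Proof. by move=> [cf]; constructor; apply: cvgN. Qed.

Lemma catB f g x : cat f x -> cat g x -> cat (fun y => f y - g y) x.
Proof. by move=> [cf] [cg]; constructor; apply: cvgB. Qed.

Lemma catM f g x : cat f x -> cat g x -> cat (fun y => f y * g y) x.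
Proof. by move=> [cf] [cg]; constructor; apply: cvgM. Qed.

Lemma catX f n x : cat f x -> cat (fun y => f y ^+ n) x.
Proof.
move=> cf; elim: n => [|n IH].
  have -> : (fun y => f y ^+ 0) = cst 1 by apply/funext => y; rewrite expr0.
  exact: cat_cst.
have -> : (fun y => f y ^+ n.+1) = (fun y => f y * f y ^+ n).
  by apply/funext => y; rewrite exprS.
exact: catM.
Qed.

Lemma catV f x : f x != 0 -> cat f x -> cat (fun y => (f y)^-1) x.
Proof. by move=> f0 [cf]; constructor; apply: cvgV. Qed.

Lemma cat_comp f g x : cat f (g x) -> cat g x -> cat (fun y => f (g y)) x.
Proof. by move=> [cf] [cg]; constructor; apply: (continuous_comp cg cf). Qed.

Lemma cat_max f g x : cat f x -> cat g x -> cat (fun y => Num.max (f y) (g y)) x.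
Proof. by move=> [cf] [cg]; constructor; apply: continuous_max. Qed.

Lemma cat_min f g x : cat f x -> cat g x -> cat (fun y => Num.min (f y) (g y)) x.
Proof. by move=> [cf] [cg]; constructor; apply: continuous_min. Qed.

Lemma cat_norm f x : cat f x -> cat (fun y => `|f y|) x.
Proof. by move=> [cf]; constructor; apply: cvg_norm. Qed.

Lemma cat_sqrt f x : cat f x -> cat (fun y => Num.sqrt (f y)) x.
Proof.
by move=> cf; apply: (cat_comp (f := Num.sqrt)) => //; constructor; exact: sqrt_continuous.
Qed.

Lemma cat_expR x : cat (@expR R) x.
Proof. by constructor; exact: continuous_expR. Qed.

Lemma cat_near f g x : (\forall y \near x, f y = g y) -> cat f x -> cat g x.
Proof.
move=> fg [cf]; constructor; have e : f x = g x by exact: (nbhs_singleton fg).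
suff : g @ x --> g x by [].
by rewrite -e; apply: cvg_trans cf; exact: near_eq_cvg.
Qed.

Lemma cat_within f a b :
  (forall x, a <= x <= b -> cat f x) -> {within `[a, b], continuous f}.
Proof.
move=> cf; apply: continuous_in_subspaceT => x.
by rewrite inE/= in_itv/= => xab; exact: (catE (cf x xab)).
Qed.

Lemma mvt f df a b : a < b -> (forall x, a <= x <= b -> cat f x) ->
  (forall x, a < x < b -> dv f x (df x)) ->
  exists2 c, a < c < b & f b - f a = df c * (b - a).
Proof.
move=> ab cf dfx.
have dfx' x : x \in `]a, b[%R -> is_derive x 1 f (df x) by rewrite in_itv/= => /dfx.
by have [c] := MVT ab dfx' (cat_within cf); rewrite in_itv/= => cab e; exists c.
Qed.

Lemma incr f df a b : a < b -> (forall x, a <= x <= b -> cat f x) ->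
  (forall x, a < x < b -> dv f x (df x)) ->
  (forall x, a < x < b -> 0 < df x) -> f a < f b.
Proof.
move=> ab cf dfx h; have [c /h c0 e] := mvt ab cf dfx.
by rewrite -subr_gt0 e mulr_gt0// subr_gt0.
Qed.

Lemma ndecr f df a b : a <= b -> (forall x, a <= x <= b -> cat f x) ->
  (forall x, a < x < b -> dv f x (df x)) ->
  (forall x, a < x < b -> 0 <= df x) -> f a <= f b.
Proof.
rewrite le_eqVlt => /predU1P[-> //|ab] cf dfx h.
have [c /h c0 e] := mvt ab cf dfx.
by rewrite -subr_ge0 e mulr_ge0// subr_ge0 ltW.
Qed.

Lemma decr f df a b : a < b -> (forall x, a <= x <= b -> cat f x) ->
  (forall x, a < x < b -> dv f x (df x)) ->
  (forall x, a < x < b -> df x < 0) -> f b < f a.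
Proof.
move=> ab cf dfx h; have [c /h c0 e] := mvt ab cf dfx.
by rewrite -subr_lt0 e nmulr_rlt0// subr_gt0.
Qed.

Lemma nincr f df a b : a <= b -> (forall x, a <= x <= b -> cat f x) ->
  (forall x, a < x < b -> dv f x (df x)) ->
  (forall x, a < x < b -> df x <= 0) -> f b <= f a.
Proof.
rewrite le_eqVlt => /predU1P[-> //|ab] cf dfx h.
have [c /h c0 e] := mvt ab cf dfx.
by rewrite -subr_le0 e mulr_le0_ge0// subr_ge0 ltW.
Qed.

Lemma ivt f a b v : a <= b -> (forall x, a <= x <= b -> cat f x) ->
  f a <= v <= f b -> exists2 c, a <= c <= b & f c = v.
Proof.
move=> ab cf /andP[av vb].
have [|c] := IVT ab (cat_within cf) (v := v).
  by rewrite (min_idPl _) ?(le_trans av)// (max_idPr _) ?av// (le_trans av).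
by rewrite in_itv/= => ? ?; exists c.
Qed.

Lemma ivt_decr f a b v : a <= b -> (forall x, a <= x <= b -> cat f x) ->
  f b <= v <= f a -> exists2 c, a <= c <= b & f c = v.
Proof.
move=> ab cf v_; have [||c ? /oppr_inj] := ivt (f := fun x => - f x) (v := - v) ab.
- by move=> x /cf; exact: catN.
- by rewrite !lerN2 andbC.
- by exists c.
Qed.

Lemma evt_max f a b : a <= b -> (forall x, a <= x <= b -> cat f x) ->
  exists2 c, a <= c <= b & forall x, a <= x <= b -> f x <= f c.
Proof.
move=> ab cf; have [c cab h] := EVT_max ab (cat_within cf).
by exists c; [rewrite in_itv in cab|move=> x xab; apply: h; rewrite in_itv].
Qed.

Lemma evt_min f a b : a <= b -> (forall x, a <= x <= b -> cat f x) ->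
  exists2 c, a <= c <= b & forall x, a <= x <= b -> f c <= f x.
Proof.
move=> ab cf; have [c cab h] := EVT_min ab (cat_within cf).
by exists c; [rewrite in_itv in cab|move=> x xab; apply: h; rewrite in_itv].
Qed.

Lemma cat_gt f x c : cat f x -> c < f x -> \forall y \near x, c < f y.
Proof. by move=> [cf] cx; exact: (cvgr_gt _ cf _ cx). Qed.

Lemma cat_lt f x c : cat f x -> f x < c -> \forall y \near x, f y < c.
Proof. by move=> [cf] cx; exact: (cvgr_lt _ cf _ cx). Qed.

Lemma near_ball (P : R -> Prop) x : (\forall y \near x, P y) ->
  exists2 e : R, 0 < e & forall y, x - e < y < x + e -> P y.
Proof.
move=> /nbhs_ballP[e /= e0 h]; exists e => // y /andP[y1 y2]; apply: h.
by rewrite /ball/= ltr_distlC y1 y2.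
Qed.

(** The zero is the supremum of the points up to which [f] stays positive. Continuation arguments
    below run through this lemma; where the last zero before a point is wanted, it is applied in the
    reversed variable [b - t]. *)
Lemma first_zero f a b : a < b -> (forall x, a <= x <= b -> cat f x) ->
  0 < f a -> f b <= 0 ->
  exists c, [/\ a < c <= b, f c = 0 & forall x, a <= x < c -> 0 < f x].
Proof.
move=> ab cf fa fb.
pose A := [set x | a <= x <= b /\ forall y, a <= y <= x -> 0 < f y].
have Aa : A a.
  by split; [rewrite lexx ltW|move=> y yy; rewrite -(le_anti yy)].
have supA : has_sup A.
  by split; [exists a|exists b => x [/andP[]]].
pose c := sup A.
have ac : a <= c by apply: ub_le_sup => //; case: supA.
have cb : c <= b by apply: ge_sup; [exists a|move=> x [/andP[]]].
have fpos x : a <= x < c -> 0 < f x.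
  move=> /andP[ax xc].
  have cx : 0 < c - x by rewrite subr_gt0.
  have [y [_ Ay] xy] := sup_adherent cx supA.
  by apply: Ay; rewrite ax ltW//; move: xy; rewrite subKr.
have cc : cat f c by apply: cf; rewrite ac.
have fc0 : f c <= 0.
  rewrite leNgt; apply/negP => fc.
  have cltb : c < b.
    by rewrite lt_neqAle cb andbT; apply: contraTneq fc => ->; rewrite -leNgt.
  have [e e0 he] := near_ball (cat_gt cc fc).
  pose d := Num.min (c + e / 2) b.
  have cd : c < d by rewrite lt_min cltb ltrDl divr_gt0.
  suff : A d by move=> /ub_le_sup => /(_ (proj2 supA)); rewrite leNgt cd.
  split; first by rewrite (le_trans ac (ltW cd))/= ge_min lexx orbT.
  move=> y /andP[ay yd]; have [yc|cy] := ltP y c; first by apply: fpos; rewrite ay.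
  apply: he; rewrite (lt_le_trans _ cy) ?gtrDl ?oppr_lt0//=.
  have : y <= c + e / 2 by rewrite (le_trans yd)// ge_min lexx.
  by lra.
have aLc : a < c.
  by rewrite lt_neqAle ac andbT; apply: contraTneq fc0 => <-; rewrite -ltNge.
exists c; split => //; first by rewrite aLc.
apply/eqP; rewrite eq_le fc0 leNgt; apply/negP => fc1.
have [e e0 he] := near_ball (cat_lt cc fc1).
have [y1 y2] : Num.max a (c - e / 2) < c /\ c - e / 2 <= Num.max a (c - e / 2).
  by rewrite gt_max aLc le_max lexx orbT; split => //; lra.
have /fpos : a <= Num.max a (c - e / 2) < c by rewrite le_max lexx.
by rewrite ltNge ltW// he//; lra.
Qed.

Lemma primitive_from g a : (forall x, cat g x) ->
  exists G : R -> R, forall x, a < x -> dv G x (g x).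
Proof.
move=> cg; pose F x := \int[lebesgue_measure]_(t in `[a, x]) g t.
have dF x : a < x -> derivable F x 1 /\ derive1 F x = g x.
  move=> ax; apply: (@continuous_FTC1_closed R g a x (x + 1) _ _ ax (catE (cg x))).
    by rewrite ltrDl.
  apply: continuous_compact_integrable; first exact: segment_compact.
  by apply: continuous_subspaceT => y; exact: (catE (cg y)).
clearbody F; exists F => x /dF[d1 d2]; constructor; first exact: d1.
by rewrite -derive1E.
Qed.

(** An integral from a fixed base point is a primitive only to the right of it. The primitives based
    at [- n] are normalized at 0, so that any two agree on their common domain, and the size of [x]
    selects one. *)
Lemma primitive g : (forall x, cat g x) ->
  exists G : R -> R, (forall x, dv G x (g x)) /\ G 0 = 0.
Proof.
move=> cg.
have P n : exists G : R -> R, forall x, - n%:R < x -> dv G x (g x) by exact: primitive_from.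
have [G GP] := choice P.
have indep m n x : - m%:R < x -> - n%:R < x -> (0 < m)%N -> (0 < n)%N ->
    G m x - G m 0 = G n x - G n 0.
  move=> mx nx m0 n0.
  have dH y : - m%:R < y -> - n%:R < y -> dv (fun y => G m y - G n y) y 0.
    move=> my ny; apply: dv_eq; first by apply: dvB; exact: GP.
    by rewrite subrr.
  have mm : - m%:R < 0 :> R by rewrite oppr_lt0 ltr0n.
  have nn : - n%:R < 0 :> R by rewrite oppr_lt0 ltr0n.
  suff : G m x - G n x = G m 0 - G n 0 by lra.
  have [x0|x0|->//] := ltgtP x 0.
    have [||c _] := mvt (f := fun y => G m y - G n y) (df := fun _ => 0) x0.
    - by move=> y /andP[xy _]; apply: dv_cat; apply: dH; apply: lt_le_trans xy.
    - by move=> y /andP[xy _]; apply: dH; apply: lt_trans xy.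
    - by rewrite mul0r; lra.
  have [||c _] := mvt (f := fun y => G m y - G n y) (df := fun _ => 0) x0.
  - by move=> y /andP[xy _]; apply: dv_cat; apply: dH; apply: lt_le_trans xy.
  - by move=> y /andP[xy _]; apply: dH; apply: lt_trans xy.
  - by rewrite mul0r; lra.
pose N (x : R) := (Num.truncn `|x|).+1.
have NP x : - (N x)%:R < x.
  have := truncnS_gt `|x|; rewrite -/(N x) => h.
  by rewrite ltrNl (le_lt_trans _ h)// -normrN ler_norm.
exists (fun x => G (N x) x - G (N x) 0); split; last by rewrite subrr.
move=> x; apply: (dv_on (f := fun y => G (N x) y - G (N x) 0) (P := fun y => - (N x)%:R < y)).
- exact: near_gt.
- by move=> y hy; apply: indep.
- by apply: (dv_eq (dvB (GP _ _ (NP x)) (dv_cst _ x))); rewrite subr0.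
Qed.

Lemma dv_inverse (g h : R -> R) l x : (\forall y \near x, h (g y) = y) ->
  (\forall y \near x, cat g y) -> dv g x l -> l != 0 -> dv h (g x) l^-1.
Proof. by move=> hg cg dg l0; apply: (is_derive_inverse hg _ dg l0); near=> y; apply: catE; near: y.
Unshelve. all: by end_near. Qed.

End calculus1.

Ltac catt := repeat (first
 [ exact: cat_id | exact: cat_cst | solve [auto 3]
 | eapply catD | eapply catB | eapply catN | eapply catM | eapply catX
 | eapply (cat_comp (f := expR)); [exact: cat_expR|] ]).
Ltac dvt := repeat (first
 [ exact: dv_id | exact: dv_cst | eassumption
 | eapply dvD | eapply dvB | eapply dvN | eapply dvM | eapply dvX | eapply dv_expR]).
Ltac pos := repeat first
 [ assumption | apply: ltW; assumption | exact: ltr01 | exact: ler01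
 | apply: ler0n | rewrite ltr0n; exact: isT | apply: expR_ge0 | apply: expR_gt0
 | apply: sqr_ge0 | apply: normr_ge0 | apply: sqrtr_ge0 | apply: powR_ge0 | apply: powR_gt0
 | rewrite invr_ge0 | rewrite invr_gt0
 | apply: mulr_ge0 | apply: mulr_gt0 | apply: addr_ge0 | apply: addr_gt0
 | apply: exprn_ge0 | apply: exprn_gt0 ].
Ltac der := eapply dv_eq; [solve [dvt]|cbv beta].

(** * The radial initial value problem *)

(** [n] is the space dimension minus one. Because of the singular term the equations are required
    for [r > 0] only; the behaviour at 0 is encoded by continuity and [P 0 = 0], and for negative
    [r] nothing but continuity is asked. *)
Definition radial_sol (R : realType) (f : R -> R) (n : nat) (w P : R -> R) :=
  [/\ forall r : R, cat w r, forall r : R, cat P r, P 0 = 0,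
      forall r : R, 0 < r -> dv w r (- P r) &
      forall r : R, 0 < r -> dv P r (f (w r) - n%:R * P r / r)].

Section ode.
Context (R : realType).
Implicit Types (f g w P : R -> R) (n : nat) (r s t x y z : R).

Lemma le_geometric (x c : R) : (forall k, x <= c / 2 ^+ k) -> x <= 0.
Proof.
move=> h; rewrite leNgt; apply/negP => x0.
have c0 : 0 < c by have := h 0%N; rewrite expr0; lra.
have /andP[_ hk] := truncn_itv (ltW (divr_gt0 c0 x0)).
set k := (Num.truncn _).+1 in hk.
have k2 : (k%:R : R) <= 2 ^+ k by rewrite -natrX ler_nat ltnW// ltn_expl.
have := h k; rewrite ler_pdivlMr ?exprn_gt0// leNgt => /negP; apply.
by rewrite mulrC -ltr_pdivrMr// (lt_le_trans hk).
Qed.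

(** [x k - 2 c / 2 ^ k] increases, [x k + 2 c / 2 ^ k] decreases, and the former stay below the
    latter: the supremum of the lower bounds is the limit, with the error estimate built in. *)
Lemma geometric_limit (x : R^nat) (c : R) :
  (forall k, `|x k.+1 - x k| <= c / 2 ^+ k) ->
  exists l, forall k, `|l - x k| <= 2 * c / 2 ^+ k.
Proof.
move=> h.
pose a k := x k - 2 * c / 2 ^+ k; pose b k := x k + 2 * c / 2 ^+ k.
have c0 : 0 <= c by have := h 0%N; rewrite expr0 divr1; apply: le_trans.
have e k : 2 * c / 2 ^+ k = 2 * (c / 2 ^+ k) by rewrite mulrA.
have e1 k : c / 2 ^+ k.+1 = c / 2 ^+ k / 2 by rewrite exprS; field.
have c_ge0 k : 0 <= c / 2 ^+ k by rewrite divr_ge0.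
have aS k : a k <= a k.+1.
  by have := h k; rewrite /a !e !e1 ler_norml => /andP[]; lra.
have bS k : b k.+1 <= b k.
  by have := h k; rewrite /b !e !e1 ler_norml => /andP[]; lra.
have am k j : a k <= a (k + j)%N.
  by elim: j => [|j IH]; rewrite ?addn0// addnS (le_trans IH).
have bm k j : b (k + j)%N <= b k.
  by elim: j => [|j IH]; rewrite ?addn0// addnS (le_trans _ IH).
have ab k j : a k <= b j.
  apply: le_trans (am k j) _; apply: le_trans (_ : b (k + j)%N <= _).
    by rewrite /a /b !e; have := c_ge0 (k + j)%N; lra.
  by rewrite addnC bm.
have supa : has_sup (range a).
  by split; [exists (a 0%N); exists 0%N|exists (b 0%N) => _ [k _ <-]].
exists (sup (range a)) => k.
have h1 : a k <= sup (range a) by apply: sup_upper_bound => //; exists k.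
have h2 : sup (range a) <= b k.
  by apply: ge_sup; [case: supa|move=> _ [j _ <-]].
by rewrite ler_norml; move: h1 h2; rewrite /a /b; lra.
Qed.

Lemma lipschitz_cat f (x c : R) :
  (forall y, `|y - x| < 1 -> `|f y - f x| <= c * `|y - x|) -> cat f x.
Proof.
move=> h; constructor; apply/cvgrPdist_lt => e e0.
have d0 : 0 < e / (`|c| + 1) by rewrite divr_gt0// ltr_wpDl.
near=> y; rewrite distrC.
have y1 : `|y - x| < 1.
  by near: y; apply/nbhs_ballP; exists 1 => //= z; rewrite /ball/= distrC.
have y2 : `|y - x| < e / (`|c| + 1).
  by near: y; apply/nbhs_ballP; exists (e / (`|c| + 1)) => //= z; rewrite /ball/= distrC.
apply: le_lt_trans (h _ y1) _.
apply: le_lt_trans (_ : (`|c| + 1) * `|y - x| < e).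
  by apply: ler_wpM2r => //; have := ler_norm c; lra.
by rewrite mulrC -ltr_pdivlMr// ltr_wpDl.
Unshelve. all: by end_near. Qed.

(** [s ^ n] is the integrating factor of the singular term: the flux [s ^ n * P] sees only the
    source [g], which is why many estimates below are made on the flux. *)
Lemma flux_deriv n g P r : 0 < r -> dv P r (g r - n%:R * P r / r) ->
  dv (fun s => s ^+ n * P s) r (r ^+ n * g r).
Proof.
move=> r0 dP; der; case: n {dP} => [|n] /=; first by rewrite !expr0; ring.
by rewrite exprS; field; rewrite gt_eqF.
Qed.

(** The bound is a supersolution: the flux of [c / lam * expR (lam * s)] has derivative
    [s ^ n * c * expR (lam * s)] plus a nonnegative term. One factor [1 / lam] is gained per
    integration. *)
Lemma flux_le n g P (c lam : R) : (0 < n)%N -> 0 < lam -> 0 <= c ->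
  (forall r, cat P r) -> P 0 = 0 ->
  (forall r, 0 < r -> dv P r (g r - n%:R * P r / r)) ->
  (forall r, 0 < r -> g r <= c * expR (lam * r)) ->
  forall r, 0 <= r -> P r <= c / lam * expR (lam * r).
Proof.
move=> n0 lam0 c0 cP P0 dP gle r; rewrite le_eqVlt => /predU1P[<-|r0].
  by rewrite P0 mulr0 expR0 mulr1 divr_ge0// ltW.
have := @ndecr _ (fun s => s ^+ n * (c / lam * expR (lam * s)) - s ^+ n * P s)
  (fun s => n%:R * s ^+ n.-1 * (c / lam * expR (lam * s)) +
    s ^+ n * (c * expR (lam * s)) - s ^+ n * g s) 0 r (ltW r0).
rewrite expr0n gtn_eqF// !mul0r subrr -mulrBr => h.
have : 0 <= r ^+ n * (c / lam * expR (lam * r) - P r).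
  apply: h => s.
  - by move=> _; catt.
  - move=> /andP[s0 _]; have dF := flux_deriv s0 (dP _ s0).
    by der; field; rewrite gt_eqF.
  - move=> /andP[s0 _]; rewrite -addrA -mulrBr addr_ge0//.
      by pos.
    apply: mulr_ge0; first by pos.
    by rewrite subr_ge0 gle.
by rewrite pmulr_rge0 ?exprn_gt0// subr_ge0.
Qed.

Lemma flux_norm_le n g P (c lam : R) : (0 < n)%N -> 0 < lam -> 0 <= c ->
  (forall r, cat P r) -> P 0 = 0 ->
  (forall r, 0 < r -> dv P r (g r - n%:R * P r / r)) ->
  (forall r, 0 < r -> `|g r| <= c * expR (lam * r)) ->
  forall r, 0 <= r -> `|P r| <= c / lam * expR (lam * r).
Proof.
move=> n0 lam0 c0 cP P0 dP gle r r0; rewrite ler_norml lerNl; apply/andP; split.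
  apply: (@flux_le n (fun s => - g s) (fun s => - P s)) => //.
  - by move=> s; catt.
  - by rewrite P0 oppr0.
  - by move=> s s0; have := dP _ s0 => d; der; field; rewrite gt_eqF.
  - by move=> s s0; apply: le_trans (gle _ s0); rewrite -normrN ler_norm.
apply: (@flux_le n g P) => //.
by move=> s s0; apply: le_trans (gle _ s0); rewrite ler_norm.
Qed.

Lemma integral_norm_le (w P : R -> R) (c lam : R) : 0 < lam -> 0 <= c ->
  (forall r, cat w r) -> w 0 = 0 ->
  (forall r, 0 < r -> dv w r (- P r)) ->
  (forall r, 0 < r -> `|P r| <= c * expR (lam * r)) ->
  forall r, 0 <= r -> `|w r| <= c / lam * expR (lam * r).
Proof.
move=> lam0 c0 cw w0 dw Ple r r0.
have key (e : R) : e = 1 \/ e = -1 -> e * w r <= c / lam * expR (lam * r).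
  move=> he.
  have h := @ndecr _ (fun s => c / lam * expR (lam * s) - e * w s)
    (fun s => c * expR (lam * s) + e * P s) 0 r r0.
  have : c / lam * expR (lam * 0) - e * w 0 <= c / lam * expR (lam * r) - e * w r.
    apply: h => s.
    - by move=> _; catt.
    - by move=> /andP[s0 _]; have := dw _ s0 => d; der; field; rewrite gt_eqF.
    - move=> /andP[/Ple + _]; rewrite ler_norml => /andP[].
      by case: he => ->; lra.
  rewrite w0 !mulr0 expR0 subr0 mulr1.
  have : 0 <= c / lam by pos.
  by lra.
rewrite ler_norml lerNl; have := key 1; have := key (-1).
by rewrite mulN1r mul1r => -> ; [move=> ->; [|left]|right].
Qed.

(** The solution is the primitive of [t ^ n * g t] divided by [r ^ n], extended by 0. Continuity at
    0 comes from bounding [P r] by [r] times the maximum of [|g|] on [[0, 1]]. *)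
Lemma flux_exists n g : (0 < n)%N -> (forall r, cat g r) ->
  exists P, [/\ forall r, cat P r, forall r, r <= 0 -> P r = 0 &
    forall r, 0 < r -> dv P r (g r - n%:R * P r / r)].
Proof.
move=> n0 cg.
have ct t : cat (fun t => t ^+ n * g t) t by catt.
have [G [dG G0]] := primitive ct.
pose P r := if r <= 0 then 0 else G r / r ^+ n.
have Pneg r : r <= 0 -> P r = 0 by rewrite /P => ->.
have Ppos r : 0 < r -> P r = G r / r ^+ n by rewrite /P leNgt => ->.
have dP r : 0 < r -> dv P r (g r - n%:R * P r / r).
  move=> r0; apply: (dv_on (f := fun s => G s / s ^+ n) (P := fun s => 0 < s)).
  - exact: near_gt.
  - by move=> s /Ppos.
  - have dGr := dG r.
    have rn0 : r ^+ n != 0 by rewrite expf_neq0// gt_eqF.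
    have dX := dvX n (dv_id r).
    apply: (dv_eq (dv_div (g := fun s => s ^+ n) rn0 dGr dX)).
    rewrite Ppos//; case: (n) n0 rn0 => // k _ rn0.
    by rewrite !exprS/=; field; rewrite gt_eqF//= expf_neq0// gt_eqF.
exists P; split => // r; have [r0|r0|->] := ltgtP r 0.
- apply: (cat_near (f := fun=> 0)); last exact: cat_cst.
  by near=> s; rewrite Pneg// ltW//; near: s; exact: near_lt.
- by apply: dv_cat (dP _ r0).
- have [c /= _ hc] := @evt_max R (fun s => `|g s|) 0 1 ler01 (fun x _ => cat_norm (cg x)).
  have c0 : 0 <= `|g c| by [].
  have GB s : 0 < s -> s <= 1 -> `|G s| <= `|g c| * s ^+ n.+1.
    move=> s0 s1.
    have [t /andP[t0 ts] e] := mvt s0 (fun x _ => dv_cat (dG x)) (fun x _ => dG x).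
    move: e; rewrite G0 !subr0 => ->.
    have t01 : 0 <= t <= 1 by rewrite ltW//= (le_trans (ltW ts)).
    have tn : 0 <= t ^+ n by pos.
    rewrite !normrM (ger0_norm (ltW s0)) (ger0_norm tn) exprSr mulrA ler_pM2r// mulrC.
    apply: ler_pM => //; first exact: hc.
    by apply: lerXn2r; rewrite ?nnegrE; pos.
  apply: (@lipschitz_cat P 0 `|g c|) => y; rewrite (Pneg 0)// !subr0 => y1.
  have [y0|y0] := leP y 0; first by rewrite Pneg// normr0 mulr_ge0.
  have yn : 0 <= y ^+ n by pos.
  rewrite Ppos// normrM normfV (ger0_norm yn).
  rewrite ler_pdivrMr ?exprn_gt0// (gtr0_norm y0) -mulrA -exprS GB//.
  by move: y1; rewrite gtr0_norm// => /ltW.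
Unshelve. all: by end_near. Qed.

(** Continuity of [w] is a premise inside the existential, so that [choice] can turn this into a map
    on all functions; a discontinuous [w] gets a dummy pair. For [r <= 0] the output is frozen at
    its initial value. *)
Lemma picard_step n f (al : R) w : (0 < n)%N -> (forall s, cat f s) ->
  exists q : (R -> R) * (R -> R), (forall r, cat w r) ->
  [/\ forall r, dv q.1 r (- q.2 r), forall r, cat q.2 r,
      forall r, r <= 0 -> q.2 r = 0 /\ q.1 r = al &
      forall r, 0 < r -> dv q.2 r (f (w r) - n%:R * q.2 r / r)].
Proof.
move=> n0 cf; have [cw|nc] := pselect (forall r, cat w r); last by exists (w, w).
have [P [cP Pneg dP]] := @flux_exists n (fun r => f (w r)) n0
  (fun r => cat_comp (cf _) (cw r)).
have [G [dG G0]] := @primitive R P cP.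
exists (fun r => al - G r, P) => _; split => //= [r|r r0].
  by have := dG r => d; der; rewrite sub0r.
split; first exact: Pneg.
move: r0; rewrite le_eqVlt => /predU1P[->|r0]; first by rewrite G0 subr0.
have [c /andP[_ c0]] := mvt r0 (fun x _ => dv_cat (dG x)) (fun x _ => dG x).
by rewrite G0 sub0r Pneg ?ltW// mul0r => /eqP; rewrite oppr_eq0 => /eqP ->; rewrite subr0.
Qed.

(** Picard iteration. Boundedness of [f] gives the iterates a common Lipschitz constant on each
    half-line [r <= T]; an exponential weight makes the iteration contract on the whole line at
    once. *)
Lemma ode_exists n f (B L al : R) : (0 < n)%N ->
  (forall s, `|f s| <= B) -> (forall s t, `|f s - f t| <= L * `|s - t|) ->
  exists w P, radial_sol f n w P /\ w 0 = al.
Proof.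
move=> n0 fB fL.
have B0 : 0 <= B by apply: le_trans (fB 0).
have L0 : 0 <= L.
  by have := fL 1 0; rewrite subr0 normr1 mulr1; apply: le_trans.
have cf s : cat f s by apply: (@lipschitz_cat f s L) => y _; exact: fL.
have [Phi HPhi] := choice (fun w => @picard_step n f al w n0 cf).
pose W k := iter k (fun w => (Phi w).1) (fun=> al).
pose Q k := (Phi (W k)).2.
have cW k r : cat (W k) r.
  elim: k r => [|k IH] r; first exact: cat_cst.
  by have [d _ _ _] := HPhi _ IH; exact: dv_cat (d r).
have dW k r : dv (W k.+1) r (- Q k r) by have [d _ _ _] := HPhi _ (cW k).
have cQ k r : cat (Q k) r by have [_ ] := HPhi _ (cW k).
have Q0 k r : r <= 0 -> Q k r = 0 by have [_ _ h _] := HPhi _ (cW k) => /h[].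
have W0 k r : r <= 0 -> W k r = al.
  by case: k => // k; have [_ _ h _] := HPhi _ (cW k) => /h[].
have dQ k r : 0 < r -> dv (Q k) r (f (W k r) - n%:R * Q k r / r).
  by have [_ _ _] := HPhi _ (cW k); exact.
(* Two integrations each gain [1 / lam] and the nonlinearity costs [L], so the contraction factor is
   [L / lam ^ 2 <= 1 / 2]. *)
pose lam := 2 * L + 2.
have lam0 : 0 < lam by rewrite /lam; lra.
have lamL : L / lam / lam <= 2^-1.
  rewrite ler_pdivrMr// ler_pdivrMr// /lam.
  by have := mulr_ge0 L0 L0; lra.
(* the linear map [w |-> f o w |-> P |-> w'] contracts by 1/2 in the norm
   with weight [expR (- lam * r)] *)
have contr (w1 w2 u1 u2 P1 P2 : R -> R) (c : R) : 0 <= c ->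
    (forall r, cat P1 r) -> (forall r, cat P2 r) -> P1 0 = 0 -> P2 0 = 0 ->
    (forall r, dv u1 r (- P1 r)) -> (forall r, dv u2 r (- P2 r)) -> u1 0 = u2 0 ->
    (forall r, 0 < r -> dv P1 r (f (w1 r) - n%:R * P1 r / r)) ->
    (forall r, 0 < r -> dv P2 r (f (w2 r) - n%:R * P2 r / r)) ->
    (forall r, 0 < r -> `|w1 r - w2 r| <= c * expR (lam * r)) ->
    forall r, 0 <= r -> `|u1 r - u2 r| <= c / 2 * expR (lam * r).
  move=> c0 cP1 cP2 P10 P20 du1 du2 u0 dP1 dP2 hw r r0.
  have Ple s : 0 <= s -> `|P1 s - P2 s| <= L * c / lam * expR (lam * s).
    apply: (@flux_norm_le n (fun s => f (w1 s) - f (w2 s)) (fun s => P1 s - P2 s)) => //.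
    - exact: mulr_ge0.
    - by move=> t; catt.
    - by rewrite P10 P20 subrr.
    - move=> t t0; have := dP1 t t0 => d1; have := dP2 t t0 => d2.
      by der; field; rewrite gt_eqF.
    - by move=> t t0; apply: le_trans (fL _ _) _; rewrite -mulrA ler_wpM2l// hw.
  have := @integral_norm_le (fun s => u1 s - u2 s) (fun s => P1 s - P2 s)
    (L * c / lam) lam lam0.
  move=> /(_ _ _ _ _ _ r r0) h; apply: le_trans (h _ _ _ _ _) _.
  - by pos.
  - by move=> t; apply: catB; [exact: dv_cat (du1 t)|exact: dv_cat (du2 t)].
  - by rewrite u0 subrr.
  - move=> t t0; have := du1 t => d1; have := du2 t => d2.
    by der; ring.
  - by move=> t /ltW; exact: Ple.
  - rewrite ler_wpM2r ?expR_ge0//.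
    rewrite (_ : L * c / lam / lam = c * (L / lam / lam)); last by ring.
    by rewrite ler_wpM2l.
have Q_le k r : 0 <= r -> `|Q k r| <= B / lam * expR (lam * r).
  apply: (@flux_norm_le n (fun s => f (W k s)) (Q k)) => //.
  - exact: Q0.
  - move=> s s0; apply: le_trans (fB _) _; rewrite ler_peMr//.
    by rewrite -expR0 ler_expR mulr_ge0 ?ltW.
pose C := B / lam / lam.
have C0 : 0 <= C by rewrite /C; pos.
have diff k r : 0 <= r -> `|W k.+1 r - W k r| <= C / 2 ^+ k * expR (lam * r).
  elim: k r => [|k IH] r r0.
    rewrite expr0 divr1.
    apply: (@integral_norm_le (fun r => W 1%N r - W 0%N r) (Q 0%N) (B / lam) lam lam0 _ _ _ _ _ r r0).
    - by pos.
    - by move=> s; apply: catB; exact: cW.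
    - by rewrite !W0 ?subrr.
    - move=> s s0; have := dW 0%N s => d; have := dv_cst al s => d2.
      by der; ring.
    - by move=> s /ltW; exact: Q_le.
  rewrite (_ : C / 2 ^+ k.+1 = C / 2 ^+ k / 2); last first.
    by rewrite exprS invfM mulrCA mulrC.
  apply: (@contr (W k.+1) (W k) (W k.+2) (W k.+1) (Q k.+1) (Q k)) => //.
  - by pos.
  - by rewrite Q0.
  - by rewrite Q0.
  - by rewrite !W0.
  - by move=> s /ltW; exact: IH.
have lim r : exists l, forall k, `|l - W k r| <= 2 * C / 2 ^+ k * expR (lam * Num.max r 0).
  have [r0|r0] := leP r 0.
    exists al => k; rewrite W0// subrr normr0 mulr_ge0 ?expR_ge0//.
    by pos.
  have [|l hl] := @geometric_limit (fun k => W k r) (C * expR (lam * r)).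
    by move=> k; have := diff k r (ltW r0); rewrite mulrAC.
  by exists l => k; have := hl k; rewrite mulrA mulrAC.
have [w hw] := choice lim.
(* Convergence is uniform on [r <= T], and the common Lipschitz constant of the iterates passes to
   the limit. *)
have cw x : cat w x.
  pose T := Num.max x 0 + 1.
  have m0 : 0 <= Num.max x 0 by rewrite le_max lexx orbT.
  have mx : x <= Num.max x 0 by rewrite le_max lexx.
  have T0 : 0 <= T by rewrite /T; lra.
  have WL k y z : y < z -> z <= T -> `|W k z - W k y| <= B / lam * expR (lam * T) * `|z - y|.
    move=> yz zT; have h0 : 0 <= B / lam * expR (lam * T).
      by pos.
    case: k => [|k]; first by rewrite subrr normr0 mulr_ge0.
    have [t /andP[yt tz] ->] := mvt yz (fun x _ => dv_cat (dW k x)) (fun x _ => dW k x).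
    rewrite normrM ler_wpM2r// normrN.
    have [t0|t0] := leP t 0; first by rewrite Q0// normr0.
    apply: le_trans (Q_le k t (ltW t0)) _.
    rewrite ler_wpM2l ?divr_ge0 ?(ltW lam0)// ler_expR ler_pM2l//.
    by rewrite ltW// (lt_le_trans tz).
  have wL y z : y < z -> z <= T -> `|w z - w y| <= B / lam * expR (lam * T) * `|z - y|.
    move=> yz zT; rewrite -subr_le0.
    apply: (@le_geometric _ (2 * (2 * C * expR (lam * T)))) => k.
    have h1 := WL k _ _ yz zT.
    have hT v : v <= T -> `|w v - W k v| <= 2 * C / 2 ^+ k * expR (lam * T).
      move=> vT; apply: le_trans (hw v k) _; rewrite ler_wpM2l//.
        by pos.
      by rewrite ler_expR ler_pM2l// ge_max vT.
    have h2 := hT _ zT; have h3 := hT _ (ltW (lt_le_trans yz zT)).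
    have -> : 2 * (2 * C * expR (lam * T)) / 2 ^+ k = 2 * (2 * C / 2 ^+ k * expR (lam * T)).
      by ring.
    have -> : w z - w y = (w z - W k z) - (w y - W k y) + (W k z - W k y) by ring.
    have := ler_normD ((w z - W k z) - (w y - W k y)) (W k z - W k y).
    have := ler_normB (w z - W k z) (w y - W k y).
    by lra.
  apply: (@lipschitz_cat w x (B / lam * expR (lam * T))) => y yx.
  have xT : x <= T by rewrite /T; lra.
  have yT : y <= T.
    by have := ler_norm (y - x); rewrite /T; lra.
  have [h|h|->] := ltgtP y x; last by rewrite !subrr normr0 mulr0.
  - by rewrite distrC [`|y - x|]distrC; exact: wL.
  - exact: wL.
(* One more Picard step, applied to the limit: by contraction its image is the limit itself, which
   therefore solves the equation. *)
have [q /(_ cw)[du cP neg dP]] := @picard_step n f al w n0 cf.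
have uw : q.1 = w.
  apply/funext => r.
  have [r0|r0] := leP r 0.
    rewrite (neg r r0).2; apply/eqP; rewrite -subr_eq0 -normr_le0.
    apply: (@le_geometric _ (2 * C * expR (lam * Num.max r 0))) => k.
    by have := hw r k; rewrite W0// distrC mulrAC.
  apply/eqP; rewrite -subr_eq0 -normr_le0.
  apply: (@le_geometric _ (2 * (2 * C * expR (lam * r)))) => k.
  have h1 : `|q.1 r - W k.+1 r| <= 2 * C / 2 ^+ k / 2 * expR (lam * r).
    apply: (@contr w (W k) q.1 (W k.+1) q.2 (Q k)) (ltW r0) => //.
    - by pos.
    - by rewrite (neg 0 _).1.
    - by rewrite Q0.
    - by rewrite (neg 0 _).2// W0.
    - by move=> s s0; have := hw s k; rewrite max_l// ltW.
  have h2 := hw r k.+1; rewrite (max_l (ltW r0)) in h2.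
  have e : 2 * C / 2 ^+ k.+1 = C / 2 ^+ k by rewrite exprS; field.
  rewrite {}e in h2.
  have := ler_normB (q.1 r - W k.+1 r) (w r - W k.+1 r).
  rewrite (_ : _ - _ - (_ - _) = q.1 r - w r); last by ring.
  have := mulr_ge0 (divr_ge0 C0 (exprn_ge0 k (ler0n _ 2))) (expR_ge0 (lam * r)).
  by lra.
exists w, q.2; split; last by rewrite -uw (neg 0 _).2.
split => //; first by rewrite (neg 0 _).1.
by move=> r _; rewrite -uw.
Qed.

(** Gronwall's argument for the squared distance in the [(w, P)] plane. The singular term
    contributes [- 2 n (P1 - P2) ^ 2 / r], which has the good sign, so that only [L] enters the
    exponential. *)
Lemma radial_sol_diff n f w1 P1 w2 P2 (L T : R) :
  radial_sol f n w1 P1 -> radial_sol f n w2 P2 ->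
  (forall r, 0 < r < T -> `|f (w1 r) - f (w2 r)| <= L * `|w1 r - w2 r|) ->
  0 <= L -> forall r, 0 <= r <= T ->
  (w1 r - w2 r) ^+ 2 + (P1 r - P2 r) ^+ 2 <= (w1 0 - w2 0) ^+ 2 * expR ((L + 1) * r).
Proof.
move=> [cw1 cP1 P10 dw1 dP1] [cw2 cP2 P20 dw2 dP2] fL L0 r /andP[r0 rT].
pose S r := (w1 r - w2 r) ^+ 2 + (P1 r - P2 r) ^+ 2.
pose dS r := 2 * (w1 r - w2 r) * (- P1 r + P2 r) + 2 * (P1 r - P2 r) *
  (f (w1 r) - f (w2 r) - n%:R * (P1 r - P2 r) / r).
have := @nincr _ (fun r => S r * expR (- ((L + 1) * r)))
  (fun r => (dS r - (L + 1) * S r) * expR (- ((L + 1) * r))) 0 r r0.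
have S0 : S 0 = (w1 0 - w2 0) ^+ 2 by rewrite /S P10 P20 subrr [0 ^+ 2]expr2 mulr0 addr0.
rewrite mulr0 oppr0 expR0 mulr1 S0 => h.
rewrite -/(S r) -ler_pdivrMr ?expR_gt0// -expRN; apply: h => s.
- by move=> _; rewrite /S; catt.
- move=> /andP[s0 _]; have := dw1 s s0 => d1; have := dw2 s s0 => d2.
  have := dP1 s s0 => d3; have := dP2 s s0 => d4.
  by rewrite /S /dS; der => /=; field; rewrite gt_eqF.
- move=> /andP[s0 sr]; rewrite mulr_le0_ge0 ?expR_ge0//.
  have fl : `|f (w1 s) - f (w2 s)| <= L * `|w1 s - w2 s|.
    by apply: fL; rewrite s0 (lt_le_trans sr).
  have np : 0 <= n%:R * (P1 s - P2 s) ^+ 2 / s.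
    by pos.
  rewrite /dS /S; set z := w1 s - w2 s; set q := P1 s - P2 s in np *.
  set D := f _ - f _ in fl *.
  have -> : 2 * z * (- P1 s + P2 s) + 2 * q * (D - n%:R * q / s) =
     - 2 * (z * q) + 2 * (q * D) - 2 * (n%:R * q ^+ 2 / s).
    by rewrite /q; field; rewrite gt_eqF.
  have h1 : q * D <= L * (`|z| * `|q|).
    apply: le_trans (ler_norm _) _; rewrite normrM mulrC mulrA ler_wpM2r//.
  have h2 : - (z * q) <= `|z| * `|q| by rewrite -normrM -normrN ler_norm.
  have h3 : 2 * (`|z| * `|q|) <= z ^+ 2 + q ^+ 2.
    rewrite -(real_normK (num_real z)) -(real_normK (num_real q)).
    by have := sqr_ge0 (`|z| - `|q|); lra.
  have h4 : L * (2 * (`|z| * `|q|)) <= L * (z ^+ 2 + q ^+ 2) by rewrite ler_wpM2l.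
  by lra.
Qed.

End ode.

(** * Ground states *)

(* [b] is the zero of [f], [bt] the zero of its primitive [F]. *)
Record nonlin0 (R : realType) (f F : R -> R) (b bt : R) : Prop := Nonlin0 {
  nl_cat : forall s : R, cat f s;
  nl_le0 : forall s : R, s <= 0 -> f s = 0;
  nl_b0 : 0 < b;
  nl_bt : b < bt;
  nl_fb : f b = 0;
  nl_neg : forall s : R, 0 < s -> s < b -> f s < 0;
  nl_pos : forall s : R, b < s -> 0 < f s;
  nl_F : forall s : R, dv F s (f s);
  nl_F0 : forall s : R, s <= 0 -> F s = 0;
  nl_Fneg : forall s : R, 0 < s -> s < bt -> F s < 0;
  nl_lip : forall A : R, exists2 L : R, 0 <= L &
    forall s t : R, s <= A -> t <= A -> `|f s - f t| <= L * `|s - t| }.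

Record nonlin (R : realType) (f f' F : R -> R) (b bt : R) : Prop := Nonlin {
  nl_base :> nonlin0 f F b bt;
  nl_dv : forall s : R, 0 < s -> dv f s (f' s);
  nl_K : forall s t : R, b < s -> s <= t -> t * f' t / f t <= s * f' s / f s }.

Record ground_state (R : realType) (f : R -> R) (n : nat) (w P : R -> R) : Prop :=
  GroundState {
  gs_sol : radial_sol f n w P;
  gs_pos : forall r : R, 0 <= r -> 0 < w r;
  gs_lim : forall e : R, 0 < e -> exists r0 : R, forall r : R, r0 <= r -> w r < e }.

(** * Energy and flux of a radial solution *)

Section radial_solutions.
Context (R : realType) (f F : R -> R) (b bt : R) (n : nat).
Context (H : nonlin0 f F b bt) (n2 : (2 <= n)%N).
Implicit Types (w P : R -> R) (r s t x y z e u th : R).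

Lemma dv_expn r : 0 < r -> dv (fun s => s ^+ n) r (n%:R * r ^+ n / r).
Proof.
move=> r0; apply: (dv_eq (dvX n (dv_id r))).
case: (n) => [|k] /=; first by rewrite !mul0r.
by rewrite exprS mulr1; field; rewrite gt_eqF.
Qed.

Lemma exp0n : (0 : R) ^+ n = 0.
Proof. by rewrite expr0n gtn_eqF// (leq_trans _ n2). Qed.

Definition energy w P r := P r ^+ 2 / 2 + F (w r).

Lemma energy_nincr w P r s : radial_sol f n w P -> 0 <= r -> r <= s ->
  energy w P s <= energy w P r.
Proof.
move=> [cw cP P0 dw dP] r0 rs.
have cF x := dv_cat (nl_F H x).
apply: (@nincr _ _ (fun t => - n%:R * P t ^+ 2 / t) r s) => // t.
- by move=> _; rewrite /energy; catt; apply: cat_comp.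
- move=> /andP[rt _]; have t0 := le_lt_trans r0 rt.
  have d1 := dw t t0; have d2 := dP t t0; have d3 := dv_comp (nl_F H _) d1.
  by rewrite /energy; der => /=; field; rewrite gt_eqF.
- move=> /andP[rt _]; have t0 := le_lt_trans r0 rt.
  have : 0 <= n%:R * P t ^+ 2 / t by pos.
  by lra.
Qed.

Lemma flux_incr w P r s : radial_sol f n w P -> 0 <= r -> r < s ->
  (forall t, r < t -> t < s -> b < w t) -> r ^+ n * P r < s ^+ n * P s.
Proof.
move=> [cw cP P0 dw dP] r0 rs hw.
apply: (@incr _ (fun t => t ^+ n * P t) (fun t => t ^+ n * f (w t))) => // t.
- by move=> _; catt.
- move=> /andP[rt _]; have t0 := le_lt_trans r0 rt.
  by apply: (@flux_deriv _ _ (fun t => f (w t))) => //; exact: dP.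
- move=> /andP[rt ts]; have t0 := le_lt_trans r0 rt.
  by apply: mulr_gt0; [pos|apply: (nl_pos H); exact: hw].
Qed.

Lemma flux_pos w P r : radial_sol f n w P -> 0 < r ->
  (forall t, 0 < t -> t < r -> b < w t) -> 0 < P r.
Proof.
move=> sol r0 hw; have := flux_incr sol (lexx 0) r0 hw.
by rewrite exp0n mul0r pmulr_rgt0// exprn_gt0.
Qed.

Lemma w_decr w P r s : radial_sol f n w P -> 0 <= r -> r < s ->
  (forall t, r < t -> t < s -> 0 < P t) -> w s < w r.
Proof.
move=> [cw _ _ dw _] r0 rs hP; apply: (@decr _ w (fun t => - P t)) => //.
- by move=> t /andP[rt _]; apply: dw; exact: le_lt_trans rt.
- by move=> t /andP[rt ts]; rewrite oppr_lt0 hP.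
Qed.

(** Near 0 the flux increases because [w > b]. At a first zero [c] of [P], [w] would have decreased
    to [w c > b], hence [w > b] on all of [(0, c)], and the increasing flux could not vanish at
    [c]. *)
Lemma P_pos_of_high_zeros w P : radial_sol f n w P -> b < w 0 ->
  (forall r, 0 < r -> P r = 0 -> b < w r) -> forall r, 0 < r -> 0 < P r.
Proof.
move=> sol bw0 hz r r0; have [cw cP P0 dw dP] := sol.
rewrite ltNge; apply/negP => Pr.
have [e e0 he] := near_ball (cat_gt (cw 0) bw0).
have Pe x : 0 < x -> x < e -> 0 < P x.
  move=> x0 xe; apply: (flux_pos sol x0) => t t0 tx; apply: he.
  by rewrite !add0r (lt_trans tx xe) (lt_trans _ t0)// oppr_lt0.
pose x := Num.min e r / 2.
have m0 : 0 < Num.min e r by rewrite lt_min e0.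
have me : Num.min e r <= e by rewrite ge_min lexx.
have mr : Num.min e r <= r by rewrite ge_min lexx orbT.
have x0 : 0 < x by rewrite /x; lra.
have xe : x < e by rewrite /x; lra.
have xr : x < r by rewrite /x; lra.
have [c [/andP[xc cr] Pc hc]] := first_zero xr (fun x _ => cP x) (Pe _ x0 xe) Pr.
have c0 := lt_trans x0 xc.
have Ppos t : 0 < t -> t < c -> 0 < P t.
  move=> t0 tc; have [tx|xt] := ltP t x; first by apply: Pe => //; exact: lt_trans xe.
  by apply: hc; rewrite xt.
have wc : b < w c by exact: hz.
have : 0 < P c.
  apply: (flux_pos sol c0) => t t0 tc; apply: lt_trans wc _.
  apply: (w_decr sol (ltW t0) tc) => s ts sc.
  by apply: Ppos => //; exact: lt_trans ts.
by rewrite Pc ltxx.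
Qed.

End radial_solutions.

(** * Qualitative properties of one ground state; monotonicity of [theta] *)

Section one_ground_state.
Context (R : realType) (f f' F : R -> R) (b bt : R) (n : nat).
Context (H : nonlin f f' F b bt) (n2 : (2 <= n)%N).
Implicit Types (r s t x y z e u th : R).

Let n1R : (0 : R) < n%:R - 1.
Proof. by rewrite subr_gt0 ltr1n. Qed.

Let nR : (0 : R) < n%:R.
Proof. by rewrite ltr0n; apply: leq_trans n2. Qed.

Context (w P : R -> R).
Context (gs : ground_state f n w P).
Let sol := gs_sol gs.
Let cw x : cat w x. Proof. by case: sol. Qed.
Let cP x : cat P x. Proof. by case: sol. Qed.
Let P0 : P 0 = 0. Proof. by case: sol. Qed.
Let dw r : 0 < r -> dv w r (- P r). Proof. by case: sol => _ _ _ h _; exact: h. Qed.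
Let dP r : 0 < r -> dv P r (f (w r) - n%:R * P r / r).
Proof. by case: sol => _ _ _ _; exact. Qed.
Let wpos r : 0 <= r -> 0 < w r. Proof. exact: (gs_pos gs). Qed.
Let F00 : F 0 = 0. Proof. exact: (nl_F0 H). Qed.

(** The energy is nonincreasing, and [F (w r)] tends to [F 0 = 0] along a ground state: a negative
    value could not be compensated at large radii. *)
Lemma gs_energy_ge0 r : 0 <= r -> 0 <= energy F w P r.
Proof.
move=> r0; rewrite leNgt; apply/negP => Er.
have F0E : energy F w P r < F 0 by rewrite F00.
have [e e0 he] := near_ball (cat_gt (dv_cat (nl_F H 0)) F0E).
have [r1 hr1] := gs_lim gs e0.
pose s := Num.max r r1.
have rs : r <= s by rewrite /s le_max lexx.
have /hr1 ws : r1 <= s by rewrite /s le_max lexx orbT.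
have := energy_nincr H sol r0 rs.
have : energy F w P r < F (w s).
  by apply: he; rewrite !add0r ws (lt_trans _ (wpos (le_trans r0 rs)))// oppr_lt0.
have : 0 <= P s ^+ 2 / 2 by pos.
by rewrite /energy; lra.
Qed.

(** At a zero of [P] the energy is [F (w r)], and [F] is negative on [(0, bt)]. *)
Lemma gs_high r : 0 <= r -> P r = 0 -> bt <= w r.
Proof.
move=> r0 Pr; rewrite leNgt; apply/negP => /(nl_Fneg H (wpos r0)).
have := gs_energy_ge0 r0; rewrite /energy Pr expr0n/= mul0r add0r.
by rewrite leNgt => /negP.
Qed.

Lemma gs_init : bt <= w 0.
Proof. exact: gs_high. Qed.

Lemma gs_P_pos r : 0 < r -> 0 < P r.
Proof.
apply: (P_pos_of_high_zeros H n2 sol).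
- exact: lt_le_trans (nl_bt H) gs_init.
- by move=> s s0 Ps; apply: lt_le_trans (nl_bt H) (gs_high (ltW s0) Ps).
Qed.

Lemma gs_decr r s : 0 <= r -> r < s -> w s < w r.
Proof.
move=> r0 rs; apply: (w_decr sol r0 rs) => t rt _.
by apply: gs_P_pos; exact: le_lt_trans rt.
Qed.

Lemma gs_level u : 0 < u -> u < w 0 -> exists2 r : R, 0 < r & w r = u.
Proof.
move=> u0 uw; have [r1 hr1] := gs_lim gs u0.
pose s := Num.max 0 r1.
have s0 : 0 <= s by rewrite /s le_max lexx.
have /hr1 ws : r1 <= s by rewrite /s le_max lexx orbT.
have [|r /andP[r0 _] e] := ivt_decr s0 (fun x _ => cw x) (v := u).
  by rewrite (ltW ws) ltW.
exists r => //; rewrite lt_neqAle r0 andbT; apply/eqP => r00.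
by move: uw; rewrite -e -r00 ltxx.
Qed.

Lemma gs_lt r s : 0 <= r -> 0 <= s -> w s < w r -> r < s.
Proof.
move=> r0 s0 h; rewrite ltNge; apply/negP; rewrite le_eqVlt => /predU1P[e|].
  by move: h; rewrite e ltxx.
by move=> /(gs_decr s0) /(lt_trans h); rewrite ltxx.
Qed.

Lemma gs_inj r s : 0 <= r -> 0 <= s -> w r = w s -> r = s.
Proof.
move=> r0 s0 e; apply/eqP; rewrite eq_le !leNgt; apply/andP; split; apply/negP.
- by move=> /(gs_decr s0); rewrite e ltxx.
- by move=> /(gs_decr r0); rewrite e ltxx.
Qed.

Context (rb : R).
Context (rb0 : 0 < rb).
Context (wrb : w rb = b).

Lemma gs_w_gt r : 0 <= r -> r < rb -> b < w r.
Proof. by move=> r0 rrb; rewrite -wrb; exact: gs_decr. Qed.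

Lemma gs_w_lt r : rb < r -> w r < b.
Proof. by move=> rrb; rewrite -wrb; apply: gs_decr => //; exact: ltW. Qed.

(** [P] decreases beyond [rb], where [f (w) < 0], so the drop of [w] over [[r / 2, r]] is at least
    [P r * r / 2]. *)
Lemma gs_rP_le r : 2 * rb <= r -> r * P r <= 2 * w (r / 2).
Proof.
move=> r2; have rb0' := rb0; have r20 : 0 < r / 2 by lra.
have rr : r / 2 < r by lra.
have Pdecr c : r / 2 < c -> c < r -> P r <= P c.
  move=> c1 c2; apply: (@nincr _ P (fun s => f (w s) - n%:R * P s / s) c r (ltW c2)).
  - by move=> x _; exact: cP.
  - by move=> x /andP[x1 _]; apply: dP; lra.
  - move=> x /andP[x1 _]; have x0 : 0 < x by lra.
    have xb : w x < b by apply: gs_w_lt; lra.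
    have := nl_neg H (wpos (ltW x0)) xb.
    have Px := gs_P_pos x0; have : 0 <= n%:R * P x / x by pos.
    by lra.
have [c /andP[c1 c2] e] := @mvt _ w (fun s => - P s) (r / 2) r rr
  (fun x _ => cw x) (fun x hx => dw (lt_trans r20 (proj1 (andP hx)))).
have := Pdecr c c1 c2; have := wpos (ltW (lt_trans r20 rr)).
have h : 0 < r - r / 2 by lra.
move=> wr PP; have : P r * (r - r / 2) <= P c * (r - r / 2) by rewrite ler_pM2r.
by lra.
Qed.

Lemma gs_P_small e : 0 < e ->
  exists2 r0 : R, 0 < r0 & forall r, r0 <= r -> P r < e /\ r * P r < e.
Proof.
move=> e0; have [r1 hr1] := gs_lim gs (divr_gt0 e0 (ltr0n R 2)).
pose m := Num.max 1 (Num.max (2 * r1) (2 * rb)).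
have m1 : 1 <= m by rewrite /m le_max lexx.
have mr1 : 2 * r1 <= m by rewrite /m !le_max lexx orbT.
have mrb : 2 * rb <= m by rewrite /m !le_max lexx !orbT.
exists m; first by lra.
move=> r mr; have h : r * P r < e.
  apply: le_lt_trans (gs_rP_le _) _; first by lra.
  have : w (r / 2) < e / 2 by apply: hr1; lra.
  by lra.
split => //; apply: le_lt_trans h.
have r1r : 1 <= r by lra.
by rewrite ler_peMl// ltW// gs_P_pos//; lra.
Qed.

(** [s P - (n - 1) w] has derivative [s f (w) < 0] beyond [rb]. If it were nonpositive at [r], it
    would then stay below a negative constant, whereas it exceeds [- (n - 1) w], which tends to
    0. *)
Lemma gs_theta_b r : rb <= r -> (n%:R - 1) * w r < r * P r.
Proof.
move=> rbr; have rb0' := rb0; rewrite ltNge; apply/negP => gr.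
pose g s := s * P s - (n%:R - 1) * w s.
have gd s t : rb <= s -> s < t -> g t < g s.
  move=> rs st; apply: (@decr _ g (fun x => x * f (w x)) s t st).
  - by move=> x _; rewrite /g; catt.
  - move=> x /andP[x1 _]; have x0 : 0 < x by lra.
    have d1 := dw x0; have d2 := dP x0.
    by rewrite /g; der; field; rewrite gt_eqF.
  - move=> x /andP[x1 _]; have x0 : 0 < x by lra.
    by rewrite pmulr_rlt0// (nl_neg H)//; [apply: wpos; lra|apply: gs_w_lt; lra].
have g1 : g (r + 1) < 0.
  have : g (r + 1) < g r by apply: gd => //; lra.
  by rewrite /g; lra.
have e0 : 0 < - g (r + 1) / (n%:R - 1) by apply: divr_gt0 => //; lra.
have [r1 hr1] := gs_lim gs e0.
pose s := Num.max (r + 2) r1.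
have rs : r + 2 <= s by rewrite /s le_max lexx.
have /hr1 : r1 <= s by rewrite /s le_max lexx orbT.
rewrite ltr_pdivlMr// => ws.
have : g s < g (r + 1) by apply: gd; lra.
have : 0 < s * P s by apply: mulr_gt0; [lra|apply: gs_P_pos; lra].
by rewrite /g in ws *; lra.
Qed.

(** The classical functional with [F - F b] in place of [F]: its density then vanishes at the level
    [b], and at [rb] only terms controlled by [gs_theta_b] are left. *)
Definition pohozaev r := r * (r ^+ n * P r) * P r / 2 +
  r * r ^+ n * (F (w r) - F b) - (n%:R - 1) / 2 * (r ^+ n * P r) * w r.

Definition poho_dens s := (n%:R + 1) * (F s - F b) - (n%:R - 1) / 2 * s * f s.

Lemma dv_pohozaev r : 0 < r -> dv pohozaev r (r ^+ n * poho_dens (w r)).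
Proof.
move=> r0; have d1 := dw r0; have d2 := dP r0; have d3 := dv_expn n r0.
have d4 := dv_comp (nl_F H _) d1.
by rewrite /pohozaev /poho_dens; der; field; rewrite gt_eqF.
Qed.

Lemma cat_pohozaev r : cat pohozaev r.
Proof.
have cF : cat (fun r => F (w r)) r by apply: cat_comp (cw r); exact: dv_cat (nl_F H _).
by rewrite /pohozaev; catt.
Qed.

(** The functional is 0 at 0 and positive at [rb]. If it were negative in between, its density would
    be negative at some level and positive at a lower one, while it vanishes at [b]. The derivative
    of the density is [f] times [(n + 1) - (n - 1) / 2 * (1 + K)] with [K = s f' / f] nonincreasing,
    so it cannot be first positive and then negative as the level rises. *)
Lemma gs_pohozaev_ge0 r : 0 < r -> r <= rb -> 0 <= pohozaev r.
Proof.
move=> r0 rrb; rewrite leNgt; apply/negP => Mr.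
have Mrb : 0 < pohozaev rb.
  have -> : pohozaev rb = rb ^+ n * P rb / 2 * (rb * P rb - (n%:R - 1) * w rb).
    by rewrite /pohozaev wrb; field.
  have := gs_P_pos rb0; have := gs_theta_b (lexx rb); rewrite -subr_gt0 => ? ?.
  by pos.
have {}rrb : r < rb.
  by rewrite lt_neqAle rrb andbT; apply: contraTneq Mr => ->; rewrite -leNgt ltW.
have [r1 /andP[r10 r1r]] := mvt r0 (fun x _ => cat_pohozaev x)
  (fun x hx => dv_pohozaev (proj1 (andP hx))).
have -> : pohozaev 0 = 0 by rewrite /pohozaev (exp0n _ n2) P0 !(mul0r, mulr0, subr0, addr0).
rewrite !subr0 => e1.
have [r2 /andP[rr2 r2b]] := mvt rrb (fun x _ => cat_pohozaev x)
  (fun x hx => dv_pohozaev (lt_trans r0 (proj1 (andP hx)))).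
move=> e2; have r20 := lt_trans r0 rr2.
have Q1 : poho_dens (w r1) < 0.
  move: Mr; rewrite e1 pmulr_llt0// pmulr_rlt0//; exact: exprn_gt0.
have Q2 : 0 < poho_dens (w r2).
  have : 0 < pohozaev rb - pohozaev r by lra.
  have rbr : 0 < rb - r by rewrite subr_gt0.
  have r2n : 0 < r2 ^+ n by exact: exprn_gt0.
  by rewrite e2 (pmulr_lgt0 _ rbr) (pmulr_rgt0 _ r2n).
have w21 : w r2 < w r1 by apply: gs_decr; [exact: ltW|exact: lt_trans rr2].
have bw2 : b < w r2 by apply: gs_w_gt => //; exact: ltW.
have b0 := nl_b0 H.
pose dQ s := f s * ((n%:R + 1) - (n%:R - 1) / 2 * (1 + s * f' s / f s)).
have ddQ s : b < s -> dv poho_dens s (dQ s).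
  move=> bs; have d1 := nl_dv H (lt_trans b0 bs); have d2 := nl_F H s.
  have fs := nl_pos H bs.
  by rewrite /poho_dens /dQ; der; field; rewrite gt_eqF.
have cQ s : cat poho_dens s.
  by have c1 := dv_cat (nl_F H s); have c2 := nl_cat H s; rewrite /poho_dens; catt.
have [x1 /andP[bx1 x12]] := mvt bw2 (fun x _ => cQ x)
  (fun x hx => ddQ x (proj1 (andP hx))).
have -> : poho_dens b = 0 by rewrite /poho_dens (nl_fb H) subrr !mulr0 subrr.
rewrite subr0 => e3.
have [x2 /andP[x22 _] e4] := mvt w21 (fun x _ => cQ x)
  (fun x hx => ddQ x (lt_trans bw2 (proj1 (andP hx)))).
have bx2 := lt_trans bw2 x22.
have : 0 < dQ x1 by move: Q2; rewrite e3 pmulr_lgt0// subr_gt0.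
rewrite /dQ (pmulr_rgt0 _ (nl_pos H bx1)).
have : dQ x2 < 0.
  have : poho_dens (w r1) - poho_dens (w r2) < 0 by lra.
  by rewrite e4 pmulr_llt0// subr_gt0.
rewrite /dQ (pmulr_rlt0 _ (nl_pos H bx2)).
have := nl_K H bx1 (ltW (lt_trans x12 x22)).
rewrite -(ler_pM2l n1R).
by lra.
Qed.

(** The numerator in [dv_theta]. Times [r ^ n / r], it is twice Pohozaev's functional with
    [2 (F (w) - F b)] replaced by [w f (w)]. *)
Definition gs_disc r :=
  (r * P r) ^+ 2 - (n%:R - 1) * (r * P r) * w r + r ^+ 2 * w r * f (w r).

(** Let [K = s f' / f]. If [K > 1] at the level [w r], then also at the levels between [b] and
    [w r], so [s f - 2 (F - F b)] is positive at [w r] and [gs_pohozaev_ge0] concludes. If [K <= 1]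
    at [w r], then also at all smaller radii, and [Y], which starts from 0, has derivative
    [t ^ n (2 w f + t P f (1 - K)) > 0]. *)
Lemma gs_disc_pos r : 0 < r -> r <= rb -> 0 < gs_disc r.
Proof.
move=> r0 rrb; have b0 := nl_b0 H.
have Pr := gs_P_pos r0; have wr := wpos (ltW r0).
move: (rrb); rewrite le_eqVlt => /predU1P[e|rltb].
  have -> : gs_disc r = r * P r * (r * P r - (n%:R - 1) * w r).
    by rewrite /gs_disc e wrb (nl_fb H); ring.
  have : (n%:R - 1) * w r < r * P r by apply: gs_theta_b; rewrite e.
  by rewrite -subr_gt0 => h; pos.
have bw := gs_w_gt (ltW r0) rltb.
have rn0 : 0 < r ^+ n by exact: exprn_gt0.
have [K1|K1] := ltP 1 (w r * f' (w r) / f (w r)).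
  have : 0 < w r * f (w r) - 2 * (F (w r) - F b).
    have := @incr _ (fun s => s * f s - 2 * (F s - F b))
      (fun s => f s * (s * f' s / f s - 1)) b (w r) bw.
    rewrite (nl_fb H) subrr !mulr0 subrr; apply.
    - move=> x _; have c1 := dv_cat (nl_F H x); have c2 := nl_cat H x; catt.
    - move=> x /andP[bx _]; have d1 := nl_dv H (lt_trans b0 bx); have d2 := nl_F H x.
      by have fx := nl_pos H bx; der; field; rewrite gt_eqF.
    - move=> x /andP[bx xw]; apply: mulr_gt0; first exact: (nl_pos H bx).
      by rewrite subr_gt0 (lt_le_trans K1)// (nl_K H)// ltW.
  move=> h; have := gs_pohozaev_ge0 r0 rrb.
  have : 0 < r ^+ n * r * (w r * f (w r) - 2 * (F (w r) - F b)) by pos.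
  move=> h1 h2; have : 0 < r ^+ n / r * gs_disc r.
    have -> : r ^+ n / r * gs_disc r = 2 * pohozaev r +
      r ^+ n * r * (w r * f (w r) - 2 * (F (w r) - F b)).
      by rewrite /gs_disc /pohozaev; field; rewrite gt_eqF.
    by lra.
  by rewrite pmulr_rgt0//; pos.
pose Y t := t * (t ^+ n * P t) * P t - (n%:R - 1) * (t ^+ n * P t) * w t +
  t * t ^+ n * (w t * f (w t)).
have Yr : 0 < Y r.
  have := @incr _ Y (fun t => t ^+ n * (2 * (w t * f (w t)) +
    t * P t * f (w t) * (1 - w t * f' (w t) / f (w t)))) 0 r r0.
  have -> : Y 0 = 0 by rewrite /Y (exp0n _ n2) P0 !(mul0r, mulr0, subr0, addr0).
  apply.
  - move=> t _; have c1 : cat (fun t => f (w t)) t by apply: cat_comp; [exact: (nl_cat H)|].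
    by rewrite /Y; catt.
  - move=> t /andP[t0 tr]; have d1 := dw t0; have d2 := dP t0; have d3 := dv_expn n t0.
    have bt' := gs_w_gt (ltW t0) (lt_trans tr rltb).
    have d4 := dv_comp (nl_dv H (lt_trans b0 bt')) d1.
    have ft := nl_pos H bt'.
    by rewrite /Y; der; field; rewrite !gt_eqF.
  - move=> t /andP[t0 tr].
    have bt' := gs_w_gt (ltW t0) (lt_trans tr rltb).
    have ft := nl_pos H bt'; have Pt := gs_P_pos t0; have wt := wpos (ltW t0).
    have Kt : w t * f' (w t) / f (w t) <= 1.
      by apply: le_trans (nl_K H bw _) K1; apply: ltW; apply: gs_decr => //; exact: ltW.
    have : 0 <= t * P t * f (w t) * (1 - w t * f' (w t) / f (w t)).
      by rewrite -subr_ge0 in Kt; pos.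
    have h2 : 0 < 2 * (w t * f (w t)) by pos.
    by move=> h3; apply: mulr_gt0; [pos|lra].
have : 0 < r ^+ n / r * gs_disc r.
  by rewrite (_ : _ * _ = Y r)// /gs_disc /Y; field; rewrite gt_eqF.
by rewrite pmulr_rgt0//; pos.
Qed.

Definition theta r := r * P r / w r.

Lemma dv_theta r : 0 < r -> dv theta r (gs_disc r / (r * w r ^+ 2)).
Proof.
move=> r0; have d1 := dw r0; have d2 := dP r0; have wr := wpos (ltW r0).
have w0 : w r != 0 by rewrite gt_eqF.
have d3 := dvM (dv_id r) d2.
apply: (dv_eq (dv_div w0 d3 d1)); rewrite /gs_disc.
by field; rewrite !gt_eqF.
Qed.

Lemma cat_theta r : 0 <= r -> cat theta r.
Proof.
move=> r0; rewrite /theta; apply: catM; first by catt.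
by apply: catV => //; rewrite gt_eqF// wpos.
Qed.

Lemma theta_incr r s : 0 <= r -> r < s -> s <= rb -> theta r < theta s.
Proof.
move=> r0 rs srb.
apply: (@incr _ theta (fun r => gs_disc r / (r * w r ^+ 2)) r s rs).
- by move=> x /andP[rx _]; apply: cat_theta; exact: le_trans rx.
- by move=> x /andP[rx _]; apply: dv_theta; exact: le_lt_trans rx.
- move=> x /andP[rx xs]; have x0 : 0 < x by exact: le_lt_trans rx.
  have := gs_disc_pos x0 (ltW (lt_le_trans xs srb)).
  by have := wpos (ltW x0) => ? ?; pos.
Qed.

End one_ground_state.

(** * Uniqueness of ground states *)

(** The argument is first clamped to [[g a, g b]], so that the inverse is defined and continuous on
    the whole line and no one-sided continuity has to be handled. *)
Lemma incr_inverse (R : realType) (g : R -> R) (a b : R) : a < b ->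
  (forall x, a <= x <= b -> cat g x) ->
  (forall x y, a <= x -> x < y -> y <= b -> g x < g y) ->
  exists h : R -> R, [/\ forall y, a <= h y <= b,
    forall y, g a <= y <= g b -> g (h y) = y,
    forall x, a <= x <= b -> h (g x) = x & forall y, cat h y].
Proof.
move=> ab cg gi.
have gab : g a < g b by exact: gi.
pose c (y : R) := Num.max (g a) (Num.min y (g b)).
have cc (y : R) : g a <= c y <= g b.
  by rewrite /c le_max lexx /= ge_max (ltW gab) ge_min lexx orbT.
have cid (y : R) : g a <= y <= g b -> c y = y.
  by move=> /andP[ay yb]; rewrite /c (min_idPl yb) (max_idPr ay).
have catc (y : R) : cat c y.
  by rewrite /c; apply: cat_max; [exact: cat_cst|apply: cat_min; [exact: cat_id|exact: cat_cst]].
have P (y : R) : exists x : R, a <= x <= b /\ g x = c y.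
  by have [x xab e] := ivt (ltW ab) cg (cc y); exists x.
have [h hP] := choice P.
have lt_of (x x' : R) : a <= x <= b -> a <= x' <= b -> g x < g x' -> x < x'.
  move=> /andP[ax xb] /andP[ax' xb'] gx; rewrite ltNge; apply/negP.
  rewrite le_eqVlt => /predU1P[e|/(gi _ _ ax')/(_ xb)].
    by move: gx; rewrite e ltxx.
  by move=> /(lt_trans gx); rewrite ltxx.
have hab (y : R) : a <= h y <= b by case: (hP y).
exists h; split => //.
- by move=> y /cid e; case: (hP y) => _ ->.
- move=> x /[dup] xab /andP[ax xb].
  have gx : g a <= g x <= g b.
    apply/andP; split.
    + by move: ax; rewrite le_eqVlt => /predU1P[->//|ax]; apply/ltW/gi.
    + by move: xb; rewrite le_eqVlt => /predU1P[->//|xb]; apply/ltW/gi.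
  have [_] := hP (g x); rewrite (cid _ gx) => e.
  apply/eqP; rewrite eq_le !leNgt; apply/andP; split; apply/negP => lt.
  + have /andP[_ h2] := hab (g x).
    by have := gi _ _ ax lt h2; rewrite e ltxx.
  + have /andP[h1 _] := hab (g x).
    by have := gi _ _ h1 lt xb; rewrite e ltxx.
- move=> y; constructor; apply/cvgrPdist_lt => e e0.
  have [/andP[ah hb] ghy] := hP y.
  have up : \forall y' \near y, h y' < h y + e.
    have [bh|hb'] := ltP b (h y + e).
      by near=> y'; apply: le_lt_trans bh; case/andP: (hab y').
    have : c y < g (h y + e) by rewrite -ghy; apply: gi => //; rewrite ltrDl.
    move=> /(cat_lt (catc y)); apply: filterS => y' hy'.
    apply: lt_of => //; last by case: (hP y') => _ ->.
    by rewrite hb' (le_trans ah)// lerDl ltW.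
  have lo : \forall y' \near y, h y - e < h y'.
    have [bh|hb'] := ltP (h y - e) a.
      by near=> y'; apply: lt_le_trans bh _; case/andP: (hab y').
    have : g (h y - e) < c y by rewrite -ghy; apply: gi => //; rewrite gtrDl oppr_lt0.
    move=> /(cat_gt (catc y)); apply: filterS => y' hy'.
    apply: lt_of => //; last by case: (hP y') => _ ->.
    by rewrite hb' (le_trans _ hb)// gerDl oppr_le0 ltW.
  near=> y'; rewrite distrC ltr_distl; apply/andP; split; near: y'; [exact: lo|exact: up].
Unshelve. all: by end_near. Qed.

(** * Ground states as curves in the variable [theta] *)

Section theta_curves.
Context (R : realType) (f f' F : R -> R) (b bt : R) (n : nat).
Context (H : nonlin f f' F b bt) (n2 : (2 <= n)%N).
Implicit Types (w P : R -> R) (r s t x y z e u th : R).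

(** [gs_disc] divided by [w ^ 2], in terms of [th] and of [h = r ^ 2 f (w) / w]. *)
Definition theta_disc (th h : R) := th ^+ 2 - (n%:R - 1) * th + h.

(* A ground state seen as a curve parametrized by [th = r P / w], on the range
   where [w >= b]; the second component is [r ^ 2 f(w) / w]. *)
Record theta_curve (al Th : R) (W h : R -> R) : Prop := ThetaCurve {
  tc_cW : forall th, cat W th;
  tc_ch : forall th, cat h th;
  tc_W0 : W 0 = al;
  tc_h0 : h 0 = 0;
  tc_end : W Th = b;
  tc_decr : forall s t, 0 <= s -> s < t -> t <= Th -> W t < W s;
  tc_h : forall th, 0 < th -> th < Th -> 0 < h th;
  tc_disc : forall th, 0 < th -> th < Th -> 0 < theta_disc th (h th);
  tc_dW : forall th, 0 < th -> th < Th ->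
    dv W th (- W th * th / theta_disc th (h th));
  tc_dh : forall th, 0 < th -> th < Th ->
    dv h th (h th * (2 - (W th * f' (W th) / f (W th) - 1) * th) /
             theta_disc th (h th)) }.

Lemma ground_state_theta_curve w P rb : ground_state f n w P -> 0 < rb -> w rb = b ->
  exists W h, theta_curve (w 0) (theta w P rb) W h /\
    forall r, 0 <= r -> r <= rb -> W (theta w P r) = w r.
Proof.
move=> gs rb0 wrb; have [cw cP P0 dw dP] := gs_sol gs.
have wpos := gs_pos gs.
have ti := theta_incr H n2 gs rb0 wrb.
have [T [Tin Tr Tl cT]] := incr_inverse rb0
  (fun x hx => cat_theta gs (proj1 (andP hx))) (fun x y => @ti x y).
have th0 : theta w P 0 = 0 by rewrite /theta !mul0r.
have wT th : 0 < w (T th) by apply: wpos; case/andP: (Tin th).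
pose W th := w (T th); pose h th := T th ^+ 2 * f (w (T th)) / w (T th).
have cWT th : cat W th by apply: cat_comp.
have T0 : T 0 = 0 by rewrite -th0 Tl// lexx ltW.
have inner th : 0 < th -> th < theta w P rb -> exists r : R, [/\ 0 < r, r < rb, T th = r & theta w P r = th].
  move=> t0 t1; have e : theta w P (T th) = th by apply: Tr; rewrite th0 !ltW.
  have /andP[a1 a2] := Tin th.
  exists (T th); split => //.
  - by rewrite lt_neqAle a1 andbT; apply: contraTneq t0 => a; rewrite -e -a th0 ltxx.
  - by rewrite lt_neqAle a2 andbT; apply: contraTneq t1 => a; rewrite -e a ltxx.
have dT r : 0 < r -> r < rb ->
    dv T (theta w P r) (r * w r ^+ 2 / gs_disc f n w P r).
  move=> r0 rrb; have dp := gs_disc_pos H n2 gs rb0 wrb r0 (ltW rrb).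
  have wr := wpos _ (ltW r0).
  apply: (dv_eq (dv_inverse (g := theta w P) (l := gs_disc f n w P r / (r * w r ^+ 2)) _ _ _ _)).
  - near=> y; apply: Tl; apply/andP; split; apply: ltW; near: y; [exact: near_gt|exact: near_lt].
  - near=> y; apply: (cat_theta gs); apply: ltW; near: y; exact: near_gt.
  - exact: (dv_theta gs).
  - by rewrite mulf_neq0 ?invr_neq0 ?gt_eqF//; pos.
  - by rewrite invfM invrK mulrC.
have ddE r : 0 < r -> theta_disc (theta w P r) (r ^+ 2 * f (w r) / w r) =
    gs_disc f n w P r / w r ^+ 2.
  move=> r0; rewrite /theta_disc /gs_disc /theta; field.
  by rewrite gt_eqF// wpos// ltW.
exists W, h; split; last by move=> r r0 rrb; rewrite /W Tl// r0.
split => //.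
- move=> th; rewrite /h; apply: catM.
    apply: catM; first by apply: catX.
    by apply: cat_comp; [exact: (nl_cat H)|exact: cWT].
  by apply: catV; [rewrite gt_eqF|exact: cWT].
- by rewrite /W T0.
- by rewrite /h T0 expr0n/= !mul0r.
- by rewrite /W Tl// lexx ltW.
- move=> s t s0 st tTh.
  have s1 : theta w P (T s) = s by apply: Tr; rewrite th0 s0 (le_trans (ltW st)).
  have t1 : theta w P (T t) = t by apply: Tr; rewrite th0 tTh andbT (le_trans s0 (ltW st)).
  have /andP[a1 a2] := Tin s; have /andP[b1 b2] := Tin t.
  apply: (gs_decr H n2 gs a1); rewrite ltNge; apply/negP.
  rewrite le_eqVlt => /predU1P[e|lt]; first by move: st; rewrite -s1 -t1 e ltxx.
  by have := ti _ _ b1 lt a2; rewrite s1 t1 ltNge (ltW st).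
- move=> th t0 t1; have [r [r0 rrb Tth _]] := inner _ t0 t1; rewrite /h Tth.
  have wr := wpos _ (ltW r0); have := nl_pos H (gs_w_gt H n2 gs wrb (ltW r0) rrb).
  by move=> fr; pos.
- move=> th t0 t1; have [r [r0 rrb Tth e]] := inner _ t0 t1; rewrite /h Tth -{1}e ddE//.
  have wr := wpos _ (ltW r0); have := gs_disc_pos H n2 gs rb0 wrb r0 (ltW rrb).
  by move=> fr; pos.
- move=> th t0 t1; have [r [r0 rrb Tth e]] := inner _ t0 t1; rewrite /h /W Tth -{3}e ddE//.
  have d1 := dT _ r0 rrb; rewrite e in d1.
  have d2 := dw _ r0; rewrite -Tth in d2.
  apply: (dv_eq (dv_comp d2 d1)); rewrite Tth -e /theta.
  have wr := wpos _ (ltW r0); have := gs_disc_pos H n2 gs rb0 wrb r0 (ltW rrb).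
  by move=> fr; field; rewrite !gt_eqF.
- move=> th t0 t1; have [r [r0 rrb Tth e]] := inner _ t0 t1.
  have d1 := dT _ r0 rrb; rewrite e in d1.
  have wr := wpos _ (ltW r0); have dp := gs_disc_pos H n2 gs rb0 wrb r0 (ltW rrb).
  have bw := gs_w_gt H n2 gs wrb (ltW r0) rrb.
  have fr := nl_pos H bw.
  have d2 := dw _ r0; have d3 := dv_comp (nl_dv H (lt_trans (nl_b0 H) bw)) d2.
  have d4 := dvM (dvX 2 (dv_id r)) d3.
  have w0 : w r != 0 by rewrite gt_eqF.
  pose G s := s ^+ 2 * f (w s) / w s.
  have d5 : dv G (T th) ((2 * r * f (w r) - r ^+ 2 * f' (w r) * P r) / w r +
      r ^+ 2 * f (w r) * P r / w r ^+ 2).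
    by rewrite Tth; apply: (dv_eq (dv_div w0 d4 d2)); rewrite /=; field.
  rewrite /h /W; apply: (dv_eq (dv_comp d5 d1)).
  rewrite Tth -{2}e ddE// -e /theta /=.
  by field; rewrite !gt_eqF.
Unshelve. all: by end_near. Qed.

(** Up to the first [c] where the curves meet, [W1 >= W2] gives [K (W1) <= K (W2)] for
    [K = s f' / f], and the equation of [h] turns this into [h1 >= h2]. A larger [h] means a larger
    [theta_disc], hence a slower logarithmic decrease of [W]: the quotient [W1 / W2] is
    nondecreasing on [[0, c]], although it starts above 1 and ends at 1. *)
Lemma theta_curve_compare al1 Th1 W1 h1 al2 Th2 W2 h2 :
  theta_curve al1 Th1 W1 h1 -> theta_curve al2 Th2 W2 h2 -> b < al2 -> al2 < al1 ->
  forall th, 0 <= th -> th <= Th1 -> th <= Th2 -> W2 th < W1 th.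
Proof.
move=> C1 C2 bal al12 th th0 thT1 thT2; rewrite ltNge; apply/negP => le12.
have b0 := nl_b0 H.
have W00 : 0 < W1 0 - W2 0 by rewrite (tc_W0 C1) (tc_W0 C2) subr_gt0.
have thpos : 0 < th.
  rewrite lt_neqAle th0 andbT; apply: contraTneq le12 => <-.
  by rewrite -ltNge -subr_gt0.
have [|c [/andP[c0 cth] ec hc]] := first_zero thpos
  (fun x _ => catB (tc_cW C1 x) (tc_cW C2 x)) W00; first by rewrite subr_le0.
have cT1 := le_trans cth thT1; have cT2 := le_trans cth thT2.
pose z t := h1 t - h2 t.
have W2b t : 0 <= t -> t < Th2 -> b < W2 t.
  by move=> t0 tT; rewrite -(tc_end C2); apply: (tc_decr C2).
(* If [z t' < 0], go back to the last zero of [z] before [t']. From there on [z' >= kap z >= C z],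
   where [kap] arises from [h1 D2 - h2 D1 = s (s - (n - 1)) z]; so [z * expR (- (C * s))] is
   nondecreasing from 0, a contradiction. *)
have z_ge0 t' : 0 < t' -> t' < c -> 0 <= z t'.
  move=> t'0 t'c; rewrite leNgt; apply/negP => zneg.
  pose K s := s * f' s / f s.
  pose Km := `|K (W2 t')| + `|K al2|.
  have Km0 : 0 <= Km by rewrite /Km; pos.
  have KB t : 0 < t -> t <= t' -> `|K (W2 t)| <= Km.
    move=> t0 tt'; have bt' := W2b t' (ltW t'0) (lt_le_trans t'c cT2).
    have h3 : W2 t' <= W2 t.
      move: tt'; rewrite le_eqVlt => /predU1P[->//|lt].
      by apply/ltW/(tc_decr C2) => //; [exact: ltW|exact: ltW (lt_le_trans t'c cT2)].
    have h4 : W2 t <= al2.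
      rewrite -(tc_W0 C2); apply/ltW/(tc_decr C2) => //.
      by rewrite (le_trans tt')// ltW// (lt_le_trans t'c).
    have h5 := nl_K H bt' h3; have h6 := nl_K H (lt_le_trans bt' h3) h4.
    have h7 := ler_norm (K (W2 t')); have h8 := ler_norm (- K al2).
    rewrite normrN in h8; have h9 := normr_ge0 (K al2); have h10 := normr_ge0 (K (W2 t')).
    by rewrite ler_norml /Km; rewrite -/(K _) in h5 h6 *; rewrite /K in h5 h6 h7 h8 h9 h10 *; clear - h5 h6 h7 h8 h9 h10; lra.
  (* The discriminants vanish at 0, so compactness gives no bound of [kap] there. For [t <= t0],
     however, [N t >= 0] and [t <= n - 1], hence [kap t <= 0]. *)
  pose t0 := Num.min t' (Num.min (n%:R - 1) (2 / (Km + 1))).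
  have n1R : (0 : R) < n%:R - 1 by rewrite subr_gt0 ltr1n.
  have Km1 : 0 < Km + 1 by clear - Km0; lra.
  have q0 : 0 < 2 / (Km + 1) by pos.
  have t00 : 0 < t0 by rewrite /t0 !lt_min t'0 n1R q0.
  have t0t' : t0 <= t' by rewrite /t0 ge_min lexx.
  have t0n : t0 <= n%:R - 1 by rewrite /t0 !ge_min lexx orbT.
  have t0K : t0 <= 2 / (Km + 1) by rewrite /t0 !ge_min lexx !orbT.
  pose D1 t := theta_disc t (h1 t); pose D2 t := theta_disc t (h2 t).
  have cD1 t : cat D1 t.
    by have := tc_ch C1 t => ch; rewrite /D1 /theta_disc; catt.
  have cD2 t : cat D2 t.
    by have := tc_ch C2 t => ch; rewrite /D2 /theta_disc; catt.
  have D1p t : 0 < t -> t <= t' -> 0 < D1 t.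
    by move=> ? ?; apply: (tc_disc C1) => //; lra.
  have D2p t : 0 < t -> t <= t' -> 0 < D2 t.
    by move=> ? ?; apply: (tc_disc C2) => //; lra.
  have [m1 /andP[m1a m1b] hm1] := evt_min t0t' (fun x _ => cD1 x).
  have [m2 /andP[m2a m2b] hm2] := evt_min t0t' (fun x _ => cD2 x).
  have M1 : 0 < D1 m1 by apply: D1p => //; clear - t00 m1a; lra.
  have M2 : 0 < D2 m2 by apply: D2p => //; clear - t00 m2a; lra.
  pose N t := 2 - (K (W2 t) - 1) * t.
  pose kap t := N t * (t * (t - (n%:R - 1))) / (D1 t * D2 t).
  pose C := (2 + (Km + 1) * t') * (t' * (t' + (n%:R - 1))) / (D1 m1 * D2 m2).
  have C0 : 0 <= C by rewrite /C; pos.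
  have kapC t : 0 < t -> t <= t' -> kap t <= C.
    move=> tp tt'; have Kt := KB t tp tt'.
    have d1 := D1p t tp tt'; have d2 := D2p t tp tt'.
    have [tt0|tt0] := leP t t0.
      apply: le_trans C0; rewrite /kap.
      apply: mulr_le0_ge0; last by pos.
      have Nt : 0 <= N t.
        have : (K (W2 t) - 1) * t <= (Km + 1) * t.
          apply: ler_wpM2r; first exact: ltW.
          by have := ler_norm (K (W2 t)); clear - Kt; lra.
        have : (Km + 1) * t <= 2 by rewrite mulrC -ler_pdivlMr//; clear - t0K tt0; lra.
        by rewrite /N; clear; lra.
      apply: mulr_ge0_le0 => //; apply: mulr_ge0_le0; first exact: ltW.
      by rewrite subr_le0 (le_trans tt0).
    rewrite /kap /C.
    have dd : D1 m1 * D2 m2 <= D1 t * D2 t.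
      by apply: ler_pM; [exact: ltW|exact: ltW|apply: hm1; rewrite (ltW tt0)|apply: hm2; rewrite (ltW tt0)].
    have dd0 : 0 < D1 m1 * D2 m2 by pos.
    apply: le_trans (_ : `|N t * (t * (t - (n%:R - 1)))| / (D1 t * D2 t) <= _).
      by apply: ler_wpM2r; [pos|exact: ler_norm].
    apply: ler_pM; [by pos|by pos| |by rewrite lef_pV2// posrE; pos].
    rewrite !normrM; apply: ler_pM; [by pos|by pos| |].
      apply: le_trans (ler_normB _ _) _.
      rewrite (ger0_norm (ler0n _ 2)) lerD2l normrM (gtr0_norm tp).
      apply: ler_pM; [by pos|by clear - tp Kt; lra| |by []].
      by apply: le_trans (ler_normB _ _) _; rewrite normr1; clear - Kt; lra.
    rewrite (gtr0_norm tp); apply: ler_pM; [by clear - tp Kt; lra|by pos|by []|].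
    by apply: le_trans (ler_normB _ _) _; rewrite !gtr0_norm//; clear - tt' d1; lra.
  have cz t : cat z t by apply: catB; [exact: (tc_ch C1)|exact: (tc_ch C2)].
  have z0 : z 0 = 0 by rewrite /z (tc_h0 C1) (tc_h0 C2) subrr.
  have [|||t1 [/andP[t10 t1t'] e1 hz]] := @first_zero _ (fun s => - z (t' - s)) 0 t' t'0.
  - move=> x _; apply: catN; apply: cat_comp; first exact: cz.
    by catt.
  - by rewrite subr0; clear - zneg Km0; lra.
  - by rewrite subrr z0 oppr0.
  have zt1 : z (t' - t1) = 0 by clear - t1t' e1; lra.
  have zlt s : t' - t1 < s -> s <= t' -> z s < 0.
    move=> s1 s2; have := hz (t' - s); rewrite subKr oppr_gt0; apply.
    by rewrite subr_ge0 s2 ltrBlDr -ltrBlDl.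
  have t1le : t' - t1 <= t' by clear - t10 zt1; lra.
  have := @ndecr _ (fun s => z s * expR (- (C * s)))
    (fun s => (h1 s * (2 - (K (W1 s) - 1) * s) / D1 s -
               h2 s * (2 - (K (W2 s) - 1) * s) / D2 s - C * z s) * expR (- (C * s)))
    (t' - t1) t' t1le.
  rewrite zt1 mul0r => hh.
  suff : 0 <= z t' * expR (- (C * t')) by rewrite pmulr_lge0 ?expR_gt0// leNgt zneg.
  apply: hh => s.
  - by move=> _; catt.
  - move=> /andP[s1 s2]; have sp : 0 < s by clear - t1t' e1 s1; lra.
    have d1 := tc_dh C1 sp (lt_le_trans (lt_trans s2 t'c) cT1).
    have d2 := tc_dh C2 sp (lt_le_trans (lt_trans s2 t'c) cT2).
    by rewrite /z /D1 /D2 /K; der; ring.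
  - move=> /andP[s1 s2]; have sp : 0 < s by clear - t1t' e1 s1; lra.
    apply: mulr_ge0; last exact: expR_ge0.
    have sT1 := lt_le_trans (lt_trans s2 t'c) cT1.
    have sT2 := lt_le_trans (lt_trans s2 t'c) cT2.
    have d1 := D1p s sp (ltW s2); have d2 := D2p s sp (ltW s2).
    have W12 : W2 s <= W1 s.
      rewrite -subr_ge0; apply/ltW/hc; rewrite (ltW sp)/=.
      exact: lt_trans t'c.
    have K12 : K (W1 s) <= K (W2 s) by apply: (nl_K H) => //; apply: W2b => //; exact: ltW.
    have h1p := tc_h C1 sp sT1.
    have zs : z s < 0 by apply: zlt => //; exact: ltW.
    have e2 : h1 s * (2 - (K (W2 s) - 1) * s) / D1 s -
              h2 s * (2 - (K (W2 s) - 1) * s) / D2 s = kap s * z s.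
      rewrite /kap /N /z; have d10 : D1 s != 0 by rewrite gt_eqF.
      have d20 : D2 s != 0 by rewrite gt_eqF.
      have eD : h1 s * D2 s - h2 s * D1 s = s * (s - (n%:R - 1)) * (h1 s - h2 s).
        by rewrite /D1 /D2 /theta_disc; ring.
      transitivity ((2 - (K (W2 s) - 1) * s) * (h1 s * D2 s - h2 s * D1 s) / (D1 s * D2 s)).
        by field; rewrite d10 d20.
      by rewrite eD; field; rewrite d10 d20.
    have e3 : h1 s * (2 - (K (W2 s) - 1) * s) / D1 s <= h1 s * (2 - (K (W1 s) - 1) * s) / D1 s.
      apply: ler_wpM2r; first by pos.
      apply: ler_wpM2l; first exact: ltW.
      by rewrite lerD2l lerN2; apply: ler_wpM2r; [exact: ltW|rewrite lerD2r].
    have e4 : C * z s <= kap s * z s by apply: ler_wnM2r; [exact: ltW|apply: kapC => //; exact: ltW].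
    by clear - e2 e3 e4; lra.
have W2pos t : 0 <= t -> t <= c -> 0 < W2 t.
  move=> t0 tc; apply: lt_le_trans b0 _; rewrite -(tc_end C2).
  have := le_trans tc cT2; rewrite le_eqVlt => /predU1P[->//|lt].
  by apply/ltW/(tc_decr C2).
have := @ndecr _ (fun t => W1 t / W2 t) (fun t => W1 t / W2 t *
   (t / theta_disc t (h2 t) - t / theta_disc t (h1 t))) 0 c (ltW c0).
have W2c := W2pos c (ltW c0) (lexx _).
have -> : W1 c / W2 c = 1 by rewrite (_ : W1 c = W2 c) ?divff ?gt_eqF//; clear - ec cT2 W2c; lra.
rewrite (tc_W0 C1) (tc_W0 C2) ler_pdivrMr ?(lt_trans b0)// mul1r => hh.
suff : al1 <= al2 by rewrite leNgt al12.
apply: hh => t.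
- move=> /andP[t0 tc]; apply: catM; first exact: (tc_cW C1).
  by apply: catV; [rewrite gt_eqF// W2pos|exact: (tc_cW C2)].
- move=> /andP[t0 tc]; have tT1 : t < Th1 by exact: lt_le_trans cT1.
  have tT2 : t < Th2 by exact: lt_le_trans cT2.
  have d1 := tc_dW C1 t0 tT1; have d2 := tc_dW C2 t0 tT2.
  have w2 := W2pos t (ltW t0) (ltW tc); have w20 : W2 t != 0 by rewrite gt_eqF.
  have D1 := tc_disc C1 t0 tT1; have D2 := tc_disc C2 t0 tT2.
  by apply: (dv_eq (dv_div w20 d1 d2)); field; rewrite !gt_eqF.
- move=> /andP[t0 tc]; have tT1 : t < Th1 by exact: lt_le_trans cT1.
  have tT2 : t < Th2 by exact: lt_le_trans cT2.
  have w2 := W2pos t (ltW t0) (ltW tc).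
  have w12 : 0 < W1 t - W2 t by apply: hc; rewrite (ltW t0).
  have w1 : 0 < W1 t by clear - tT2 w2 w12; lra.
  have D1 := tc_disc C1 t0 tT1; have D2 := tc_disc C2 t0 tT2.
  apply: mulr_ge0; first by pos.
  rewrite subr_ge0; apply: ler_wpM2l; first exact: ltW.
  rewrite lef_pV2 ?posrE// /theta_disc lerD2l -subr_ge0.
  exact: z_ge0.
Qed.

End theta_curves.

(** * Comparison of two ground states at equal levels *)

Section uniqueness.
Context (R : realType) (f f' F : R -> R) (b bt : R) (n : nat).
Context (H : nonlin f f' F b bt) (n2 : (2 <= n)%N).
Implicit Types (w P : R -> R) (r s t x y z e u th : R).

Let n0R : (0 : R) < n%:R. Proof. by rewrite ltr0n; apply: leq_trans n2. Qed.

(** [x] inverts [w], and [y] is [P] at that radius. With the level as independent variable, two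
    ground states are compared at the same value of [f]. *)
Lemma ground_state_level w P : ground_state f n w P -> exists x y : R -> R,
  forall u, 0 < u -> u < w 0 ->
  [/\ 0 < x u, w (x u) = u, y u = P (x u) /\ 0 < y u, dv x u (- (y u)^-1) &
      dv y u (n%:R / x u - f u / y u)].
Proof.
move=> gs; have [cw cP P0 dw dP] := gs_sol gs.
have ex u : exists r, 0 < u -> u < w 0 -> 0 < r /\ w r = u.
  have [[u0 uw]|nu] := pselect (0 < u /\ u < w 0).
    by have [r r0 e] := gs_level gs u0 uw; exists r.
  by exists 0 => u0 uw; case: nu.
have [x xP] := choice ex.
exists x, (fun u => P (x u)) => u u0 uw; have [x0 wx] := xP u u0 uw.
have Px := gs_P_pos H n2 gs x0.
have dx : dv x u (- (P (x u))^-1).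
  rewrite -{1}wx -invrN; apply: dv_inverse.
  - near=> r; have r0 : 0 < r by near: r; exact: near_gt.
    have wr0 : w r < w 0 := gs_decr H n2 gs (lexx 0) r0.
    have [y0 wy] := xP (w r) (gs_pos gs (ltW r0)) wr0.
    exact: (gs_inj H n2 gs (ltW y0) (ltW r0) wy).
  - by near=> r; exact: cw.
  - exact: dw.
  - by rewrite oppr_eq0 gt_eqF.
split => //; apply: (dv_eq (dv_comp (dP _ x0) dx)); rewrite wx.
by field; rewrite !gt_eqF.
Unshelve. all: by end_near. Qed.

(* Compares the level functions [r_i(u)], [P_i(u)]: with
   [X = r1 P1 - r2 P2], [d = r1 - r2], [e = P1 - P2] one has [X' = - f (r1 / P1 - r2 / P2)],
   [d' = e / (P1 P2)] and [(P1 ^ 2 - P2 ^ 2)' = 2 n (P1 / r1 - P2 / r2)]. *)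
Lemma ground_state_init_le w1 P1 w2 P2 :
  ground_state f n w1 P1 -> ground_state f n w2 P2 -> w1 0 <= w2 0.
Proof.
move=> g1 g2; rewrite leNgt; apply/negP => al12.
have b0 := nl_b0 H.
have bal2 : b < w2 0 := lt_le_trans (nl_bt H) (gs_init H g2).
have bal1 : b < w1 0 := lt_trans bal2 al12.
have [rb1 rb10 wrb1] := gs_level g1 b0 bal1.
have [rb2 rb20 wrb2] := gs_level g2 b0 bal2.
have [x1 [y1 L1]] := ground_state_level g1.
have [x2 [y2 L2]] := ground_state_level g2.
(* With [c = theta w2 P2 (x2 u)] the comparison of curves gives [W1 c > W2 c = u = W1 (theta w1 P1
   (x1 u))]. As [W1] decreases, [c < theta w1 P1 (x1 u)], and the common factor [1 / u] cancels. *)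
have X_pos u : b <= u -> u < w2 0 -> x2 u * y2 u < x1 u * y1 u.
  move=> bu uw2; have u0 := lt_le_trans b0 bu.
  have [x10 wx1 [yx1 _] _ _] := L1 u u0 (lt_trans uw2 al12).
  have [x20 wx2 [yx2 _] _ _] := L2 u u0 uw2.
  have [W1 [h1 [C1 W1e]]] := ground_state_theta_curve H n2 g1 rb10 wrb1.
  have [W2 [h2 [C2 W2e]]] := ground_state_theta_curve H n2 g2 rb20 wrb2.
  have cmp := theta_curve_compare H n2 C1 C2 bal2 al12.
  have ti1 := theta_incr H n2 g1 rb10 wrb1; have ti2 := theta_incr H n2 g2 rb20 wrb2.
  have xr1 : x1 u <= rb1.
    rewrite leNgt; apply/negP => /(gs_w_lt H n2 g1 rb10 wrb1).
    by rewrite wx1 ltNge bu.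
  have xr2 : x2 u <= rb2.
    rewrite leNgt; apply/negP => /(gs_w_lt H n2 g2 rb20 wrb2).
    by rewrite wx2 ltNge bu.
  have t0 (w P : R -> R) : theta w P 0 = 0 by rewrite /theta !mul0r.
  have T1p : 0 < theta w1 P1 rb1 by rewrite -(t0 w1 P1) ti1.
  have T2p : 0 < theta w2 P2 rb2 by rewrite -(t0 w2 P2) ti2.
  (* The second curve ends first: otherwise it would be below [b] at [theta w1 P1 rb1] without
     having passed its end. Hence [c] lies in the range of both curves. *)
  have T21 : theta w2 P2 rb2 < theta w1 P1 rb1.
    rewrite ltNge; apply/negP => le12.
    have := cmp _ (ltW T1p) (lexx _) le12; rewrite (tc_end C1) -(tc_end C2) ltNge.
    move: le12; rewrite le_eqVlt => /predU1P[->|lt]; first by rewrite lexx.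
    by rewrite ltW// (tc_decr C2)// ltW.
  pose c := theta w2 P2 (x2 u).
  have c0 : 0 < c by rewrite /c -(t0 w2 P2) ti2.
  have cT : c <= theta w2 P2 rb2.
    by rewrite /c; move: xr2; rewrite le_eqVlt => /predU1P[->//|lt]; apply/ltW/ti2 => //; exact: ltW.
  have := cmp c (ltW c0) (le_trans cT (ltW T21)) cT.
  rewrite /c (W2e _ (ltW x20) xr2) wx2 -{1}wx1 -(W1e _ (ltW x10) xr1) -/c => h.
  have : c < theta w1 P1 (x1 u).
    rewrite ltNge; apply/negP; rewrite le_eqVlt => /predU1P[e|lt].
      by move: h; rewrite e ltxx.
    have th0 : 0 <= theta w1 P1 (x1 u) by rewrite -(t0 w1 P1); apply/ltW/ti1.
    have := tc_decr C1 th0 lt (le_trans cT (ltW T21)).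
    by move=> /(lt_trans h); rewrite ltxx.
  rewrite /c /theta wx1 wx2 -yx1 -yx2.
  by rewrite ltr_pM2r// invr_gt0.
have d_deriv u : 0 < u -> u < w2 0 ->
    dv (fun u => x1 u - x2 u) u ((y1 u - y2 u) / (y1 u * y2 u)).
  move=> u0 uw; have [_ _ [_ y10] d1 _] := L1 u u0 (lt_trans uw al12).
  have [_ _ [_ y20] d2 _] := L2 u u0 uw.
  by der; field; rewrite !gt_eqF.
have X_deriv u : 0 < u -> u < w2 0 ->
    dv (fun u => x1 u * y1 u - x2 u * y2 u) u (- f u * (x1 u / y1 u - x2 u / y2 u)).
  move=> u0 uw; have [x10 _ [_ y10] d1 e1] := L1 u u0 (lt_trans uw al12).
  have [x20 _ [_ y20] d2 e2] := L2 u u0 uw.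
  by der; field; rewrite !gt_eqF.
have e_deriv u : 0 < u -> u < w2 0 -> dv (fun u => y1 u - y2 u) u
    (n%:R * (1 / x1 u - 1 / x2 u) + f u * (y1 u - y2 u) / (y1 u * y2 u)).
  move=> u0 uw; have [x10 _ [_ y10] d1 e1] := L1 u u0 (lt_trans uw al12).
  have [x20 _ [_ y20] d2 e2] := L2 u u0 uw.
  by der; field; rewrite !gt_eqF.
have q_deriv u : 0 < u -> u < w2 0 -> dv (fun u => y1 u ^+ 2 - y2 u ^+ 2) u
    (2 * n%:R * (y1 u / x1 u - y2 u / x2 u)).
  move=> u0 uw; have [x10 _ [_ y10] d1 e1] := L1 u u0 (lt_trans uw al12).
  have [x20 _ [_ y20] d2 e2] := L2 u u0 uw.
  by der => /=; field; rewrite !gt_eqF.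
have pos u : 0 < u -> u < w2 0 -> [/\ 0 < x1 u, 0 < y1 u, 0 < x2 u & 0 < y2 u].
  move=> u0 uw; have [x10 _ [_ y10] d1 e1] := L1 u u0 (lt_trans uw al12).
  by have [x20 _ [_ y20] d2 e2] := L2 u u0 uw.
have small e : 0 < e -> exists u0, [/\ 0 < u0, u0 < w2 0 &
    forall u, 0 < u -> u < u0 -> y1 u < e /\ x1 u * y1 u < e].
  move=> e0; have [r0 r00 hr] := gs_P_small H n2 g1 rb10 wrb1 e0.
  pose m := Num.min (w1 r0) (w2 0).
  have m0 : 0 < m by rewrite /m lt_min (gs_pos g1)/= ?(gs_pos g2)// ltW.
  have m1 : m <= w1 r0 by rewrite /m ge_min lexx.
  have m2 : m <= w2 0 by rewrite /m ge_min lexx orbT.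
  exists (m / 2); split; [by clear - r00 m0 m1 m2; lra|by clear - r00 m0 m1 m2; lra|move=> u u0 um].
  have uw2 : u < w2 0 by clear - m2 u0 um; lra.
  have [x10 wx1 [-> _] _ _] := L1 u u0 (lt_trans uw2 al12).
  apply: hr; apply/ltW/(gs_lt H n2 g1); [exact: ltW|exact: ltW|].
  by rewrite wx1; clear - m0 m1 um; lra.
(* below a level where [d <= 0 < e] these signs and the lower bound on [X] persist *)
have caseA u0 : 0 < u0 -> u0 <= b -> x1 u0 <= x2 u0 -> y2 u0 < y1 u0 ->
    x2 u0 * y2 u0 < x1 u0 * y1 u0 -> False.
  move=> u00 u0b d0 e0 X0.
  have uw u : u <= u0 -> u < w2 0 by move=> h; apply: le_lt_trans bal2; exact: le_trans u0b.
  have stay c : 0 < c -> c < u0 -> (forall u, c < u -> u <= u0 -> y2 u < y1 u) ->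
      x1 c <= x2 c /\ x1 u0 * y1 u0 - x2 u0 * y2 u0 <= x1 c * y1 c - x2 c * y2 c.
    move=> c0 cu0 he.
    have dle v : c <= v -> v < u0 -> x1 v - x2 v <= x1 u0 - x2 u0.
      move=> cv vu0; apply: (@ndecr _ (fun u => x1 u - x2 u)
        (fun u => (y1 u - y2 u) / (y1 u * y2 u)) v u0 (ltW vu0)) => x.
      - move=> /andP[vx xu]; apply: dv_cat (d_deriv x _ (uw _ xu)).
        by apply: lt_le_trans vx; exact: lt_le_trans cv.
      - move=> /andP[vx xu]; apply: (d_deriv x _ (uw _ (ltW xu))).
        by apply: lt_trans vx; exact: lt_le_trans cv.
      - move=> /andP[vx xu]; have x0 : 0 < x by apply: lt_trans vx; exact: lt_le_trans cv.
        have [_ ? _ ?] := pos x x0 (uw _ (ltW xu)).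
        have := he x (le_lt_trans cv vx) (ltW xu); rewrite -subr_gt0 => ?.
        by apply: ltW; apply: divr_gt0 => //; apply: mulr_gt0.
    split; first by have := dle c (lexx _) cu0; clear - u00 u0b d0; lra.
    apply: (@nincr _ (fun u => x1 u * y1 u - x2 u * y2 u)
      (fun u => - f u * (x1 u / y1 u - x2 u / y2 u)) c u0 (ltW cu0)) => x.
    - move=> /andP[vx xu]; apply: dv_cat (X_deriv x _ (uw _ xu)).
      exact: lt_le_trans vx.
    - move=> /andP[vx xu]; apply: (X_deriv x _ (uw _ (ltW xu))).
      exact: lt_trans vx.
    - move=> /andP[vx xu]; have x0 : 0 < x by exact: lt_trans vx.
      have [x10 y10 x20 y20] := pos x x0 (uw _ (ltW xu)).
      have fx := nl_neg H x0 (lt_le_trans xu u0b).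
      apply: mulr_ge0_le0; first by rewrite oppr_ge0 ltW.
      rewrite subr_le0; apply: ler_pM; [exact: ltW|by rewrite invr_ge0 ltW| |].
      + by have := dle x (ltW vx) xu; clear - u00 u0b d0; lra.
      + by rewrite lef_pV2 ?posrE// ltW// he// ltW.
  (* Going down from [u0], at the first level with [P1 = P2] the inequality [x1 <= x2] would give
     [X <= 0], while [X] has not dropped below its value at [u0]. *)
  have epos u : 0 < u -> u < u0 -> y2 u < y1 u.
    move=> up uu0; rewrite ltNge; apply/negP => eu.
    have [||||t [/andP[t0 tu] et ht]] := @first_zero _ (fun t => y1 (u0 - t) - y2 (u0 - t)) 0 (u0 - u).
    - by rewrite subr_gt0.
    - move=> t /andP[t0 tu]; apply: (cat_comp (f := fun u => y1 u - y2 u)); last by catt.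
      by apply: dv_cat (e_deriv _ _ (uw _ _)); clear - X0 up t0 tu; lra.
    - by rewrite subr0 subr_gt0.
    - by rewrite subKr subr_le0.
    have [||u' h1 h2|dc Xc] := stay (u0 - t); [by clear - up t0 tu et; lra|by clear - up t0 tu et; lra| |].
      by have := ht (u0 - u'); rewrite subKr subr_gt0; apply; apply/andP; split; clear - et h1 h2; lra.
    have ye : y1 (u0 - t) = y2 (u0 - t) by clear - et Xc; lra.
    have [x10 y10 x20 y20] : [/\ 0 < x1 (u0 - t), 0 < y1 (u0 - t), 0 < x2 (u0 - t) & 0 < y2 (u0 - t)].
      by apply: pos; [(clear - X0 up t0 tu; lra)|apply: uw; clear - X0 up t0 tu; lra].
    have : x1 (u0 - t) * y2 (u0 - t) <= x2 (u0 - t) * y2 (u0 - t) by rewrite ler_pM2r.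
    by rewrite -{1}ye; clear - X0 Xc; lra.
  (* Down to level 0, [X] stays above its positive value at [u0], but [r1 P1] tends to 0 there. *)
  have X00 : 0 < x1 u0 * y1 u0 - x2 u0 * y2 u0 by rewrite subr_gt0.
  have [v [v0 vw hv]] := small _ X00.
  pose m := Num.min v u0.
  have m0 : 0 < m by rewrite /m lt_min v0.
  have m1 : m <= v by rewrite /m ge_min lexx.
  have m2 : m <= u0 by rewrite /m ge_min lexx orbT.
  have [||u' h1|_ Xm] := stay (m / 2); [by clear - vw m0 m1 m2; lra|by clear - vw m0 m1 m2; lra| |].
    by rewrite le_eqVlt => /predU1P[->//|h2]; apply: epos => //; clear - m0 m1 m2 h1; lra.
  have [||_ Xs] := hv (m / 2); [by clear - m0 m1 Xm; lra|by clear - m0 m1 Xm; lra|].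
  have [||_ _ x20 y20] := pos (m / 2); [by clear - vw m0 m1 m2; lra|by clear - vw m0 m1 m2; lra|].
  by have := mulr_gt0 x20 y20; clear - Xm Xs; lra.
have Xb := X_pos b (lexx _) bal2.
have [x1b y1b x2b y2b] := pos b b0 bal2.
(* If [d <= 0] at [b], then [X > 0] forces [e > 0], and [caseA] applies with [u0 = b]. *)
have db : x2 b < x1 b.
  rewrite ltNge; apply/negP => db; apply: (caseA b) => //.
  rewrite ltNge; apply/negP => yb; move: Xb; rewrite ltNge => /negP; apply.
  by apply: ler_pM => //; exact: ltW.
(* Suppose [e >= 0] at [b]. As the level falls below [b], [e] increases strictly as long as [d > 0].
   Either this lasts down to 0, against the decay of [P1], or [d] vanishes at a level where [e > 0],
   which is [caseA]. *)
have eb : y1 b < y2 b.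
  rewrite ltNge; apply/negP => eb.
  have uw u : u <= b -> u < w2 0 by move=> h; apply: le_lt_trans bal2.
  (* Squares are used because the derivative of [y1 ^ 2 - y2 ^ 2] contains no [f]; it is negative
     where [x1 > x2] and [y1 < y2]. *)
  have q_ge0 c : 0 < c -> c < b -> (forall u, c < u -> u <= b -> x2 u < x1 u) ->
      forall u, c < u -> u <= b -> y2 u <= y1 u.
    move=> c0 cb hd u cu; rewrite le_eqVlt => /predU1P[->//|ub].
    rewrite leNgt; apply/negP => qu.
    have sq v : 0 < v -> v <= b -> (y1 v ^+ 2 < y2 v ^+ 2) = (y1 v < y2 v).
      move=> v0 vb; have [_ y10 _ y20] := pos v v0 (uw _ vb).
      by rewrite ltr_pXn2r ?nnegrE// ltW.
    have u0 : 0 < u by exact: lt_trans cu.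
    have [|||t [/andP[ut tb] et ht]] := @first_zero _ (fun t => y2 t ^+ 2 - y1 t ^+ 2) u b ub.
    - move=> x /andP[x1' x2']; have := q_deriv x (lt_le_trans u0 x1') (uw _ x2').
      by move=> /dv_cat /catN; apply: cat_near; near=> z; rewrite opprB.
    - by rewrite subr_gt0 sq// ltW.
    - by rewrite subr_le0 ler_pXn2r ?nnegrE// ltW.
    have : y1 t ^+ 2 - y2 t ^+ 2 < y1 u ^+ 2 - y2 u ^+ 2.
      apply: (@decr _ (fun u => y1 u ^+ 2 - y2 u ^+ 2)
        (fun u => 2 * n%:R * (y1 u / x1 u - y2 u / x2 u)) u t ut) => x.
      - move=> /andP[h1 h2]; apply: dv_cat (q_deriv x (lt_le_trans u0 h1) (uw _ (le_trans h2 tb))).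
      - by move=> /andP[h1 h2]; apply: (q_deriv x (lt_trans u0 h1) (uw _ (le_trans (ltW h2) tb))).
      - move=> /andP[h1 h2]; have xb := le_trans (ltW h2) tb.
        have x0 := lt_trans u0 h1.
        have [x10 y10 x20 y20] := pos x x0 (uw _ xb).
        have : y1 x < y2 x by rewrite -sq// -subr_gt0; apply: ht; rewrite (ltW h1).
        have dx := hd x (lt_trans cu h1) xb.
        move=> yx; rewrite pmulr_rlt0 ?mulr_gt0// subr_lt0.
        apply: ltr_pM; [exact: ltW|by rewrite invr_ge0 ltW|by []|].
        by rewrite ltf_pV2 ?posrE.
    have := qu; rewrite -sq// ?ltW//.
    by clear - ut tb et; lra.
  have e_strict c : 0 < c -> c < b -> (forall u, c < u -> u <= b -> x2 u < x1 u) ->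
      forall u v, c <= u -> u < v -> v <= b -> y1 v - y2 v < y1 u - y2 u.
    move=> c0 cb hd u v cu uv vb.
    apply: (@decr _ (fun u => y1 u - y2 u) (fun u => n%:R * (1 / x1 u - 1 / x2 u) +
      f u * (y1 u - y2 u) / (y1 u * y2 u)) u v uv) => x.
    - move=> /andP[h1 h2]; apply: dv_cat (e_deriv x _ (uw _ (le_trans h2 vb))).
      by apply: lt_le_trans h1; exact: lt_le_trans cu.
    - move=> /andP[h1 h2]; apply: (e_deriv x _ (uw _ (le_trans (ltW h2) vb))).
      by apply: lt_trans h1; exact: lt_le_trans cu.
    - move=> /andP[h1 h2]; have xb := lt_le_trans h2 vb.
      have cx := le_lt_trans cu h1; have x0 := lt_trans c0 cx.
      have [x10 y10 x20 y20] := pos x x0 (uw _ (ltW xb)).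
      have dx := hd x cx (ltW xb); have yx := q_ge0 c c0 cb hd x cx (ltW xb).
      have fx := nl_neg H x0 xb.
      have t1 : n%:R * (1 / x1 x - 1 / x2 x) < 0.
        by rewrite pmulr_rlt0// subr_lt0 !div1r ltf_pV2 ?posrE.
      have t2 : f x * (y1 x - y2 x) / (y1 x * y2 x) <= 0.
        apply: mulr_le0_ge0; last by rewrite invr_ge0 ltW// mulr_gt0.
        by apply: mulr_le0_ge0; [exact: ltW|rewrite subr_ge0].
      by clear - t1 t2; lra.
  have [hall|/existsNP[c /not_implyP[c0 /not_implyP[cb /negP]]]] :=
    pselect (forall u, 0 < u -> u <= b -> x2 u < x1 u).
    have b2 : 0 < b / 2 by exact: divr_gt0.
    have e2 : 0 < y1 (b / 2) - y2 (b / 2).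
      have := e_strict (b / 2 / 2) _ _ _ (b / 2) b _ _ (lexx _).
      have h1 : 0 < b / 2 / 2 by clear - db eb b2; lra.
      have h2 : b / 2 / 2 < b by clear - db eb h1; lra.
      have h3 : b / 2 / 2 <= b / 2 by clear - y2b db h1 h2; lra.
      have h4 : b / 2 < b by clear - db eb h2; lra.
      move=> /(_ h1 h2 _ h3 h4) h; have := h (fun u hu ub => hall u (lt_trans h1 hu) ub).
      by clear - db eb b2; lra.
    have [v [v0 vw hv]] := small _ e2.
    pose m := Num.min v (b / 2) / 2.
    have m0 : 0 < Num.min v (b / 2) by rewrite lt_min v0.
    have m1 : Num.min v (b / 2) <= v by rewrite ge_min lexx.
    have m2 : Num.min v (b / 2) <= b / 2 by rewrite ge_min lexx orbT.
    have mp : 0 < m by rewrite /m; clear - e2 vw m0; lra.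
    have mv : m < v by rewrite /m; clear - vw m0 m1 mp; lra.
    have mb : m < b / 2 by rewrite /m; clear - m0 m1 m2 mp mv; lra.
    have bb : b / 2 <= b by clear - m1 m2 mp mv mb; lra.
    have mbb : m < b by clear - m2 mp mv mb bb; lra.
    have := e_strict m mp mbb (fun u hu ub => hall u (lt_trans mp hu) ub) m (b / 2) (lexx _) mb bb.
    have [ym _] := hv m mp mv.
    have [_ _ _ y2m] := pos m mp (uw _ (ltW mbb)).
    by clear - mbb ym y2m; lra.
  rewrite -leNgt => dc.
  have {}cb : c < b.
    rewrite lt_neqAle cb andbT; apply: contraTneq dc => ->.
    by rewrite -ltNge.
  have [||||t [/andP[t0 tc] et ht]] := @first_zero _ (fun t => x1 (b - t) - x2 (b - t)) 0 (b - c).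
  - by rewrite subr_gt0.
  - move=> t /andP[t0 tc]; apply: (cat_comp (f := fun u => x1 u - x2 u)); last by catt.
    by apply: dv_cat (d_deriv _ _ (uw _ _)); clear - eb c0 t0 tc; lra.
  - by rewrite subr0 subr_gt0.
  - by rewrite subKr subr_le0.
  have hd u : b - t < u -> u <= b -> x2 u < x1 u.
    move=> h1 h2; rewrite -subr_gt0; have := ht (b - u); rewrite subKr; apply.
    by apply/andP; split; clear - et h1 h2; lra.
  have p0 : 0 < b - t by clear - c0 tc et; lra.
  have pb : b - t < b by clear - t0 tc et; lra.
  have := e_strict _ p0 pb hd _ _ (lexx _) pb (lexx _) => e1.
  have [x10 y10 x20 y20] := pos _ p0 (uw _ (ltW pb)).
  have xe : x1 (b - t) = x2 (b - t) by clear - et e1; lra.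
  have ye : y2 (b - t) < y1 (b - t) by clear - eb e1 x10; lra.
  apply: (caseA (b - t)) => //; [exact: ltW|by rewrite xe|].
  by rewrite xe ltr_pM2l.
(* [P1 - P2] is negative at level [b], and positive near the level [w2 0], where [P2]
   vanishes: consider its first zero in between *)
have [u3 [bu3 u3w e3]] : exists u, [/\ b < u, u < w2 0 & y2 u <= y1 u].
  have [cw1 cP1 P10 _ _] := gs_sol g1; have [cw2 cP2 P20 _ _] := gs_sol g2.
  have [s0 s00 ws0] := gs_level g1 (lt_trans b0 bal2) al12.
  have sr : s0 < rb1 by apply: (gs_lt H n2 g1); [exact: ltW|exact: ltW|rewrite ws0 wrb1].
  have [c /andP[c1 c2] hc] := evt_min (ltW sr) (fun x _ => cP1 x).
  have Pc : 0 < P1 c by apply: (gs_P_pos H n2 g1); exact: lt_le_trans c1.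
  have P20c : P2 0 < P1 c by rewrite P20.
  have [d d0 hd] := near_ball (cat_lt (cP2 0) P20c).
  pose r := Num.min d rb2 / 2.
  have m0 : 0 < Num.min d rb2 by rewrite lt_min d0.
  have m1 : Num.min d rb2 <= d by rewrite ge_min lexx.
  have m2 : Num.min d rb2 <= rb2 by rewrite ge_min lexx orbT.
  have r0 : 0 < r by rewrite /r; clear - P20c d0 m0; lra.
  have rd : r < d by rewrite /r; clear - P20c m0 m1; lra.
  have rrb : r < rb2 by rewrite /r; clear - m0 m1 m2 r0 rd; lra.
  have bu := gs_w_gt H n2 g2 wrb2 (ltW r0) rrb.
  have uw := gs_decr H n2 g2 (lexx 0) r0.
  exists (w2 r); split => //.
  have [x10 wx1 [-> _] _ _] := L1 _ (lt_trans b0 bu) (lt_trans uw al12).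
  have [x20 wx2 [-> _] _ _] := L2 _ (lt_trans b0 bu) uw.
  have -> : x2 (w2 r) = r by apply: (gs_inj H n2 g2) => //; exact: ltW.
  apply: (@le_trans _ _ (P1 c)).
    by apply/ltW/hd; apply/andP; split; clear - r0 rd bu; lra.
  apply: hc; apply/andP; split; apply/ltW/(gs_lt H n2 g1); rewrite ?ltW//.
  - by rewrite wx1 ws0.
  - by rewrite wx1 wrb1.
have [|||c [/andP[bc cu] ec hc]] := @first_zero _ (fun t => y2 t ^+ 2 - y1 t ^+ 2) b u3 bu3.
- move=> x /andP[h1 h2]; have := q_deriv x (lt_le_trans b0 h1) (le_lt_trans h2 u3w).
  by move=> /dv_cat /catN; apply: cat_near; near=> z; rewrite opprB.
- by rewrite subr_gt0 ltr_pXn2r ?nnegrE// ltW.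
- have [_ y10 _ y20] := pos _ (lt_trans b0 bu3) u3w.
  by rewrite subr_le0 ler_pXn2r ?nnegrE// ltW.
have cw2 := le_lt_trans cu u3w.
(* Between [b] and [c] one has [P1 < P2], and [X > 0] then forces [r1 > r2]. So [P1 ^ 2 - P2 ^ 2]
   decreases there, although it is negative at [b] and 0 at [c]. *)
have : y1 c ^+ 2 - y2 c ^+ 2 < y1 b ^+ 2 - y2 b ^+ 2.
  apply: (@decr _ (fun u => y1 u ^+ 2 - y2 u ^+ 2)
    (fun u => 2 * n%:R * (y1 u / x1 u - y2 u / x2 u)) b c bc) => x.
  - by move=> /andP[h1 h2]; apply: dv_cat (q_deriv x (lt_le_trans b0 h1) (le_lt_trans h2 cw2)).
  - by move=> /andP[h1 h2]; apply: (q_deriv x (lt_trans b0 h1) (lt_trans h2 cw2)).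
  - move=> /andP[h1 h2]; have x0 := lt_trans b0 h1; have xw := lt_trans h2 cw2.
    have [x10 y10 x20 y20] := pos x x0 xw.
    have yx : y1 x < y2 x.
      rewrite -(ltr_pXn2r (ltn0Sn 1)) ?nnegrE ?ltW// -subr_gt0.
      by apply: hc; rewrite (ltW h1).
    have xx : x2 x < x1 x.
      rewrite ltNge; apply/negP => xx; have := X_pos x (ltW h1) xw.
      by rewrite ltNge => /negP; apply; apply: ler_pM => //; exact: ltW.
    rewrite pmulr_rlt0 ?mulr_gt0// subr_lt0.
    apply: ltr_pM; [exact: ltW|by rewrite invr_ge0 ltW|by []|].
    by rewrite ltf_pV2 ?posrE.
have : y1 b ^+ 2 < y2 b ^+ 2 by rewrite ltr_pXn2r ?nnegrE// ltW.
by clear - cu ec cw2; lra.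
Unshelve. all: by end_near. Qed.

Lemma ground_state_unique w1 P1 w2 P2 :
  ground_state f n w1 P1 -> ground_state f n w2 P2 ->
  forall r, 0 <= r -> w1 r = w2 r.
Proof.
move=> g1 g2 r r0.
have e0 : w1 0 = w2 0.
  by apply/eqP; rewrite eq_le (ground_state_init_le g1 g2) (ground_state_init_le g2 g1).
have [L L0 hL] := nl_lip H (w1 0).
have le0 w P (gs : ground_state f n w P) s : 0 < s -> w s <= w 0.
  by move=> s0; apply/ltW/(gs_decr H n2 gs).
have := @radial_sol_diff _ n f w1 P1 w2 P2 L r (gs_sol g1) (gs_sol g2) _ L0 r.
rewrite r0 lexx => /(_ _ isT); rewrite e0 subrr [0 ^+ 2]expr2 !mul0r => h.
have {}h : (w1 r - w2 r) ^+ 2 + (P1 r - P2 r) ^+ 2 <= 0.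
  apply: h => s /andP[s0 _]; apply: hL; first exact: le0 g1 _ s0.
  by rewrite e0; exact: le0 g2 _ s0.
have h2 := sqr_ge0 (P1 r - P2 r); have h1 := sqr_ge0 (w1 r - w2 r).
apply/eqP; rewrite -subr_eq0 -sqrf_eq0; apply/eqP.
by lra.
Qed.

End uniqueness.

(** * Existence of ground states *)

Section shooting.
Context (R : realType) (f F : R -> R) (b bt : R) (n : nat).
Context (H : nonlin0 f F b bt) (n2 : (2 <= n)%N).
Implicit Types (w P : R -> R) (r s t x y z e u th : R).

Lemma no_linear_decay w P r0 c : radial_sol f n w P -> 0 <= r0 -> 0 < c ->
  (forall r, r0 < r -> c <= P r) -> (forall r, 0 <= r -> 0 <= w r) -> False.
Proof.
move=> [cw cP P0 dw dP] r00 c0 hP hw.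
have w0 : 0 <= w r0 by exact: hw.
pose r := r0 + w r0 / c + 1.
have q0 : 0 <= w r0 / c by apply: divr_ge0 => //; exact: ltW.
have rr : r0 < r by rewrite /r; lra.
have [x /andP[x1 _] ex] := mvt rr (fun x _ => cw x)
  (fun x hx => dw x (le_lt_trans r00 (proj1 (andP hx)))).
have : c * (r - r0) <= P x * (r - r0) by apply: ler_wpM2r; [lra|exact: hP].
have -> : c * (r - r0) = w r0 + c by rewrite /r; field; rewrite gt_eqF.
have := hw r (le_trans r00 (ltW rr)).
by lra.
Qed.

(** While [w < 0] the source [f (w)] is 0, so the flux does not decrease. It is positive somewhere
    between the last zero of [w] and [r2], because [w] falls there; hence [w] keeps decreasing and
    cannot return to 0. *)
Lemma neg_forever w P r2 : radial_sol f n w P -> 0 < w 0 -> 0 <= r2 -> w r2 < 0 ->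
  forall r, r2 <= r -> w r < 0.
Proof.
move=> [cw cP P0 dw dP] w0 r20 wr2 r r2r; rewrite ltNge; apply/negP => wr.
have r2p : 0 < r2.
  rewrite lt_neqAle r20 andbT; apply: contraTneq wr2 => <-.
  by rewrite -leNgt ltW.
have [|||c [/andP[c0 cr2] ec hc]] := @first_zero _ (fun t => - w (r2 - t)) 0 r2 r2p.
- by move=> x _; apply: catN; apply: cat_comp; [exact: cw|catt].
- by rewrite subr0 oppr_gt0.
- by rewrite subrr oppr_le0 ltW.
have wt0 : w (r2 - c) = 0 by lra.
have t00 : 0 < r2 - c.
  rewrite subr_gt0 lt_neqAle cr2 andbT; apply/eqP => e.
  by move: wt0; rewrite e subrr => e0; move: w0; rewrite e0 ltxx.
have tr2 : r2 - c < r2 by lra.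
have [xi /andP[xi1 xi2] exi] := mvt tr2 (fun x _ => cw x)
  (fun x hx => dw x (lt_trans t00 (proj1 (andP hx)))).
have Pxi : 0 < P xi.
  have : - P xi * (r2 - (r2 - c)) < 0 by rewrite -exi wt0 subr0.
  by rewrite subKr (pmulr_llt0 _ c0) oppr_lt0.
have r2lt : r2 < r.
  rewrite lt_neqAle r2r andbT; apply: contraTneq wr2 => ->.
  by rewrite -leNgt.
have [|||d [/andP[d1 d2] ed hd]] := @first_zero _ (fun t => - w t) r2 r r2lt.
- by move=> x _; apply: catN.
- by rewrite oppr_gt0.
- by rewrite oppr_le0.
have xi0 : 0 < xi by exact: lt_trans xi1.
have neg t : xi <= t -> t < d -> w t < 0.
  move=> xt td; have [h|h] := ltP t r2.
    by have := hc (r2 - t); rewrite subKr oppr_gt0; apply; apply/andP; split; lra.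
  by have := hd t; rewrite oppr_gt0; apply; rewrite h.
have Ppos t : xi < t -> t < d -> 0 < P t.
  move=> xt td; have t0 := lt_trans xi0 xt.
  have : xi ^+ n * P xi <= t ^+ n * P t.
    apply: (@ndecr _ (fun t => t ^+ n * P t) (fun t => t ^+ n * f (w t)) xi t (ltW xt)) => x.
    - by move=> _; catt.
    - move=> /andP[x1 _]; have x0 := lt_trans xi0 x1.
      by apply: (@flux_deriv _ _ (fun t => f (w t))) => //; exact: dP.
    - move=> /andP[x1 x2]; rewrite (nl_le0 H) ?mulr0//.
      by apply/ltW/neg; [exact: ltW|exact: lt_trans td].
  have : 0 < xi ^+ n * P xi by pos.
  by move=> h1 h2; have := lt_le_trans h1 h2; rewrite pmulr_rgt0// exprn_gt0.
have : w d < w r2.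
  apply: (@decr _ w (fun t => - P t) r2 d d1) => x.
  - by [].
  - by move=> /andP[x1 _]; apply: dw; exact: lt_trans x1.
  - by move=> /andP[x1 x2]; rewrite oppr_lt0 Ppos//; exact: lt_trans x1.
by lra.
Qed.

(** Where [w < 0] the energy reduces to [P ^ 2 / 2 >= 0]. As the energy is nonincreasing and a
    negative [w] stays negative, either order of [r1] and [r2] is contradictory. *)
Lemma neg_energy_disjoint w P r1 r2 : radial_sol f n w P -> 0 < w 0 ->
  0 <= r1 -> 0 <= r2 -> energy F w P r1 < 0 -> w r2 < 0 -> False.
Proof.
move=> sol w0 r10 r20 E1 w2.
have Ege r : w r < 0 -> 0 <= energy F w P r.
  by move=> wr; rewrite /energy (nl_F0 H (ltW wr)) addr0; pos.
have [h|h] := leP r2 r1.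
  by have := Ege _ (neg_forever sol w0 r20 w2 h); rewrite leNgt E1.
have := energy_nincr H sol r10 (ltW h); have := Ege _ w2.
by move=> h1 h2; have := le_trans h1 h2; rewrite leNgt E1.
Qed.

(** At a zero [r] the nonnegative [w] has a minimum, so [P r = 0] too. This is excluded by backward
    uniqueness: [S = w ^ 2 + P ^ 2] satisfies [S' >= - C S] on [[x, r]], where the part [2 n / x] of
    [C] pays for the singular term, and [S r = 0] would make [w x] vanish. *)
Lemma no_zero w P : radial_sol f n w P -> 0 < w 0 ->
  (forall r, 0 <= r -> 0 <= w r) -> forall r, 0 <= r -> 0 < w r.
Proof.
move=> sol w0 hw r r0; have [cw cP P0 dw dP] := sol.
rewrite lt_neqAle hw// andbT eq_sym; apply/eqP => wr.
have rp : 0 < r.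
  rewrite lt_neqAle r0 andbT; apply/eqP => e; rewrite -e in wr.
  by move: w0; rewrite wr ltxx.
have Pr : P r = 0.
  apply/eqP; rewrite eq_le !leNgt; apply/andP; split; apply/negP => Pr.
  - have [e e0 he] := near_ball (cat_gt (cP r) Pr).
    have : w (r + e / 2) < w r.
      apply: (w_decr sol r0); first by lra.
      by move=> t t1 t2; apply: he; apply/andP; split; lra.
    by rewrite wr ltNge hw//; lra.
  - have [e e0 he] := near_ball (cat_lt (cP r) Pr).
    pose x := Num.max (r / 2) (r - e / 2).
    have xr : x < r by rewrite /x gt_max; apply/andP; split; lra.
    have x1 : r / 2 <= x by rewrite /x le_max lexx.
    have x2 : r - e / 2 <= x by rewrite /x le_max lexx orbT.
    have : w x < w r.
      apply: (@incr _ w (fun t => - P t) x r xr) => t.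
      - by [].
      - by move=> /andP[t1 _]; apply: dw; lra.
      - by move=> /andP[t1 t2]; rewrite oppr_gt0; apply: he; apply/andP; split; lra.
    by rewrite wr ltNge hw//; lra.
have [e e0 he] := near_ball (cat_gt (cw 0) w0).
pose x := Num.min (e / 2) (r / 2).
have x0 : 0 < x by rewrite /x lt_min; apply/andP; split; lra.
have x1 : x <= e / 2 by rewrite /x ge_min lexx.
have x2 : x <= r / 2 by rewrite /x ge_min lexx orbT.
have wx : 0 < w x by apply: he; apply/andP; split; lra.
have [c _ hc] := evt_max r0 (fun x _ => cw x).
have [L L0 hL] := nl_lip H (w c).
pose C := L + 1 + 2 * (n%:R / x).
pose S t := w t ^+ 2 + P t ^+ 2.
have xr : x <= r by lra.
have := @ndecr _ (fun t => S t * expR (C * t))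
  (fun t => (- 2 * (w t * P t) + 2 * (P t * f (w t)) - 2 * (n%:R * P t ^+ 2 / t) +
     C * S t) * expR (C * t)) x r xr.
have Sr : S r = 0 by rewrite /S wr Pr expr2 mulr0 addr0.
rewrite Sr mul0r => h.
have : S x * expR (C * x) <= 0.
  apply: h => t.
  - by move=> _; rewrite /S; catt.
  - move=> /andP[t1 _]; have t0 : 0 < t by lra.
    have d1 := dw t t0; have d2 := dP t t0.
    by rewrite /S; der => /=; field; rewrite gt_eqF.
  - move=> /andP[t1 t2]; apply: mulr_ge0; last exact: expR_ge0.
    have t0 : 0 < t by lra.
    have fl : `|f (w t)| <= L * `|w t|.
      have := hL (w t) 0; rewrite (nl_le0 H (lexx 0)) !subr0; apply.
        by apply: hc; apply/andP; split; lra.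
      by apply: le_trans (hw r r0) (hc r _); rewrite r0 lexx.
    have n1 : n%:R * P t ^+ 2 / t <= n%:R / x * P t ^+ 2.
      rewrite mulrAC; apply: ler_wpM2r; first exact: sqr_ge0.
      by apply: ler_wpM2l; [exact: ler0n|rewrite lef_pV2 ?posrE// ltW].
    have n3 : 0 <= n%:R / x * w t ^+ 2 by pos.
    have h1 : - (P t * f (w t)) <= L * (`|w t| * `|P t|).
      apply: le_trans (ler_norm _) _; rewrite normrN normrM mulrC mulrA.
      by apply: ler_wpM2r.
    have h2 : w t * P t <= `|w t| * `|P t| by rewrite -normrM ler_norm.
    have h3 : 2 * (`|w t| * `|P t|) <= w t ^+ 2 + P t ^+ 2.
      rewrite -(real_normK (num_real (w t))) -(real_normK (num_real (P t))).
      by have := sqr_ge0 (`|w t| - `|P t|); lra.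
    have h4 : L * (2 * (`|w t| * `|P t|)) <= L * (w t ^+ 2 + P t ^+ 2) by rewrite ler_wpM2l.
    by rewrite /C /S; lra.
rewrite pmulr_lle0 ?expR_gt0// /S.
have : 0 < w x ^+ 2 by pos.
by have := sqr_ge0 (P x); lra.
Qed.

(** Nonnegative energy excludes zeros of [P] below [bt], so [w] decreases. If it stayed above some
    [e > 0], then [P] would be bounded below, against [w >= 0]: once [w < bt], because
    [P ^ 2 >= - 2 F (w)] with [F (w)] bounded away from 0; if always [w >= bt], because [f (w)] is
    bounded below and feeds the flux. *)
Lemma trapped_ground_state w P : radial_sol f n w P -> b < w 0 ->
  (forall r, 0 <= r -> 0 <= w r) -> (forall r, 0 <= r -> 0 <= energy F w P r) ->
  ground_state f n w P /\ forall r, 0 < r -> 0 < P r.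
Proof.
move=> sol bw0 hw hE; have [cw cP P0 dw dP] := sol.
have w0 := lt_trans (nl_b0 H) bw0.
have wpos := no_zero sol w0 hw.
have Ppos : forall r, 0 < r -> 0 < P r.
  apply: (P_pos_of_high_zeros H n2 sol bw0) => r r0 Pr.
  apply: lt_le_trans (nl_bt H) _; rewrite leNgt; apply/negP.
  move=> /(nl_Fneg H (wpos _ (ltW r0))).
  have := hE r (ltW r0); rewrite /energy Pr [0 ^+ 2]expr2 mulr0 mul0r add0r.
  by rewrite leNgt => /negP.
split => //; split => // e e0; apply: contrapT => /forallNP hn.
have we r : 0 <= r -> e <= w r.
  move=> r0; have /existsNP[s /not_implyP[rs /negP]] := hn r; rewrite -leNgt => es.
  move: rs; rewrite le_eqVlt => /predU1P[->//|rs].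
  apply: le_trans es (ltW _); apply: (w_decr sol r0 rs) => t rt _.
  by apply: Ppos; exact: le_lt_trans rt.
have wd r s : 0 <= r -> r <= s -> w s <= w r.
  move=> r0; rewrite le_eqVlt => /predU1P[->//|rs].
  by apply/ltW/(w_decr sol r0 rs) => t rt _; apply: Ppos; exact: le_lt_trans rt.
have [[r0 [r00 wr0]]|hbt] := pselect (exists r0 : R, 0 <= r0 /\ w r0 < bt).
  have [c /andP[c1 c2] hc] := evt_max (we _ r00) (fun x _ => dv_cat (nl_F H x)).
  have Fc : F c < 0.
    by apply: (nl_Fneg H); [exact: lt_le_trans c1|exact: le_lt_trans wr0].
  have m0 : 0 < Num.sqrt (- F c) by rewrite sqrtr_gt0 oppr_gt0.
  apply: (no_linear_decay sol r00 m0 _ hw) => r rr.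
  have rp := le_lt_trans r00 rr.
  have h1 : F (w r) <= F c by apply: hc; apply/andP; split; [exact: we (ltW rp)|exact: wd (ltW rr)].
  have := hE r (ltW rp); rewrite /energy => h2.
  rewrite -(ler_pXn2r (ltn0Sn 1)) ?nnegrE ?sqrtr_ge0//; last exact/ltW/Ppos.
  rewrite sqr_sqrtr; last by rewrite oppr_ge0 ltW.
  by have := sqr_ge0 (P r); lra.
have {}hbt r : 0 <= r -> bt <= w r.
  by move=> r0; rewrite leNgt; apply/negP => h; apply: hbt; exists r.
have [c /andP[c1 _] hc] := evt_min (hbt 0 (lexx 0)) (fun x _ => nl_cat H x).
have fc : 0 < f c by apply: (nl_pos H); exact: lt_le_trans (nl_bt H) c1.
have N0 : (0 : R) < n%:R + 1 by rewrite ltr_wpDl.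
have c0 : 0 < f c / (n%:R + 1) by exact: divr_gt0.
apply: (no_linear_decay sol ler01 c0 _ hw) => r r1.
have r0 : 0 < r by lra.
have := @ndecr _ (fun t => t ^+ n * P t - f c / (n%:R + 1) * (t * t ^+ n))
  (fun t => t ^+ n * (f (w t) - f c)) 0 r (ltW r0).
rewrite (exp0n _ n2) !(mul0r, mulr0) subrr => h.
have : 0 <= r ^+ n * P r - f c / (n%:R + 1) * (r * r ^+ n).
  apply: h => t.
  - by move=> _; catt.
  - move=> /andP[t0 _]; have d1 := dP t t0; have d2 := dv_expn n t0.
    by der; field; rewrite !gt_eqF.
  - move=> /andP[t0 _]; apply: mulr_ge0; first by pos.
    rewrite subr_ge0; apply: hc; apply/andP; split; [exact: hbt (ltW t0)|].
    exact: wd (lexx 0) (ltW t0).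
have -> : r ^+ n * P r - f c / (n%:R + 1) * (r * r ^+ n) =
  r ^+ n * (P r - f c / (n%:R + 1) * r) by ring.
rewrite pmulr_rge0 ?exprn_gt0// subr_ge0; apply: le_trans.
by rewrite ler_peMr// ltW.
Qed.

(* Shooting: the initial values for which [w] becomes negative, and those for
   which the energy does, form disjoint open sets. *)
Lemma shooting (B L A : R) :
  (forall s, `|f s| <= B) -> (forall s t, `|f s - f t| <= L * `|s - t|) ->
  bt < A ->
  (forall w P, radial_sol f n w P -> w 0 = A -> exists2 r, 0 <= r & w r < 0) ->
  exists w P, [/\ ground_state f n w P, w 0 <= A & forall r, 0 < r -> 0 < P r].
Proof.
move=> fB fL btA cross.
have b0 := nl_b0 H; have bbt := nl_bt H.
have L0 : 0 <= L by have := fL 1 0; rewrite subr0 normr1 mulr1; apply: le_trans.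
have [q hq] := choice (fun al => let: ex_intro w (ex_intro P h) :=
  @ode_exists R n f B L al (leq_trans (isT : (0 < 2)%N) n2) fB fL in
  ex_intro (fun q : (R -> R) * (R -> R) => radial_sol f n q.1 q.2 /\ q.1 0 = al) (w, P) h).
have sol al : radial_sol f n (q al).1 (q al).2 by case: (hq al).
have q0 al : (q al).1 0 = al by case: (hq al).
have dist al be r : 0 <= r -> ((q al).1 r - (q be).1 r) ^+ 2 +
    ((q al).2 r - (q be).2 r) ^+ 2 <= (al - be) ^+ 2 * expR ((L + 1) * r).
  move=> r0; have := @radial_sol_diff _ n f _ _ _ _ L r (sol al) (sol be).
  by rewrite !q0; apply => //; rewrite r0 lexx.
have lip al be r x : 0 <= r -> x ^+ 2 <= (al - be) ^+ 2 * expR ((L + 1) * r) ->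
    `|x| <= expR ((L + 1) * r) * `|al - be|.
  move=> r0 hx; have e1 : 1 <= expR ((L + 1) * r).
    by rewrite -expR0 ler_expR; pos.
  have p1 : 0 <= expR ((L + 1) * r) * `|al - be| by pos.
  rewrite -(ler_pXn2r (ltn0Sn 1)) ?nnegrE//.
  rewrite exprMn !(real_normK (num_real _)) mulrC; apply: le_trans hx _.
  apply: ler_wpM2l; first exact: sqr_ge0.
  by rewrite expr2 ler_peMl// expR_ge0.
have cq1 r al : 0 <= r -> cat (fun be => (q be).1 r) al.
  move=> r0; apply: (@lipschitz_cat _ _ _ (expR ((L + 1) * r))) => be _.
  apply: lip => //; apply: le_trans (dist be al r r0).
  by rewrite lerDl sqr_ge0.
have cq2 r al : 0 <= r -> cat (fun be => (q be).2 r) al.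
  move=> r0; apply: (@lipschitz_cat _ _ _ (expR ((L + 1) * r))) => be _.
  apply: lip => //; apply: le_trans (dist be al r r0).
  by rewrite lerDr sqr_ge0.
pose E al r := energy F (q al).1 (q al).2 r.
have cE r al : 0 <= r -> cat (E^~ r) al.
  move=> r0; rewrite /E /energy; have c1 := cq1 r al r0; have c2 := cq2 r al r0.
  have c3 : cat (fun be => F ((q be).1 r)) al.
    by apply: cat_comp c1; exact: dv_cat (nl_F H _).
  by catt.
(* [S] contains [(b + bt) / 2], where the energy is negative already at [r = 0]. At its supremum
   neither alternative occurs: negative energy would persist slightly above it, and negative [w]
   would persist at nearby elements of [S], against disjointness. The value [A] is no obstacle,
   since there [w] crosses zero. *)
pose S := [set al | (b + bt) / 2 <= al <= A /\ exists2 r, 0 <= r & E al r < 0].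
have S0 : S ((b + bt) / 2).
  split; first by apply/andP; split; lra.
  exists 0 => //; rewrite /E /energy q0; case: (sol ((b + bt) / 2)) => _ _ -> _ _.
  rewrite [0 ^+ 2]expr2 mulr0 mul0r add0r; apply: (nl_Fneg H); lra.
have supS : has_sup S.
  by split; [exists ((b + bt) / 2)|exists A => x [/andP[]]].
pose al := sup S.
have al1 : (b + bt) / 2 <= al by apply: sup_upper_bound.
have al2 : al <= A by apply: ge_sup; [case: supS|move=> x [/andP[]]].
have alb : b < al by lra.
have al0 : 0 < al by lra.
have disj be r1 r2 : 0 < be -> 0 <= r1 -> 0 <= r2 -> E be r1 < 0 -> (q be).1 r2 < 0 -> False.
  by move=> be0; apply: neg_energy_disjoint; [exact: sol|rewrite q0].
have nE r : 0 <= r -> 0 <= E al r.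
  move=> r0; rewrite leNgt; apply/negP => Er.
  have alA : al < A.
    rewrite lt_neqAle al2 andbT; apply/eqP => e.
    have [r' r'0 wr'] := cross _ _ (sol al) (etrans (q0 al) e).
    exact: (disj al r r').
  have [e e0 he] := near_ball (cat_lt (cE r al r0) Er).
  pose be := Num.min (al + e / 2) A.
  have be1 : al < be by rewrite /be lt_min alA andbT; lra.
  have be2 : be <= al + e / 2 by rewrite /be ge_min lexx.
  have be3 : be <= A by rewrite /be ge_min lexx orbT.
  have : S be.
    split; first by apply/andP; split => //; lra.
    by exists r => //; apply: he; apply/andP; split; lra.
  by move=> /(sup_upper_bound supS); rewrite leNgt be1.
have nN r : 0 <= r -> 0 <= (q al).1 r.
  move=> r0; rewrite leNgt; apply/negP => wr.
  have [e e0 he] := near_ball (cat_lt (cq1 r al r0) wr).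
  have [be [/andP[be1 be2] [r1 r10 Er1]] be3] := sup_adherent e0 supS.
  have be4 : be <= al by apply: sup_upper_bound => //; split; [rewrite be1|exists r1].
  apply: (disj be r1 r) => //; first by lra.
  by apply: he; apply/andP; split; [exact: be3|lra].
have [||||gs Ppos] := @trapped_ground_state (q al).1 (q al).2.
- exact: sol.
- by rewrite q0.
- exact: nN.
- exact: nE.
by exists (q al).1, (q al).2; rewrite q0.
Qed.

End shooting.

(** * Solutions with a large initial value cross zero *)

Section crossing.
Context (R : realType) (f F : R -> R) (b bt : R) (n : nat).
Context (H : nonlin0 f F b bt) (n2 : (2 <= n)%N).
Context (q c1 c2 C3 W0 M0 : R).
Context (q0 : 0 < q) (qn : q * (n%:R - 1) < n%:R + 3).
Context (c10 : 0 < c1) (c20 : 0 < c2) (C30 : 0 < C3) (W01 : 1 <= W0) (bW0 : b <= W0).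
Context (flb : forall s : R, W0 <= s -> c1 * s `^ q <= f s).
Context (fub : forall A s : R, W0 <= A -> s <= A -> f s <= C3 * A `^ q).
Context (Qlb : forall s : R, W0 <= s ->
  c2 * s `^ (q + 1) <= (n%:R + 1) * F s - (n%:R - 1) / 2 * s * f s).
Context (M00 : 0 <= M0) (fM : forall s : R, - M0 <= f s).
Implicit Types (w P : R -> R) (r s t x y z e u th al : R).

Let N : R := n%:R + 1.

Let N0 : 0 < N. Proof. by rewrite /N ltr_wpDl. Qed.

Let n1R : (0 : R) < n%:R - 1. Proof. by rewrite subr_gt0 ltr1n. Qed.

(** [al ^ (ee * N / 2)] is the size of [al ^ (q + 1) * rho ^ N] for [rho] of order
    [al ^ ((1 - q) / 2)], that is, of what Pohozaev's functional gains while [w >= al / 2].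
    Positivity of [ee] is the subcriticality of [q]. *)
Let ee := 2 * (q + 1) / N + 1 - q.

Let ee0 : 0 < ee.
Proof.
rewrite /ee (_ : _ - q = (n%:R + 3 - q * (n%:R - 1)) / N); last first.
  by rewrite /N; field; rewrite gt_eqF.
by apply: divr_gt0; rewrite ?subr_gt0.
Qed.

(** [al ^ (gam / 2)] will bound the radius at which [w] reaches [W0]. The maximum makes [gam]
    positive and at least [1 - q], and both of its entries are below [ee]. *)
Let gam := Num.max (ee / 2) (1 - q + (q + 1) / N).

Let gam0 : 0 < gam. Proof. by rewrite /gam lt_max divr_gt0. Qed.

Let gam1 : 1 - q <= gam.
Proof.
rewrite /gam le_max; apply/orP; right; rewrite lerDl.
by apply: divr_ge0; [have := q0; lra|exact: ltW].
Qed.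

Let game : gam < ee.
Proof.
have h := ee0; rewrite /gam gt_max; apply/andP; split; first by lra.
have : 0 < (q + 1) / N by apply: divr_gt0 => //; have := q0; lra.
by rewrite /ee; lra.
Qed.

Let W0p : 0 < W0. Proof. exact: lt_le_trans ltr01 W01. Qed.

Section noncrossing.
Context (al : R) (w P : R -> R).
Context (al2 : 2 * W0 <= al) (bal : b < al).
Context (sol : radial_sol (fun s => f (Num.min s al)) n w P).
Context (w0 : w 0 = al) (hw : forall r, 0 <= r -> 0 <= w r).
Let cw x : cat w x. Proof. by case: sol. Qed.
Let cP x : cat P x. Proof. by case: sol. Qed.
Let P0 : P 0 = 0. Proof. by case: sol. Qed.
Let dw r : 0 < r -> dv w r (- P r). Proof. by case: sol => _ _ _ h _; exact: h. Qed.
Let dP r : 0 < r -> dv P r (f (Num.min (w r) al) - n%:R * P r / r).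
Proof. by case: sol => _ _ _ _; exact. Qed.
Let alp : 0 < al. Proof. by have := W0p; have := al2; lra. Qed.
Let W0al : W0 < al. Proof. by have := W0p; have := al2; lra. Qed.

Lemma noncrossing_flux_ge m r : 0 < r ->
  (forall t, 0 < t -> t < r -> m <= f (Num.min (w t) al)) -> m * r / N <= P r.
Proof.
move=> r0 hm.
have := @ndecr _ (fun t => t ^+ n * P t - m / N * (t * t ^+ n))
  (fun t => t ^+ n * (f (Num.min (w t) al) - m)) 0 r (ltW r0).
rewrite (exp0n _ n2) !(mul0r, mulr0) subrr => h.
have : 0 <= r ^+ n * P r - m / N * (r * r ^+ n).
  apply: h => t.
  - by move=> _; catt.
  - move=> /andP[t0 _]; have d1 := dP t0; have d2 := dv_expn n t0.
    by have := N0 => ?; der; rewrite /N; field; rewrite !gt_eqF.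
  - move=> /andP[t0 tr]; apply: mulr_ge0; first by pos.
    by rewrite subr_ge0; exact: hm.
have -> : r ^+ n * P r - m / N * (r * r ^+ n) = r ^+ n * (P r - m * r / N) by ring.
by rewrite pmulr_rge0 ?exprn_gt0// subr_ge0.
Qed.

Lemma noncrossing_flux_le m r : 0 < r ->
  (forall t, 0 < t -> t < r -> f (Num.min (w t) al) <= m) -> P r <= m * r / N.
Proof.
move=> r0 hm.
have := @nincr _ (fun t => t ^+ n * P t - m / N * (t * t ^+ n))
  (fun t => t ^+ n * (f (Num.min (w t) al) - m)) 0 r (ltW r0).
rewrite (exp0n _ n2) !(mul0r, mulr0) subrr => h.
have : r ^+ n * P r - m / N * (r * r ^+ n) <= 0.
  apply: h => t.
  - by move=> _; catt.
  - move=> /andP[t0 _]; have d1 := dP t0; have d2 := dv_expn n t0.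
    by have := N0 => ?; der; rewrite /N; field; rewrite !gt_eqF.
  - move=> /andP[t0 tr]; apply: mulr_ge0_le0; first by pos.
    by rewrite subr_le0; exact: hm.
have -> : r ^+ n * P r - m / N * (r * r ^+ n) = r ^+ n * (P r - m * r / N) by ring.
by rewrite pmulr_rle0 ?exprn_gt0// subr_le0.
Qed.

(** If [w] stayed above [W0], then [f >= c1] would keep [P] away from 0 and drive [w] negative. Up
    to the first radius with [w = W0] the function decreases from [al], so the truncation is
    inactive. *)
Lemma noncrossing_r1 : exists r1, [/\ 0 < r1, w r1 = W0,
  forall r, 0 <= r -> r <= r1 -> W0 <= w r <= al & forall r, 0 < r -> r <= r1 -> 0 < P r].
Proof.
have [hW|] := pselect (forall r, 0 <= r -> W0 < w r).
  exfalso; have c0 : 0 < c1 / N by exact: divr_gt0.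
  apply: (no_linear_decay sol ler01 c0 _ hw) => r r1.
  have r0 : 0 < r by lra.
  apply: (@le_trans _ _ (c1 * r / N)).
    by rewrite mulrAC; apply: ler_peMr; exact: ltW.
  apply: noncrossing_flux_ge => // t t0 _.
  have m1 : W0 <= Num.min (w t) al.
    by rewrite le_min (ltW W0al) andbT; apply/ltW/hW/ltW.
  apply: le_trans (flb m1); rewrite ler_peMr ?(ltW c10)//.
  rewrite -[X in X <= _](powRr0 (Num.min (w t) al)).
  by apply: ler_powR; [exact: le_trans m1|exact: ltW].
move=> /existsNP[r2 /not_implyP[r20 /negP]]; rewrite -leNgt => wr2.
have r2p : 0 < r2.
  rewrite lt_neqAle r20 andbT; apply/eqP => e.
  by move: wr2; rewrite -e w0 leNgt W0al.
have [|||r1 [/andP[r10 _] e1 h1]] := @first_zero _ (fun r => w r - W0) 0 r2 r2p.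
- by move=> x _; catt.
- by rewrite w0 subr_gt0.
- by rewrite subr_le0.
have wW r : 0 <= r -> r < r1 -> W0 < w r.
  by move=> r0 rr1; rewrite -subr_gt0; apply: h1; rewrite r0.
have Ppos r : 0 < r -> r <= r1 -> 0 < P r.
  move=> r0 rr1.
  have := @incr _ (fun t => t ^+ n * P t) (fun t => t ^+ n * f (Num.min (w t) al)) 0 r r0.
  rewrite (exp0n _ n2) mul0r => h.
  suff : 0 < r ^+ n * P r by rewrite pmulr_rgt0// exprn_gt0.
  apply: h => t.
  - by move=> _; catt.
  - move=> /andP[t0 _].
    by apply: (@flux_deriv _ _ (fun t => f (Num.min (w t) al))) => //; exact: dP.
  - move=> /andP[t0 tr]; apply: mulr_gt0; first by pos.
    apply: (nl_pos H); rewrite lt_min bal andbT.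
    by apply: le_lt_trans bW0 _; apply: wW; [exact: ltW|exact: lt_le_trans rr1].
exists r1; split => //; first by lra.
move=> r r0 rr1; apply/andP; split.
  move: rr1; rewrite le_eqVlt => /predU1P[->|rr1]; first by lra.
  exact/ltW/wW.
move: r0; rewrite le_eqVlt => /predU1P[<-|r0]; first by rewrite w0.
rewrite -w0; apply: ltW; apply: (w_decr sol (lexx 0) r0) => t t0 tr.
by apply: Ppos => //; apply: ltW; exact: lt_le_trans rr1.
Qed.

(** [kap] enters the radius [rho] up to which [w >= al / 2], [C4] the bound of the radius [r1] of
    [noncrossing_r1], and [C5] the bound of [Num.min 1 r1 * P r1]. *)
Let kap := Num.sqrt (N / C3).
Let C4 := Num.sqrt (2 * N / (gam * c1)).
Let C5 := 2 ^+ n * (W0 + M0).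

(** Pohozaev's functional gains a multiple of [al ^ (q + 1) * rho ^ N] on [[0, rho]] and does not
    decrease until [w = W0]. At that radius [r1] it involves only [r1], the fixed level [W0] and the
    slope [P r1], which cannot be large if [w] is to stay nonnegative. *)
Lemma noncrossing_bound :
  c2 / 2 `^ (q + 1) * kap ^+ n.+1 / N * al `^ (ee * N / 2) <=
  (C5 ^+ 2 / 2 + `|F W0|) * (1 + C4 ^+ n.+1 * al `^ (gam * N / 2)).
Proof.
have [r1 [r10 wr1 hr1 Pr1]] := noncrossing_r1.
have minE t : 0 <= t -> t <= r1 -> Num.min (w t) al = w t.
  by move=> t0 t1; apply/min_idPl; case/andP: (hr1 t t0 t1).
have wge t : 0 <= t -> t <= r1 -> W0 <= w t by move=> t0 t1; case/andP: (hr1 t t0 t1).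
have wle t : 0 <= t -> t <= r1 -> w t <= al by move=> t0 t1; case/andP: (hr1 t t0 t1).
have wp t : 0 <= t -> t <= r1 -> 0 < w t by move=> t0 t1; exact: lt_le_trans (wge t t0 t1).
have alq : 0 < al `^ q by exact: powR_gt0.
have wd s t : 0 <= s -> s <= t -> t <= r1 -> w t <= w s.
  move=> s0; rewrite le_eqVlt => /predU1P[->//|st] tr; apply/ltW/(w_decr sol s0 st).
  move=> x sx xt; apply: Pr1; first exact: le_lt_trans sx.
  by apply: ltW; exact: lt_le_trans tr.
(* [P r <= C3 al ^ q r / N], hence [w >= al / 2] on [0, rho] *)
pose rho := kap * al `^ ((1 - q) / 2).
have kap0 : 0 < kap by rewrite sqrtr_gt0 divr_gt0.
have rho0 : 0 < rho by rewrite /rho mulr_gt0// powR_gt0.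
have rho2 : C3 * al `^ q / N * rho ^+ 2 = al.
  rewrite /rho exprMn sqr_sqrtr; last by apply: divr_ge0; exact: ltW.
  rewrite -powR_mulrn ?powR_ge0// -powRrM.
  rewrite (_ : (1 - q) / 2 * 2%:R = 1 - q); last by field.
  rewrite (_ : C3 * al `^ q / N * (N / C3 * al `^ (1 - q)) = al `^ q * al `^ (1 - q)).
    rewrite -powRD; last by rewrite (gt_eqF alp) implybT.
    by rewrite addrC subrK powRr1// ltW.
  by field; rewrite !gt_eqF.
have wlow t : 0 < t -> t <= r1 -> al - C3 * al `^ q / N * (t ^+ 2 / 2) <= w t.
  move=> t0 tr1.
  have := @ndecr _ (fun s => w s + C3 * al `^ q / N * (s ^+ 2 / 2))
    (fun s => C3 * al `^ q * s / N - P s) 0 t (ltW t0).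
  rewrite w0 [0 ^+ 2]expr2 !(mul0r, mulr0) addr0 => h.
  suff : al <= w t + C3 * al `^ q / N * (t ^+ 2 / 2) by lra.
  apply: h => s.
  - by move=> _; catt.
  - by move=> /andP[s0 _]; have d1 := dw s0; der => /=; field; rewrite gt_eqF.
  - move=> /andP[s0 st]; rewrite subr_ge0; apply: noncrossing_flux_le => // x x0 xs.
    by apply: fub; [exact: ltW|rewrite ge_min lexx orbT].
have rho_r1 : rho <= r1.
  rewrite leNgt; apply/negP => r1rho; have := wlow r1 r10 (lexx _); rewrite wr1.
  have : r1 ^+ 2 < rho ^+ 2 by rewrite ltr_pXn2r ?nnegrE// ltW.
  have k0 : 0 < C3 * al `^ q / N by apply: divr_gt0 => //; apply: mulr_gt0.
  by rewrite -(ltr_pM2l k0) rho2; have := al2; lra.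
have whalf t : 0 < t -> t <= rho -> al / 2 <= w t.
  move=> t0 trho; have := wlow t t0 (le_trans trho rho_r1).
  have : t ^+ 2 <= rho ^+ 2 by rewrite ler_pXn2r ?nnegrE// ltW.
  have k0 : 0 < C3 * al `^ q / N by apply: divr_gt0 => //; apply: mulr_gt0.
  by rewrite -(ler_pM2l k0) rho2; lra.
(* Pohozaev's functional [M], with [M' = r ^ n Q(w)] *)
pose M r := r * (r ^+ n * P r) * P r / 2 + r * r ^+ n * F (w r) -
  (n%:R - 1) / 2 * (r ^+ n * P r) * w r.
pose Q s := N * F s - (n%:R - 1) / 2 * s * f s.
have cM r : cat M r.
  have cF : cat (fun r => F (w r)) r by apply: cat_comp (cw r); exact: dv_cat (nl_F H _).
  by rewrite /M; catt.
have dM r : 0 < r -> r <= r1 -> dv M r (r ^+ n * Q (w r)).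
  move=> r0 rr1; have d1 := dw r0; have d2 := dP r0; have d3 := dv_expn n r0.
  have mt := minE r (ltW r0) rr1; rewrite mt in d2.
  have d4 := dv_comp (nl_F H _) d1.
  by rewrite /M /Q /N; der; field; rewrite gt_eqF.
have Qpos s : W0 <= s -> 0 <= Q s.
  move=> Ws; apply: le_trans (Qlb Ws); apply: mulr_ge0; first exact: ltW.
  exact: powR_ge0.
have Mrho : c2 * (al / 2) `^ (q + 1) / N * (rho * rho ^+ n) <= M rho.
  have := @ndecr _ (fun t => M t - c2 * (al / 2) `^ (q + 1) / N * (t * t ^+ n))
    (fun t => t ^+ n * (Q (w t) - c2 * (al / 2) `^ (q + 1))) 0 rho (ltW rho0).
  have Mz : M 0 = 0 by rewrite /M (exp0n _ n2) !(mul0r, mulr0, subr0, addr0).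
  rewrite Mz (exp0n _ n2) !(mul0r, mulr0) subrr => h.
  rewrite -subr_ge0; apply: h => t.
  - by move=> _; have := cM t => cMt; catt.
  - move=> /andP[t0 tr]; have d1 := dM t t0 (le_trans (ltW tr) rho_r1).
    have d2 := dv_expn n t0.
    by have := N0 => ?; der; rewrite /N; field; rewrite !gt_eqF.
  - move=> /andP[t0 tr]; apply: mulr_ge0; first by pos.
    have wt := wge t (ltW t0) (le_trans (ltW tr) rho_r1).
    rewrite subr_ge0; apply: le_trans (Qlb wt).
    apply: ler_wpM2l; first exact: ltW.
    apply: ge0_ler_powR; [by have := q0; lra|by rewrite nnegrE; have := alp; lra| |].
      by rewrite nnegrE; apply: ltW; exact: lt_le_trans wt.
    by apply: whalf => //; exact: ltW.
have Mr1 : M rho <= M r1.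
  apply: (@ndecr _ M (fun t => t ^+ n * Q (w t)) rho r1 rho_r1) => t.
  - by [].
  - move=> /andP[t1 t2]; apply: dM; [exact: lt_trans t1|exact: ltW].
  - move=> /andP[t1 t2]; have t0 := lt_trans rho0 t1.
    apply: mulr_ge0; first by pos.
    by apply: Qpos; apply: wge; exact: ltW.
(* From [P t >= c1 w ^ q t / N], [w >= 1] and [gam - 1 + q >= 0] one gets
   [(w ^ gam)' <= - gam c1 t / N]; integration from the value [al ^ gam] bounds [r1 ^ 2]. *)
have r1_le : r1 <= C4 * al `^ (gam / 2).
  have := @nincr _ (fun t => w t `^ gam + gam * c1 / N * (t ^+ 2 / 2))
    (fun t => - (gam * w t `^ (gam - 1) * P t) + gam * c1 / N * t) 0 r1 (ltW r10).
  rewrite w0 [0 ^+ 2]expr2 !(mul0r, mulr0) addr0 => h.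
  have k0 : 0 < gam * c1 / (2 * N) by apply: divr_gt0; apply: mulr_gt0.
  have h1 : gam * c1 / (2 * N) * r1 ^+ 2 <= al `^ gam.
    have : w r1 `^ gam + gam * c1 / N * (r1 ^+ 2 / 2) <= al `^ gam.
      apply: h => t.
      - move=> /andP[t0 tr]; have c0 : cat (fun t => w t `^ gam) t.
          apply: (cat_comp (f := fun y => y `^ gam)) => //.
          exact: dv_cat (dv_powR gam (wp t t0 tr) (dv_id _)).
        by catt.
      - move=> /andP[t0 tr]; have d1 := dv_powR gam (wp t (ltW t0) (ltW tr)) (dw t0).
        by der => /=; field; rewrite gt_eqF.
      - move=> /andP[t0 tr]; have wt := wge t (ltW t0) (ltW tr).
        have wt0 := wp t (ltW t0) (ltW tr).
        have Pt : c1 * w t `^ q * t / N <= P t.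
          apply: noncrossing_flux_ge => // s s0 st.
          have sr := ltW (lt_trans st tr).
          rewrite minE// ?(ltW s0)//; apply: le_trans (flb (wge s (ltW s0) sr)).
          apply: ler_wpM2l; first exact: ltW.
          apply: ge0_ler_powR; [exact: ltW|by rewrite nnegrE ltW| |].
            by rewrite nnegrE; apply/ltW/wp => //; exact: ltW.
          by apply: wd; [exact: ltW|exact: ltW|exact: ltW].
        have p1 : 1 <= w t `^ (gam - 1) * w t `^ q.
          rewrite -powRD; last by rewrite (gt_eqF wt0) implybT.
          rewrite -[X in X <= _](powRr0 (w t)); apply: ler_powR.
            exact: le_trans wt.
          by have := gam1; lra.
        have p2 : 0 <= gam * w t `^ (gam - 1) by apply: mulr_ge0; [exact: ltW|exact: powR_ge0].
        have : gam * w t `^ (gam - 1) * (c1 * w t `^ q * t / N) <=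
          gam * w t `^ (gam - 1) * P t by exact: ler_wpM2l.
        have : gam * c1 / N * t <= gam * c1 / N * t * (w t `^ (gam - 1) * w t `^ q).
          by apply: ler_peMr => //; apply: mulr_ge0; [apply: divr_ge0; [apply: mulr_ge0|]|]; exact: ltW.
        rewrite (_ : gam * c1 / N * t * _ =
          gam * w t `^ (gam - 1) * (c1 * w t `^ q * t / N)); last by ring.
        by lra.
    have := powR_ge0 (w r1) gam.
    rewrite (_ : gam * c1 / N * (r1 ^+ 2 / 2) = gam * c1 / (2 * N) * r1 ^+ 2); last first.
      by have := N0 => ?; field; rewrite gt_eqF.
    by lra.
  have p0 : 0 <= C4 * al `^ (gam / 2) by apply: mulr_ge0; [exact: sqrtr_ge0|exact: powR_ge0].
  rewrite -(ler_pXn2r (ltn0Sn 1)) ?nnegrE//; last exact: ltW.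
  rewrite exprMn sqr_sqrtr; last first.
    by apply: divr_ge0; [apply: mulr_ge0|apply: mulr_ge0] => //; exact: ltW.
  have -> : (al `^ (gam / 2)) ^+ 2 = al `^ gam.
    by rewrite -powR_mulrn ?powR_ge0// -powRrM; congr (_ `^ _); field.
  rewrite -(ler_pM2l k0) (_ : _ * (_ * al `^ gam) = al `^ gam)//.
  by have := N0 => ?; have := gam0 => ?; field; rewrite !gt_eqF.
pose h := Num.min 1 r1.
have h0 : 0 < h by rewrite /h lt_min ltr01.
have h1 : h <= 1 by rewrite /h ge_min lexx.
have hr : h <= r1 by rewrite /h ge_min lexx orbT.
(* On [[r1, r1 + h]] the source is at least [- M0], so the flux loses little. As [x <= 2 r1] there,
   a large [P r1] would keep [P] large and bring [w] from [W0] below 0 within length [h]. *)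
have slope : h * P r1 <= C5.
  have r1h : r1 < r1 + h by rewrite ltrDl.
  have [x /andP[x1 x2] ex] := mvt r1h (fun x _ => cw x)
    (fun x hx => dw (lt_trans r10 (proj1 (andP hx)))).
  have x0 := lt_trans r10 x1; have xn : 0 < x ^+ n by exact: exprn_gt0.
  have hx : r1 ^+ n * P r1 <= x ^+ n * P x + M0 * x ^+ n * (x - r1).
    have := @ndecr _ (fun t => t ^+ n * P t + M0 * x ^+ n * (t - r1))
      (fun t => t ^+ n * f (Num.min (w t) al) + M0 * x ^+ n) r1 x (ltW x1).
    rewrite subrr mulr0 addr0; apply => t.
    - by move=> _; catt.
    - move=> /andP[t1 _]; have t0 := lt_trans r10 t1.
      have d1 := @flux_deriv _ n (fun t => f (Num.min (w t) al)) _ _ t0 (dP t0).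
      by der; ring.
    - move=> /andP[t1 t2]; have t0 := lt_trans r10 t1.
      have e1 : t ^+ n <= x ^+ n by rewrite lerXn2r ?nnegrE// ltW.
      have e2 : 0 < t ^+ n by exact: exprn_gt0.
      have e3 : t ^+ n * (- M0) <= t ^+ n * f (Num.min (w t) al).
        by apply: ler_wpM2l; [exact: ltW|exact: fM].
      have e4 : M0 * t ^+ n <= M0 * x ^+ n by exact: ler_wpM2l.
      by lra.
  have Pr1p := Pr1 r1 r10 (lexx _).
  have x2r1 : x ^+ n <= 2 ^+ n * r1 ^+ n.
    rewrite -exprMn; apply: lerXn2r; rewrite ?nnegrE; [exact: ltW|by apply: mulr_ge0 => //; exact: ltW|].
    by rewrite mulr_natl mulr2n; apply: ltW; apply: lt_le_trans x2 _; rewrite lerD2l.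
  have hx2 : x ^+ n * P r1 <= x ^+ n * (2 ^+ n * (P x + M0 * (x - r1))).
    apply: (@le_trans _ _ (2 ^+ n * (r1 ^+ n * P r1))).
      by rewrite mulrA; apply: ler_wpM2r => //; exact: ltW.
    rewrite [X in _ <= X]mulrCA; apply: ler_wpM2l; first by pos.
    by apply: le_trans hx _; rewrite mulrDr; lra.
  rewrite ler_pM2l// in hx2.
  have hh : 0 <= w (r1 + h) by apply: hw; lra.
  rewrite wr1 in ex; have ex2 : P x * h <= W0 by lra.
  apply: (@le_trans _ _ (h * (2 ^+ n * (P x + M0 * (x - r1))))).
    by apply: ler_wpM2l => //; exact: ltW.
  rewrite /C5 mulrCA; apply: ler_wpM2l; first by pos.
  have : M0 * (x - r1) * h <= M0.
    rewrite -mulrA -[X in _ <= X]mulr1; apply: ler_wpM2l => //.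
    by apply: mulr_ile1 => //; [rewrite subr_ge0 ltW|exact: ltW|rewrite lerBlDl ltW// (lt_le_trans x2)// lerD2l].
  by lra.
have C50 : 0 <= C5 by apply: mulr_ge0; [exact: exprn_ge0|have := W0p; have := M00; lra].
have rS : r1 * r1 ^+ n * P r1 ^+ 2 <= C5 ^+ 2 * (1 + r1 ^+ n.+1).
  have Pr1p := Pr1 r1 r10 (lexx _).
  have s2 : (h * P r1) ^+ 2 <= C5 ^+ 2.
    by rewrite ler_pXn2r ?nnegrE//; apply: mulr_ge0; exact: ltW.
  have C52 : 0 <= C5 ^+ 2 by exact: sqr_ge0.
  have rn0 : 0 <= r1 ^+ n.+1 by apply: exprn_ge0; exact: ltW.
  have [r1le|r1ge] := leP r1 1.
    have eh : h = r1 by rewrite /h; exact: min_r.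
    rewrite eh in s2.
    have rn1 : r1 ^+ n.-1 <= 1 by apply: exprn_ile1 => //; exact: ltW.
    have rn2 : 0 <= r1 ^+ n.-1 by apply: exprn_ge0; exact: ltW.
    rewrite (_ : r1 * r1 ^+ n = r1 ^+ n.-1 * r1 ^+ 2); last first.
      rewrite -exprS -exprD addn2 -[in LHS](prednK (n := n))//.
      exact: leq_trans n2.
    rewrite -mulrA -exprMn; apply: (@le_trans _ _ (C5 ^+ 2)).
      by apply: le_trans (ler_piMl (sqr_ge0 _) rn1) s2.
    by rewrite mulrDr mulr1 lerDl mulr_ge0.
  have eh : h = 1 by rewrite /h; apply: min_l; exact: ltW.
  rewrite eh mul1r in s2; rewrite -exprS mulrC mulrDr mulr1.
  apply: (@le_trans _ _ (C5 ^+ 2 * r1 ^+ n.+1)); first exact: ler_wpM2r.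
  by rewrite lerDr.
have MC : M r1 <= (C5 ^+ 2 / 2 + `|F W0|) * (1 + r1 ^+ n.+1).
  have Pr1p := Pr1 r1 r10 (lexx _).
  have rn0 : 0 < r1 ^+ n by exact: exprn_gt0.
  have t1 : 0 <= (n%:R - 1) / 2 * (r1 ^+ n * P r1) * w r1.
    have := n1R => ?; have := W0p; rewrite wr1 => ?.
    by pos.
  have t2 : r1 * r1 ^+ n * F (w r1) <= `|F W0| * (1 + r1 ^+ n.+1).
    rewrite wr1 -exprS mulrC mulrDr mulr1.
    have : F W0 * r1 ^+ n.+1 <= `|F W0| * r1 ^+ n.+1.
      by apply: ler_wpM2r; [apply: exprn_ge0; exact: ltW|exact: ler_norm].
    by have := normr_ge0 (F W0); lra.
  have t3 : r1 * (r1 ^+ n * P r1) * P r1 / 2 = r1 * r1 ^+ n * P r1 ^+ 2 / 2 by ring.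
  by rewrite /M t3; lra.
have rr : r1 ^+ n.+1 <= C4 ^+ n.+1 * al `^ (gam * N / 2).
  have e : (al `^ (gam / 2)) ^+ n.+1 = al `^ (gam * N / 2).
    rewrite -powR_mulrn ?powR_ge0// -powRrM; congr (_ `^ _).
    by rewrite -natr1 /N; ring.
  rewrite -e -exprMn lerXn2r ?nnegrE//; first exact: ltW.
  by apply: le_trans r1_le; exact: ltW.
have eL : c2 / 2 `^ (q + 1) * kap ^+ n.+1 / N * al `^ (ee * N / 2) =
    c2 * (al / 2) `^ (q + 1) / N * (rho * rho ^+ n).
  rewrite -exprS /rho exprMn -(powR_mulrn _ (powR_ge0 _ _)) -powRrM.
  rewrite powRM ?invr_ge0//; last exact: ltW.
  have i2 : (2^-1 : R) `^ (q + 1) = (2 `^ (q + 1))^-1.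
    by rewrite -powR_inv1// -powRrM mulN1r powRN.
  rewrite i2.
  have -> : al `^ (ee * N / 2) = al `^ (q + 1) * al `^ ((1 - q) / 2 * n.+1%:R).
    rewrite -powRD; last by rewrite (gt_eqF alp) implybT.
    have eN : n.+1%:R = N by rewrite /N natr1.
    congr (_ `^ _); rewrite /ee eN; have := N0 => ?.
    by field; rewrite gt_eqF.
  by ring.
rewrite eL; apply: le_trans Mrho _; apply: le_trans Mr1 _; apply: le_trans MC _.
apply: ler_wpM2l; last by rewrite lerD2l.
by apply: addr_ge0 => //; apply: divr_ge0 => //; exact: sqr_ge0.
Qed.

End noncrossing.

(** In [noncrossing_bound] the left side has the higher power of [al]. Taking [A ^ d = X], with [d]
    the difference of the exponents and [X] beyond the quotient of the constants, makes it fail. *)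
Lemma crossing : exists A, bt < A /\ forall w P,
  radial_sol (fun s => f (Num.min s A)) n w P -> w 0 = A -> exists2 r, 0 <= r & w r < 0.
Proof.
pose c7 := c2 / 2 `^ (q + 1) * Num.sqrt (N / C3) ^+ n.+1 / N.
pose C4 := Num.sqrt (2 * N / (gam * c1)) ^+ n.+1.
pose C8 := ((2 ^+ n * (W0 + M0)) ^+ 2 / 2 + `|F W0|) * (1 + C4).
have c70 : 0 < c7.
  have := powR_gt0 (q + 1) (ltr0n R 2); have : 0 < Num.sqrt (N / C3).
    by rewrite sqrtr_gt0 divr_gt0.
  by move=> h1 h2; rewrite /c7; have := N0 => ?; have := c20 => ?; pos.
have C40 : 0 <= C4 by apply: exprn_ge0; exact: sqrtr_ge0.
have C80 : 0 <= C8.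
  apply: mulr_ge0; last by apply: addr_ge0.
  by apply: addr_ge0 => //; apply: divr_ge0 => //; exact: sqr_ge0.
pose d := (ee - gam) * N / 2.
have d0 : 0 < d by apply: divr_gt0 => //; apply: mulr_gt0 => //; rewrite subr_gt0.
pose X := (2 * W0 + `|bt| + 1) `^ d + C8 / c7 + 1.
have bp : 0 < 2 * W0 + `|bt| + 1 by have := W0p; have := normr_ge0 bt; lra.
have q8 : 0 <= C8 / c7 by apply: divr_ge0 => //; exact: ltW.
have Xp : 0 < X by have := powR_ge0 (2 * W0 + `|bt| + 1) d; rewrite /X; lra.
pose A := X `^ d^-1.
have Ad : A `^ d = X by rewrite /A -powRrM mulVf ?gt_eqF// powRr1// ltW.
have Age : 2 * W0 + `|bt| + 1 <= A.
  have -> : 2 * W0 + `|bt| + 1 = ((2 * W0 + `|bt| + 1) `^ d) `^ d^-1.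
    by rewrite -powRrM mulfV ?gt_eqF// powRr1// ltW.
  apply: ge0_ler_powR; [by rewrite invr_ge0 ltW|by rewrite nnegrE powR_ge0|by rewrite nnegrE ltW|].
  by rewrite /X; lra.
have btA : bt < A by have := ler_norm bt; have := W0p; lra.
exists A; split => // w P sol w0; apply: contrapT => nc.
have hw r : 0 <= r -> 0 <= w r.
  by move=> r0; rewrite leNgt; apply/negP => wr; apply: nc; exists r.
have A2 : 2 * W0 <= A by have := normr_ge0 bt; lra.
have bA := lt_trans (nl_bt H) btA.
have := noncrossing_bound A2 bA sol w0 hw.
rewrite -/c7 -/C4 => hb.
have A1 : 1 <= A by have := W01; have := normr_ge0 bt; lra.
have Ap : 0 < A by lra.
have p1 : 1 <= A `^ (gam * N / 2).
  rewrite -[X in X <= _](powRr0 A); apply: ler_powR => //.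
  by apply: divr_ge0 => //; apply: mulr_ge0; exact: ltW.
have e : A `^ (ee * N / 2) = X * A `^ (gam * N / 2).
  rewrite -Ad -powRD; last by rewrite (gt_eqF Ap) implybT.
  by congr (_ `^ _); rewrite /d; field.
have : c7 * X * A `^ (gam * N / 2) <= C8 * A `^ (gam * N / 2).
  rewrite -mulrA -e; apply: le_trans hb _; rewrite /C8.
  rewrite -[X in _ <= X]mulrA; apply: ler_wpM2l.
    by apply: addr_ge0 => //; apply: divr_ge0 => //; exact: sqr_ge0.
  by rewrite mulrDl mul1r lerD2r.
rewrite ler_pM2r; last exact: lt_le_trans p1.
rewrite leNgt => /negP; apply; rewrite mulrC -ltr_pdivrMr//.
by have := powR_ge0 (2 * W0 + `|bt| + 1) d; rewrite /X; lra.
Qed.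

End crossing.

(** * Truncation of the nonlinearity above the level [A] *)

Section truncation.
Context (R : realType) (f F : R -> R) (b bt A : R).
Context (H : nonlin0 f F b bt) (btA : bt < A).
Implicit Types (s t x : R).

Let b0 := nl_b0 H.
Let bbt := nl_bt H.

Let A0 : 0 < A. Proof. by have := b0; have := bbt; have := btA; lra. Qed.

Lemma trunc_lip : exists2 L : R, 0 <= L &
  forall s t, `|f (Num.min s A) - f (Num.min t A)| <= L * `|s - t|.
Proof.
have [L L0 hL] := nl_lip H A; exists L => // s t.
have mA x : Num.min x A <= A by rewrite ge_min lexx orbT.
apply: le_trans (hL _ _ (mA s) (mA t)) _; apply: ler_wpM2l => //.
wlog st : s t / s <= t.
  move=> h; have [/h//|/ltW/h] := leP s t.
  by rewrite distrC [`|s - t|]distrC.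
rewrite distrC [`|s - t|]distrC (@ger0_norm _ (t - s)) ?subr_ge0//.
have mm : Num.min s A <= Num.min t A by rewrite le_min ge_min st/= mA.
rewrite ger0_norm ?subr_ge0//.
have [sA|As] := leP s A; have [tA|At] := leP t A; lra.
Qed.

Lemma trunc_bounded : exists B : R, forall s, `|f (Num.min s A)| <= B.
Proof.
have [L L0 hL] := nl_lip H A; exists (L * A) => s.
have [s0|s0] := leP s 0.
  rewrite min_l; last by apply: le_trans s0 (ltW A0).
  by rewrite (nl_le0 H s0) normr0; apply: mulr_ge0 => //; exact: ltW.
have mA : Num.min s A <= A by rewrite ge_min lexx orbT.
have m0 : 0 <= Num.min s A by rewrite le_min (ltW s0) (ltW A0).
have := hL _ 0 mA (ltW A0); rewrite (nl_le0 H (lexx 0)) !subr0 (ger0_norm m0) => h.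
by apply: le_trans h _; exact: ler_wpM2l.
Qed.

(** The primitive has to be rebuilt; it agrees with [F] up to [A], and since [bt < A] all sign
    conditions survive. *)
Lemma trunc_nonlin0 : exists G : R -> R, nonlin0 (fun s => f (Num.min s A)) G b bt.
Proof.
have cg s : cat (fun s => f (Num.min s A)) s.
  apply: cat_comp; first exact: (nl_cat H).
  by apply: cat_min; [exact: cat_id|exact: cat_cst].
have [G [dG G0]] := primitive cg; exists G.
have GF s : s <= A -> G s = F s.
  move=> sA; have dd x : x <= A -> dv (fun x => G x - F x) x 0.
    move=> xA; apply: (dv_eq (dvB (dG x) (nl_F H x))).
    by rewrite min_l// subrr.
  have F0 : F 0 = 0 by apply: (nl_F0 H).
  have [s0|s0|->] := ltgtP s 0; last by rewrite G0 F0.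
  - have xA x : s <= x <= 0 -> x <= A by move=> /andP[_ x0]; apply: le_trans x0 (ltW A0).
    have [||c _] := mvt (f := fun x => G x - F x) (df := fun=> 0) s0.
    + by move=> x /xA /dd; exact: dv_cat.
    + by move=> x /andP[x1 x2]; apply: dd; apply: xA; rewrite !ltW.
    + by rewrite G0 F0 mul0r; lra.
  - have [||c _] := mvt (f := fun x => G x - F x) (df := fun=> 0) s0.
    + by move=> x /andP[_ xs]; apply: dv_cat (dd _ _); exact: le_trans sA.
    + by move=> x /andP[_ xs]; apply: dd; exact: le_trans (ltW xs) sA.
    + by rewrite G0 F0 mul0r; lra.
have sub s : s <= bt -> s <= A by move=> sb; apply: le_trans sb (ltW btA).
split => //.
- by move=> s s0; rewrite min_l ?(nl_le0 H)// (le_trans s0)// ltW.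
- by rewrite min_l ?(nl_fb H)//; apply: sub; exact: ltW.
- move=> s s0 sb; rewrite min_l ?(nl_neg H)//; apply: sub.
  by apply: ltW; exact: lt_trans sb bbt.
- move=> s bs; apply: (nl_pos H); rewrite lt_min bs /=.
  by apply: lt_trans btA; exact: bbt.
- by move=> s s0; rewrite GF ?(nl_F0 H)// (le_trans s0)// ltW.
- by move=> s s0 sb; rewrite GF ?(nl_Fneg H)//; apply: sub; exact: ltW.
- by move=> B; have [L L0 hL] := trunc_lip; exists L => // s t _ _; exact: hL.
Qed.

End truncation.

(** * Ground states of the original nonlinearity and their decay *)

Section existence.
Context (R : realType) (f F : R -> R) (b bt : R) (n : nat).
Context (H : nonlin0 f F b bt) (n2 : (2 <= n)%N).
Implicit Types (w P : R -> R) (r s t x : R).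

(** A ground state of the truncated problem starts at most at [A] and decreases, so the truncation
    is never active along it. *)
Lemma ground_state_exists (A : R) : bt < A ->
  (forall w P, radial_sol (fun s => f (Num.min s A)) n w P -> w 0 = A ->
    exists2 r, 0 <= r & w r < 0) ->
  exists w P, ground_state f n w P /\ forall r, 0 < r -> 0 < P r.
Proof.
move=> btA cross; have [G HG] := trunc_nonlin0 H btA.
have [B hB] := trunc_bounded H btA; have [L _ hL] := trunc_lip A H.
have [w [P [gs w0 Ppos]]] := shooting HG n2 hB hL btA cross.
exists w, P; split => //; have [cw cP P0 dw dP] := gs_sol gs.
split; [split => //|exact: gs_pos gs|exact: gs_lim gs].
move=> r r0; have wA : w r <= A.
  apply: le_trans w0; apply: ltW.
  by apply: (w_decr (gs_sol gs) (lexx 0) r0) => t t0 _; exact: Ppos.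
by have := dP r r0; rewrite min_l.
Qed.

Context (w P : R -> R) (ka e : R).
Context (gs : ground_state f n w P) (Ppos : forall r, 0 < r -> 0 < P r).
Context (ka0 : 0 < ka) (e0 : 0 < e) (fle : forall s, 0 < s -> s < e -> f s <= - ka * s).

(** With [lam ^ 2 = ka], [P ^ 2 - ka w ^ 2] is nonincreasing for large [r]; once negative it would
    stay below a negative constant, although [w] tends to 0. Hence [P >= lam w], and
    [w * expR (lam * r)] is nonincreasing. As [P] decreases for large [r], it is at most the drop of
    [w] over [[r - 1, r]]. *)
Lemma ground_state_decay : exists C lam, [/\ 0 < C, 0 < lam &
  forall r, 0 <= r -> w r <= C * expR (- (lam * r)) /\ P r <= C * expR (- (lam * r))].
Proof.
have [cw cP P0 dw dP] := gs_sol gs; have wpos := gs_pos gs.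
have [r1 hr1] := gs_lim gs e0; pose r0 := Num.max 1 r1.
have r01 : 1 <= r0 by rewrite /r0 le_max lexx.
have we r : r0 <= r -> w r < e.
  by rewrite ge_max => /andP[_]; exact: hr1.
pose lam := Num.sqrt ka; have lam0 : 0 < lam by rewrite sqrtr_gt0.
have lam2 : lam ^+ 2 = ka by rewrite sqr_sqrtr// ltW.
have dPle r : r0 <= r -> f (w r) - n%:R * P r / r <= - ka * w r.
  move=> rr; have rp : 0 < r by lra.
  have := fle (wpos r (ltW rp)) (we r rr).
  have : 0 <= n%:R * P r / r.
    by have Pr := Ppos rp; pos.
  by lra.
have Pge r : r0 <= r -> lam * w r <= P r.
  move=> rr; have rp : 0 < r by lra.
  have wr := wpos r (ltW rp); have Pr := Ppos rp.
  rewrite -(@ler_pXn2r _ 2) ?nnegrE//; [|by pos|exact: ltW].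
  rewrite exprMn lam2 leNgt; apply/negP => h.
  pose d := ka * w r ^+ 2 - P r ^+ 2; have d0 : 0 < d by rewrite /d; lra.
  have mono s : r <= s -> P s ^+ 2 - ka * w s ^+ 2 <= - d.
    move=> rs; have -> : - d = P r ^+ 2 - ka * w r ^+ 2 by rewrite /d; ring.
    apply: (@nincr _ (fun t => P t ^+ 2 - ka * w t ^+ 2) (fun t =>
      2 * P t * (f (w t) - n%:R * P t / t) + 2 * ka * w t * P t) r s rs) => t.
    - by move=> _; catt.
    - move=> /andP[rt _]; have t0 : 0 < t by lra.
      by have d1 := dw t t0; have d2 := dP t t0; der => /=; ring.
    - move=> /andP[rt _]; have t0 : 0 < t by lra.
      have rt0 : r0 <= t by lra.
      have := dPle t rt0; have Pt := Ppos t0 => /(ler_wpM2l (ltW Pt)) h'.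
      by lra.
  have e1 : 0 < Num.sqrt (d / ka) by rewrite sqrtr_gt0 divr_gt0.
  have [r2 hr2] := gs_lim gs e1; pose s := Num.max r r2.
  have rs : r <= s by rewrite /s le_max lexx.
  have ws : w s < Num.sqrt (d / ka) by apply: hr2; rewrite /s le_max lexx orbT.
  have s0 : 0 < s by lra.
  have : w s ^+ 2 < d / ka.
    rewrite -[ltRHS](@sqr_sqrtr _ (d / ka)); last by apply/ltW/divr_gt0.
    by rewrite ltr_pXn2r ?nnegrE ?sqrtr_ge0// ltW// wpos// ltW.
  rewrite ltr_pdivlMr// => h1; have := mono s rs.
  have := sqr_ge0 (P s); lra.
have wexp r : r0 <= r -> w r <= w r0 * expR (lam * r0) * expR (- (lam * r)).
  move=> rr; rewrite expRN ler_pdivlMr ?expR_gt0//.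
  apply: (@nincr _ (fun t => w t * expR (lam * t)) (fun t =>
    (lam * w t - P t) * expR (lam * t)) r0 r rr) => t.
  - by move=> _; catt.
  - move=> /andP[rt _]; have t0 : 0 < t by lra.
    by have d1 := dw t t0; der; ring.
  - move=> /andP[rt _]; apply: mulr_le0_ge0; last exact: expR_ge0.
    by rewrite subr_le0; apply: Pge; exact: ltW.
have wle r : 0 <= r -> w r <= w 0.
  rewrite le_eqVlt => /predU1P[<-//|rp]; apply: ltW.
  by apply: (w_decr (gs_sol gs) (lexx 0) rp) => t t0 _; exact: Ppos.
have w00 := wpos 0 (lexx 0).
have Pexp r : r0 + 1 <= r -> P r <= w r0 * expR (lam * (r0 + 1)) * expR (- (lam * r)).
  move=> rr; have r1r : r - 1 < r by lra.
  have rm0 : 0 < r - 1 by lra.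
  have [c /andP[c1 c2] ec] := @mvt _ w (fun s => - P s) (r - 1) r r1r
    (fun x _ => cw x) (fun x hx => dw x (lt_trans rm0 (proj1 (andP hx)))).
  have Prc : P r <= P c.
    apply: (@nincr _ P (fun s => f (w s) - n%:R * P s / s) c r (ltW c2)).
    - by move=> x _; exact: cP.
    - by move=> x /andP[x1 _]; apply: dP; lra.
    - move=> x /andP[x1 _]; have rx : r0 <= x by lra.
      have x0 : 0 <= x by lra.
      have := dPle x rx; have := mulr_gt0 ka0 (wpos x x0); lra.
  have rm : r0 <= r - 1 by lra.
  have rp : 0 <= r by lra.
  have wr := wpos r rp; have := wexp (r - 1) rm.
  have -> : - (lam * (r - 1)) = lam + - (lam * r) by ring.
  have -> : lam * (r0 + 1) = lam * r0 + lam by ring.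
  rewrite !expRD; move: ec; lra.
have r10 : 0 <= r0 + 1 by lra.
have [x _ hx] := evt_max r10 (fun x _ => cP x).
have Px0 : 0 <= P x.
  by rewrite -P0; apply: hx; rewrite lexx.
pose C := (w 0 + P x) * expR (lam * (r0 + 1)).
have ex := expR_gt0 (lam * (r0 + 1)).
exists C, lam; split => //; first by apply: mulr_gt0 => //; lra.
move=> r rp; have [rr|rr] := leP r (r0 + 1).
  have E1 : 1 <= expR (lam * (r0 + 1)) * expR (- (lam * r)).
    rewrite -expRD -[leLHS]expR0 ler_expR -mulrBr.
    by apply: mulr_ge0; [exact: ltW|lra].
  rewrite /C -mulrA; split.
    apply: (@le_trans _ _ ((w 0 + P x) * 1)); first by have := wle r rp; lra.
    by apply: ler_wpM2l => //; lra.
  apply: (@le_trans _ _ ((w 0 + P x) * 1)).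
    have : P r <= P x by apply: hx; rewrite rp.
    by lra.
  by apply: ler_wpM2l => //; lra.
have er := expR_gt0 (- (lam * r)).
have rr0 : r0 <= r by lra.
have r00 : 0 <= r0 by lra.
have h0 := wle r0 r00.
have key : w r0 * expR (lam * (r0 + 1)) * expR (- (lam * r)) <= C * expR (- (lam * r)).
  by apply: ler_wpM2r; [exact: ltW|apply: ler_wpM2r; [exact: ltW|lra]].
split; apply: le_trans key; last by apply: Pexp; exact: ltW.
apply: le_trans (wexp r rr0) _; apply: ler_wpM2r; first exact: ltW.
apply: ler_wpM2l; first by apply/ltW/wpos.
by rewrite ler_expR ler_pM2l//; lra.
Qed.

End existence.

(** * The change of variable *)

(** The power of the positive part, continuous on the whole line for positive exponents, so that the
    transformed nonlinearity is 0 at negative arguments. *)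
Definition ppow (R : realType) (c s : R) : R := Num.max s 0 `^ c.

Section positive_powers.
Context (R : realType).
Implicit Types (s c d u : R).

Lemma ppow_gt0 c s : 0 < s -> ppow c s = s `^ c.
Proof. by move=> s0; rewrite /ppow max_l// ltW. Qed.

Lemma ppow_le0 c s : c != 0 -> s <= 0 -> ppow c s = 0.
Proof. by move=> c0 s0; rewrite /ppow max_r// powR0. Qed.

Lemma cat_ppow d s : 0 < d -> cat (ppow d) s.
Proof.
move=> d0; have dn0 : d != 0 by rewrite gt_eqF.
have [s0|s0|->] := ltgtP s 0.
- apply: (cat_near (f := fun=> 0)); last exact: cat_cst.
  by near=> y; rewrite ppow_le0// ltW//; near: y; exact: near_lt.
- apply: (cat_near (f := fun y => y `^ d)).
    by near=> y; rewrite ppow_gt0//; near: y; exact: near_gt.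
  exact: dv_cat (dv_powR d s0 (dv_id s)).
- constructor; apply/cvgrPdist_lt => e e0.
  have e1 : 0 < e `^ d^-1 by exact: powR_gt0.
  near=> y; rewrite (ppow_le0 dn0 (lexx 0)) sub0r normrN ger0_norm ?powR_ge0//.
  have [y0|y0] := leP y 0; first by rewrite ppow_le0.
  rewrite ppow_gt0// -[ltRHS](powRr1 (ltW e0)) -[X in e `^ X](mulVf dn0) powRrM.
  apply: gt0_ltr_powR => //; rewrite ?nnegrE ?powR_ge0 ?(ltW y0)//.
  by near: y; exact: near_lt.
Unshelve. all: by end_near. Qed.

Lemma dv_ppow c s : 1 < c -> dv (ppow c) s (c * ppow (c - 1) s).
Proof.
move=> c1; have cn0 : c != 0 by rewrite gt_eqF//; lra.
have c1n0 : c - 1 != 0 by rewrite gt_eqF//; lra.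
have [s0|s0|->] := ltgtP s 0.
- rewrite ppow_le0 ?mulr0 ?ltW//.
  apply: (dv_on (f := fun=> 0) (P := fun y => y < 0)); [exact: near_lt|].
  by move=> y y0; rewrite ppow_le0// ltW.
- rewrite ppow_gt0//.
  apply: (dv_on (f := fun y => y `^ c) (P := fun y => 0 < y)); first exact: near_gt.
    by move=> y y0; rewrite ppow_gt0.
  by apply: (dv_eq (dv_powR c s0 (dv_id s))); rewrite mulr1.
- rewrite ppow_le0// mulr0; apply/is_derive1_caratheodory.
  exists (ppow (c - 1)); split.
  + move=> z; rewrite (ppow_le0 cn0 (lexx 0)) !subr0.
    have [z0|z0] := leP z 0; first by rewrite !ppow_le0// mul0r.
    by rewrite !ppow_gt0// mulrC mulr_powRB1//; [exact: ltW|lra].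
  + by apply: catE; apply: cat_ppow; lra.
  + exact: ppow_le0.
Qed.

(** The threshold is at least 1, so that powers of [s] are monotone in the exponent beyond it. *)
Definition ev (P : R -> Prop) := exists2 S : R, 1 <= S & forall s, S <= s -> P s.

Lemma evI (P Q : R -> Prop) : ev P -> ev Q -> ev (fun s => P s /\ Q s).
Proof.
move=> [S S1 hS] [T T1 hT]; exists (Num.max S T); first by rewrite le_max S1.
by move=> s; rewrite ge_max => /andP[? ?]; split; [exact: hS|exact: hT].
Qed.

Lemma evS (P Q : R -> Prop) : (forall s, 1 <= s -> P s -> Q s) -> ev P -> ev Q.
Proof.
move=> PQ [S S1 hS]; exists S => // s Ss.
by apply: PQ; [exact: le_trans Ss|exact: hS].
Qed.

Lemma ev_ge c : ev (fun s => c <= s).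
Proof.
exists (Num.max c 1); first by rewrite le_max lexx orbT.
by move=> s; rewrite ge_max => /andP[].
Qed.

Lemma ev_powR_ge d c : 0 < d -> ev (fun s => c <= s `^ d).
Proof.
move=> d0; apply: evS (ev_ge (Num.max c 0 `^ d^-1)) => s s1 h.
have m0 : 0 <= Num.max c 0 by rewrite le_max lexx orbT.
apply: (@le_trans _ _ (Num.max c 0)); first by rewrite le_max lexx.
have -> : Num.max c 0 = (Num.max c 0 `^ d^-1) `^ d.
  by rewrite -powRrM mulVf ?gt_eqF// powRr1.
by apply: ge0_ler_powR; rewrite ?nnegrE ?powR_ge0 ?(ltW d0)//; lra.
Qed.

End positive_powers.

(** * The nonlinearity of the transformed equation *)

Section dual.
Context (R : realType) (a1 k p c0 : R) (psi psi' psi'' : R -> R).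
Context (a10 : 0 < a1) (k2 : 2 < k) (kp : k < 2 * p) (p1 : 1 < p) (c00 : 0 < c0).
Context (dpsi : forall s : R, dv psi s (psi' s)).
Context (dpsi' : forall s : R, dv psi' s (psi'' s)).
Context (psi_ge : forall s : R, 0 <= s -> c0 <= psi s).
Context (psi_k : forall s : R, 0 <= s -> 0 <= k * psi s - s * psi' s).
Context (psi0y : forall e : R, 0 < e -> ev (fun s => `|psi s| <= e * s `^ ((k - 2) / 2))).
Context (psi1y : forall e : R, 0 < e -> ev (fun s => `|s * psi' s| <= e * s `^ ((k - 2) / 2))).
Context (psi2y : forall e : R, 0 < e -> ev (fun s => `|s ^+ 2 * psi'' s| <= e * s `^ ((k - 2) / 2))).
Implicit Types (s t u x y z w m e : R).

(** Agrees with [a] for [s > 0]. For negative [s], where no bound on [psi] is given, it is frozen at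
    [psi 0]: it then stays above [c0], and the change of variable is a bijection of the line. *)
Definition aext s := a1 * ppow k s + psi (Num.max s 0).
Definition gext s := Num.sqrt (aext s).

Lemma aext_ge s : c0 <= aext s.
Proof.
rewrite /aext; have : 0 <= a1 * ppow k s by apply: mulr_ge0; [exact: ltW|exact: powR_ge0].
have : c0 <= psi (Num.max s 0) by apply: psi_ge; rewrite le_max lexx orbT.
by lra.
Qed.

Lemma aext_gt0 s : 0 < aext s. Proof. exact: lt_le_trans (aext_ge s). Qed.

Lemma gext_gt0 s : 0 < gext s. Proof. by rewrite sqrtr_gt0 aext_gt0. Qed.

Lemma gext2 s : gext s ^+ 2 = aext s.
Proof. by rewrite sqr_sqrtr// ltW// aext_gt0. Qed.

Lemma cat_max0 s : cat (fun s => Num.max s 0) s.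
Proof. by apply: cat_max; [exact: cat_id|exact: cat_cst]. Qed.

Lemma cat_aext s : cat aext s.
Proof.
rewrite /aext; apply: catD.
  by apply: catM; [exact: cat_cst|apply: cat_ppow; have := k2; lra].
by apply: cat_comp; [exact: dv_cat (dpsi _)|exact: cat_max0].
Qed.

Lemma cat_gext s : cat gext s.
Proof. by apply: cat_sqrt; exact: cat_aext. Qed.

(** The defect in the logarithmic derivative: [s g' / g = k / 2 - kapp s] for [g = gext]. It
    measures how far [a] is from a pure power, and its sign is the assumption on
    [k psi - s psi']. *)
Definition kapp s := (k * psi s - s * psi' s) / (2 * aext s).

Lemma dv_aext s : 0 < s -> dv aext s (aext s * (k - 2 * kapp s) / s).
Proof.
move=> s0; apply: (dv_on (f := fun y => a1 * ppow k y + psi y) (P := fun y => 0 < y)).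
- exact: near_gt.
- by move=> y y0; rewrite /aext (max_l (ltW y0)).
have d1 := dpsi s; have k1 : 1 < k by have := k2; lra.
have d2 := dv_ppow s k1; have := aext_gt0 s.
rewrite /kapp /aext (max_l (ltW s0)) => h.
have e : ppow k s = s * ppow (k - 1) s.
  by rewrite !ppow_gt0// mulr_powRB1//; [exact: ltW|have := k2; lra].
rewrite e in h *; der; field.
by rewrite !gt_eqF.
Qed.

Lemma dv_gext s : 0 < s -> dv gext s (gext s * (k / 2 - kapp s) / s).
Proof.
move=> s0; apply: (dv_eq (dv_sqrt (aext_gt0 s) (dv_aext s0))).
rewrite -/(gext s) -gext2.
by field; rewrite !gt_eqF// gext_gt0.
Qed.

Lemma kapp_ge0 s : 0 <= s -> 0 <= kapp s.
Proof.
move=> s0; apply: divr_ge0; first exact: psi_k.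
by apply: mulr_ge0 => //; apply: ltW; exact: aext_gt0.
Qed.

Definition kapp' s := ((k - 1) * psi' s - s * psi'' s) / (2 * aext s) -
  kapp s * (k - 2 * kapp s) / s.

Lemma dv_kapp s : 0 < s -> dv kapp s (kapp' s).
Proof.
move=> s0; have d1 := dpsi s; have d2 := dpsi' s; have d3 := dv_aext s0.
have h := aext_gt0 s; have h2 : 2 * aext s != 0 by rewrite gt_eqF// mulr_gt0.
have d4 := dvM (dv_cst 2 s) d3.
have d5 := dvB (dvM (dv_cst k s) d1) (dvM (dv_id s) d2).
apply: (dv_eq (dv_div (f := fun y => k * psi y - y * psi' y) (g := fun y => 2 * aext y) h2 d5 d4)).
rewrite /kapp' {2}/kapp.
by field; rewrite !gt_eqF.
Qed.

(** [X] is the growth of [Rr], and [psi], [s psi'], [s ^ 2 psi''] are small compared with [Y]; the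
    product [s ^ k] is the growth of [a]. Hence [kapp] and [s kapp'] are small compared with
    [1 / X]. *)
Let X s := s `^ ((k + 2) / 2).
Let Y s := s `^ ((k - 2) / 2).

Let XYE s : 0 < s -> s `^ k = Y s * X s.
Proof.
move=> s0; rewrite /X /Y -powRD; last by rewrite (gt_eqF s0) implybT.
by congr (_ `^ _); field.
Qed.

Let Xp s : 0 < s -> 0 < X s. Proof. exact: powR_gt0. Qed.
Let Yp s : 0 < s -> 0 < Y s. Proof. exact: powR_gt0. Qed.

Let aext_geXY s : 0 < s -> a1 * (Y s * X s) <= aext s.
Proof.
move=> s0; rewrite /aext ppow_gt0// XYE// lerDl.
by apply: le_trans (ltW c00) _; apply: psi_ge; rewrite le_max lexx orbT.
Qed.

Lemma kapp_small e : 0 < e -> ev (fun s => kapp s * X s <= e).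
Proof.
move=> e0; pose e' := e * a1 / (k + 1).
have kk : 0 < k + 1 by have := k2; lra.
have e'0 : 0 < e' by apply: divr_gt0 => //; exact: mulr_gt0.
apply: evS (evI (psi0y e'0) (psi1y e'0)) => s s1 [h0 h1].
have s0 : 0 < s by lra.
rewrite -/(Y s) in h0 h1.
have XY := aext_geXY s0; have Xs := Xp s0; have Ys := Yp s0; have as0 := aext_gt0 s.
rewrite /kapp mulrAC ler_pdivrMr; last by apply: mulr_gt0.
have : k * psi s - s * psi' s <= (k + 1) * (e' * Y s).
  have : k * psi s <= k * (e' * Y s).
    by apply: ler_wpM2l; [have := k2; lra|apply: le_trans h0; exact: ler_norm].
  by move: h1; rewrite ler_norml; lra.
move=> /(ler_wpM2r (ltW Xs)) h; apply: le_trans h _.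
have -> : (k + 1) * (e' * Y s) * X s = e * (a1 * (Y s * X s)).
  by rewrite /e'; field; rewrite gt_eqF.
by apply: ler_wpM2l; [exact: ltW|lra].
Qed.

Lemma kapp'_small e : 0 < e -> ev (fun s => `|s * kapp' s| * X s <= e).
Proof.
move=> e0; pose e' := e * a1 / k.
have kk : 0 < k by have := k2; lra.
have e'0 : 0 < e' by apply: divr_gt0 => //; exact: mulr_gt0.
pose e2 := Num.min 1 (e / (2 * (k + 2))).
have e20 : 0 < e2 by rewrite /e2 lt_min ltr01/=; apply: divr_gt0 => //; apply: mulr_gt0 => //; lra.
apply: evS (evI (evI (psi1y e'0) (psi2y e'0)) (kapp_small e20)) => s s1 [[h1 h2] h3].
have s0 : 0 < s by lra.
rewrite -/(Y s) in h1 h2.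
have XY := aext_geXY s0; have Xs := Xp s0; have Ys := Yp s0; have as0 := aext_gt0 s.
have kap0 := kapp_ge0 (ltW s0).
have X1 : 1 <= X s.
  rewrite -[X in X <= _](powRr0 s); apply: ler_powR => //.
  by apply: divr_ge0 => //; lra.
have kap1 : kapp s <= 1.
  apply: le_trans (_ : kapp s * X s <= _); first by rewrite ler_peMr.
  by apply: le_trans h3 _; rewrite /e2 ge_min lexx.
have h3' : kapp s * X s <= e / (2 * (k + 2)) by apply: le_trans h3 _; rewrite /e2 ge_min lexx orbT.
have -> : s * kapp' s = ((k - 1) * (s * psi' s) - s ^+ 2 * psi'' s) / (2 * aext s) -
    kapp s * (k - 2 * kapp s).
  by rewrite /kapp'; field; rewrite !gt_eqF.
apply: (@le_trans _ _ ((`|((k - 1) * (s * psi' s) - s ^+ 2 * psi'' s) / (2 * aext s)| +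
  `|kapp s * (k - 2 * kapp s)|) * X s)).
  by apply: ler_wpM2r; [exact: ltW|exact: ler_normB].
rewrite mulrDl; have t1 : `|kapp s * (k - 2 * kapp s)| * X s <= e / 2.
  rewrite normrM (ger0_norm kap0) mulrAC.
  apply: (@le_trans _ _ (kapp s * X s * (k + 2))).
    apply: ler_wpM2l; first by apply: mulr_ge0 => //; exact: ltW.
    by rewrite ler_norml; apply/andP; split; lra.
  have kk2 : 0 < k + 2 by lra.
  apply: le_trans (ler_wpM2r (ltW kk2) h3') _.
  by rewrite le_eqVlt; apply/orP; left; apply/eqP; field; rewrite gt_eqF.
have t2 : `|((k - 1) * (s * psi' s) - s ^+ 2 * psi'' s) / (2 * aext s)| * X s <= e / 2.
  have a20 : 0 < 2 * aext s by exact: mulr_gt0.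
  rewrite normrM normfV (gtr0_norm a20) mulrAC ler_pdivrMr//.
  have : `|(k - 1) * (s * psi' s) - s ^+ 2 * psi'' s| <= k * (e' * Y s).
    apply: le_trans (ler_normB _ _) _.
    rewrite normrM (@ger0_norm _ (k - 1)); last by have := k2; lra.
    have : (k - 1) * `|s * psi' s| <= (k - 1) * (e' * Y s) by apply: ler_wpM2l => //; have := k2; lra.
    by lra.
  move=> /(ler_wpM2r (ltW Xs)) h; apply: le_trans h _.
  have -> : k * (e' * Y s) * X s = e * (a1 * (Y s * X s)).
    by rewrite /e'; field; rewrite gt_eqF.
  have : e * (a1 * (Y s * X s)) <= e * aext s by apply: ler_wpM2l => //; exact: ltW.
  by lra.
by lra.
Qed.

Lemma gext_le : ev (fun s => gext s <= Num.sqrt (a1 + 1) * s `^ (k / 2)).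
Proof.
apply: evS (psi0y ltr01) => s s1; rewrite mul1r => h.
have s0 : 0 < s by lra.
have ps : psi s <= s `^ k.
  apply: le_trans (ler_norm _) _; apply: le_trans h _; apply: ler_powR => //.
  by have := k2; lra.
have -> : s `^ (k / 2) = Num.sqrt (s `^ k).
  by rewrite -powR12_sqrt ?powR_ge0// -powRrM.
rewrite -sqrtrM; last by have := a10; lra.
rewrite /gext ler_wsqrtr// /aext ppow_gt0// (max_l (ltW s0)) mulrDl mul1r.
by rewrite lerD2l.
Qed.

Lemma gext_ge s : 0 < s -> Num.sqrt a1 * s `^ (k / 2) <= gext s.
Proof.
move=> s0; have -> : s `^ (k / 2) = Num.sqrt (s `^ k).
  by rewrite -powR12_sqrt ?powR_ge0// -powRrM.
rewrite -sqrtrM; last exact: ltW.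
rewrite /gext ler_wsqrtr// /aext ppow_gt0// lerDl.
by apply: le_trans (ltW c00) _; apply: psi_ge; rewrite le_max lexx orbT.
Qed.

(* [Rr] is the change of variable [w = Rr(u)], with inverse [rho]. *)
Context (Rr rho : R -> R) (dRr : forall s : R, dv Rr s (gext s)) (Rr0 : Rr 0 = 0).
Context (rhoK : forall w : R, Rr (rho w) = w).

Lemma Rr_incr s t : s < t -> Rr s < Rr t.
Proof.
move=> st; apply: (@incr _ Rr gext s t st) => x _; [exact: dv_cat (dRr x)|].
exact: gext_gt0.
Qed.

Lemma Rr_le s t : (Rr s <= Rr t) = (s <= t).
Proof.
have [st|ts] := leP s t.
  by move: st; rewrite le_eqVlt => /predU1P[->|/Rr_incr/ltW]; rewrite ?lexx.
by apply/negbTE; rewrite -ltNge Rr_incr.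
Qed.

Lemma Rr_lt s t : (Rr s < Rr t) = (s < t). Proof. by rewrite !ltNge Rr_le. Qed.

Lemma RrK s : rho (Rr s) = s.
Proof. by apply/eqP; rewrite eq_le -[_ <= s]Rr_le -[s <= _]Rr_le rhoK lexx. Qed.

Lemma rho0 : rho 0 = 0. Proof. by rewrite -{1}Rr0 RrK. Qed.

Lemma rho_lt s t : (rho s < rho t) = (s < t). Proof. by rewrite -Rr_lt !rhoK. Qed.
Lemma rho_le s t : (rho s <= rho t) = (s <= t). Proof. by rewrite -Rr_le !rhoK. Qed.

Lemma rho_gt0 w : (0 < rho w) = (0 < w). Proof. by rewrite -{1}rho0 rho_lt. Qed.
Lemma rho_le0 w : (rho w <= 0) = (w <= 0). Proof. by rewrite -{1}rho0 rho_le. Qed.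

Lemma dv_rho w : dv rho w (gext (rho w))^-1.
Proof.
rewrite -{1}(rhoK w); apply: dv_inverse.
- by near=> y; exact: RrK.
- by near=> y; exact: dv_cat (dRr y).
- by rewrite gt_eqF// gext_gt0.
Unshelve. all: by end_near. Qed.

Lemma cat_rho w : cat rho w. Proof. exact: dv_cat (dv_rho w). Qed.

Lemma Rr_gt0 s : 0 < s -> 0 < Rr s. Proof. by move=> s0; rewrite -Rr0 Rr_lt. Qed.

Definition Jdef s := (1 + k / 2) * Rr s - s * gext s.

Lemma dv_Jdef s : 0 < s -> dv Jdef s (kapp s * gext s).
Proof.
move=> s0; have d1 := dRr s; have d2 := dv_gext s0.
by rewrite /Jdef; der; field; rewrite gt_eqF.
Qed.

Lemma cat_Jdef s : cat Jdef s.
Proof.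
have c1 := dv_cat (dRr s); have c2 := cat_gext s; rewrite /Jdef; catt.
Qed.

Lemma Jdef0 : Jdef 0 = 0. Proof. by rewrite /Jdef Rr0 mulr0 mul0r subrr. Qed.

Lemma Jdef_ndecr s t : 0 <= s -> s <= t -> Jdef s <= Jdef t.
Proof.
move=> s0 st; apply: (@ndecr _ Jdef (fun x => kapp x * gext x) s t st) => x.
- by move=> _; exact: cat_Jdef.
- by move=> /andP[sx _]; apply: dv_Jdef; exact: le_lt_trans sx.
- move=> /andP[sx _]; apply: mulr_ge0; last exact/ltW/gext_gt0.
  by apply: kapp_ge0; apply: ltW; exact: le_lt_trans sx.
Qed.

(** [k psi 0 > 0] makes [kapp] positive near 0, so [Jdef] leaves 0 at once. The value [Jdef 1] is
    the margin that later absorbs the terms in [kapp] and [kapp']. *)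
Lemma Jdef1 : 0 < Jdef 1.
Proof.
have c : cat (fun s => k * psi s - s * psi' s) 0.
  by have c1 := dv_cat (dpsi 0); have c2 := dv_cat (dpsi' 0); catt.
have h0 : 0 < k * psi 0 - 0 * psi' 0.
  rewrite mul0r subr0; apply: mulr_gt0; first by have := k2; lra.
  exact: lt_le_trans c00 (psi_ge (lexx 0)).
have [e e0 he] := near_ball (cat_gt c h0).
pose s := Num.min (e / 2) 1.
have s1 : s <= 1 by rewrite /s ge_min lexx orbT.
have se : s <= e / 2 by rewrite /s ge_min lexx.
have s0 : 0 < s by rewrite /s lt_min ltr01 andbT; lra.
apply: lt_le_trans (Jdef_ndecr (ltW s0) s1); rewrite -Jdef0.
apply: (@incr _ Jdef (fun x => kapp x * gext x) 0 s s0) => x.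
- by move=> _; exact: cat_Jdef.
- by move=> /andP[sx _]; apply: dv_Jdef.
- move=> /andP[x0 xs]; apply: mulr_gt0; last exact: gext_gt0.
  apply: divr_gt0; first by apply: he; apply/andP; split; lra.
  by apply: mulr_gt0 => //; exact: aext_gt0.
Qed.

(** This is [Jdef s >= 0] combined with [gext_ge]. *)
Lemma Rr_ge s : 0 < s -> 2 * Num.sqrt a1 / (k + 2) * X s <= Rr s.
Proof.
move=> s0; have kk : 0 < k + 2 by have := k2; lra.
have : 0 <= Jdef s by rewrite -Jdef0; apply: Jdef_ndecr => //; exact: ltW.
have : s * (Num.sqrt a1 * s `^ (k / 2)) <= s * gext s.
  by apply: ler_wpM2l; [exact: ltW|exact: gext_ge].
have -> : s * (Num.sqrt a1 * s `^ (k / 2)) = Num.sqrt a1 * X s.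
  rewrite mulrCA /X; congr (_ * _).
  rewrite -[X in X * _](powRr1 (ltW s0)) -powRD; last by rewrite (gt_eqF s0) implybT.
  by congr (_ `^ _); field.
rewrite /Jdef => h1 h2.
rewrite mulrAC ler_pdivrMr//; lra.
Qed.

Lemma Rr_le_X : exists2 cu, 0 < cu & ev (fun s => Rr s <= cu * X s).
Proof.
have [S S1 hS] := gext_le; pose cu := `|Rr S| + Num.sqrt (a1 + 1) + 1.
have q0 := sqrtr_ge0 (a1 + 1); have n0 := normr_ge0 (Rr S).
exists cu; first by rewrite /cu; lra.
exists S => // s Ss; have s0 : 0 < s by lra.
have X1 : 1 <= X s.
  rewrite -[X in X <= _](powRr0 s); apply: ler_powR; first by lra.
  by apply: divr_ge0 => //; have := k2; lra.
have sX : s * s `^ (k / 2) = X s.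
  rewrite -[X in X * _](powRr1 (ltW s0)) -powRD; last by rewrite (gt_eqF s0) implybT.
  by rewrite /X; congr (_ `^ _); field.
have h : Rr s <= Rr S + Num.sqrt (a1 + 1) * X s.
  move: Ss; rewrite le_eqVlt => /predU1P[<-|Ss].
    by rewrite lerDl; apply: mulr_ge0 => //; apply/ltW/Xp; lra.
  have [x /andP[x1 x2] e] := mvt Ss (fun x _ => dv_cat (dRr x)) (fun x _ => dRr x).
  have x0 : 0 < x by lra.
  have : gext x * (s - S) <= Num.sqrt (a1 + 1) * s `^ (k / 2) * s.
    apply: ler_pM; [exact/ltW/gext_gt0|by lra| |by lra].
    apply: le_trans (hS x (ltW x1)) _; apply: ler_wpM2l => //.
    by apply: ge0_ler_powR; rewrite ?nnegrE; have := k2; lra.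
  rewrite -mulrA [s `^ _ * s]mulrC sX -e; lra.
apply: le_trans h _; rewrite /cu.
have : Rr S <= `|Rr S| * X s.
  by apply: le_trans (ler_norm _) _; rewrite ler_peMr.
by lra.
Qed.

Let T u := ppow (p - 1) u.

Definition hdual m u := ppow p u - m * ppow 1 u.
Definition phid m u := hdual m u / gext u.
Definition phid' m u := (p * ppow (p - 1) u - m -
  (ppow (p - 1) u - m) * (k / 2 - kapp u)) / gext u.
Definition fdual m w := phid m (rho w).
Definition fdual' m w := phid' m (rho w) / gext (rho w).
(** The primitive is explicit in [u]: since [dw = g du] and [f = h / g], integrating [f] in [w] is
    integrating [h = hdual m] in [u]. *)
Definition Gdual m u := ppow (p + 1) u / (p + 1) - m * ppow 2 u / 2.
Definition Fdual m w := Gdual m (rho w).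
(** [um m] and [ubt m] are the positive zeros of [hdual m] and of [Gdual m]. *)
Definition um m := m `^ (p - 1)^-1.
Definition ubt m := ((p + 1) / 2 * m) `^ (p - 1)^-1.

Let pm1 : 0 < p - 1. Proof. by rewrite subr_gt0. Qed.

Lemma hdualE m u : 0 < u -> hdual m u = u * (T u - m).
Proof.
move=> u0; rewrite /hdual /T !ppow_gt0// powRr1; last exact: ltW.
by rewrite -(mulr_powRB1 (ltW u0)); [ring|have := p1; lra].
Qed.

Lemma hdual_le0 m u : u <= 0 -> hdual m u = 0.
Proof. by move=> u0; rewrite /hdual !ppow_le0 ?mulr0 ?subrr// gt_eqF//; have := p1; lra. Qed.

Lemma GdualE m u : 0 < u -> Gdual m u = u ^+ 2 * (T u / (p + 1) - m / 2).
Proof.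
move=> u0; rewrite /Gdual /T !ppow_gt0//.
have -> : u `^ (p + 1) = u ^+ 2 * u `^ (p - 1).
  rewrite -powR_mulrn; last exact: ltW.
  rewrite -powRD; last by rewrite (gt_eqF u0) implybT.
  by congr (_ `^ _); ring.
by rewrite (powR_mulrn 2 (ltW u0)); ring.
Qed.

Lemma T_lt u x : 0 < u -> 0 < x -> (T u < x) = (u < x `^ (p - 1)^-1).
Proof.
move=> u0 x0; rewrite /T ppow_gt0//.
have e : x = (x `^ (p - 1)^-1) `^ (p - 1).
  by rewrite -powRrM mulVf ?gt_eqF// powRr1// ltW.
have y0 : 0 < x `^ (p - 1)^-1 by exact: powR_gt0.
apply/idP/idP; last first.
  by rewrite {2}e => h; apply: gt0_ltr_powR => //; rewrite nnegrE ltW.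
apply: contraTT; rewrite -!leNgt => h; rewrite {1}e.
by apply: ge0_ler_powR => //; rewrite ?nnegrE ltW.
Qed.

Lemma T_gt u x : 0 < u -> 0 < x -> (x < T u) = (x `^ (p - 1)^-1 < u).
Proof.
move=> u0 x0; rewrite /T ppow_gt0//.
have e : x = (x `^ (p - 1)^-1) `^ (p - 1).
  by rewrite -powRrM mulVf ?gt_eqF// powRr1// ltW.
have y0 : 0 < x `^ (p - 1)^-1 by exact: powR_gt0.
apply/idP/idP; last first.
  by rewrite {2}e => h; apply: gt0_ltr_powR => //; rewrite nnegrE ltW.
apply: contraTT; rewrite -!leNgt => h; rewrite [leRHS]e.
by apply: ge0_ler_powR => //; rewrite ?nnegrE ltW.
Qed.

Lemma um_gt0 m : 0 < m -> 0 < um m. Proof. exact: powR_gt0. Qed.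

Lemma um_ubt m : 0 < m -> um m < ubt m.
Proof.
move=> m0; apply: gt0_ltr_powR; rewrite ?invr_gt0// ?nnegrE; first exact: ltW.
  by apply: mulr_ge0; [have := p1; lra|exact: ltW].
by rewrite ltr_pMl//; have := p1; lra.
Qed.

Lemma cat_hdual m u : cat (hdual m) u.
Proof.
have c1 : cat (ppow p) u by apply: cat_ppow; have := p1; lra.
have c2 : cat (@ppow R 1) u by apply: cat_ppow.
by rewrite /hdual; catt.
Qed.

Lemma cat_fdual m w : cat (fdual m) w.
Proof.
apply: (cat_comp (f := phid m)); last exact: cat_rho.
rewrite /phid; apply: catM; first exact: cat_hdual.
by apply: catV; [rewrite gt_eqF// gext_gt0|exact: cat_gext].
Qed.

Lemma dv_phid m u : 0 < u -> dv (phid m) u (phid' m u).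
Proof.
move=> u0; have d1 := dv_gext u0; have g0 := gext_gt0 u.
have pp1 : 1 < p := p1.
have d2 : dv (fun y => ppow p y - m * y) u (p * ppow (p - 1) u - m).
  by have d := dv_ppow u pp1; der; ring.
have gn : gext u != 0 by rewrite gt_eqF.
apply: (dv_on (f := fun y => (ppow p y - m * y) / gext y) (P := fun y => 0 < y)).
- exact: near_gt.
- by move=> y y0; rewrite /phid /hdual [ppow 1 y]ppow_gt0// powRr1// ltW.
apply: (dv_eq (dv_div (f := fun y => ppow p y - m * y) gn d2 d1)).
have -> : ppow p u = u * T u.
  by rewrite /T !ppow_gt0// (mulr_powRB1 (ltW u0))//; have := p1; lra.
by rewrite /phid' -/(T u); field; rewrite !gt_eqF.
Qed.

Lemma dv_fdual m w : 0 < w -> dv (fdual m) w (fdual' m w).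
Proof.
rewrite -rho_gt0 => u0.
exact: (dv_comp (f := phid m) (dv_phid m u0) (dv_rho w)).
Qed.

Lemma dv_Gdual m u : dv (Gdual m) u (hdual m u).
Proof.
have pp1 : 1 < p + 1 by have := p1; lra.
have d1 := dv_ppow u pp1; have d2 := dv_ppow u (ltr1n R 2).
rewrite /Gdual /hdual.
have e1 : p + 1 - 1 = p by ring.
have e2 : 2 - 1 = 1 :> R by ring.
rewrite e1 in d1; rewrite e2 in d2.
by der; field; rewrite gt_eqF//; lra.
Qed.

Lemma dv_Fdual m w : dv (Fdual m) w (fdual m w).
Proof. exact: (dv_comp (f := Gdual m) (dv_Gdual m _) (dv_rho w)). Qed.

(** For [u > 0] the derivative of [phid] is the restriction of a continuous function, hence bounded
    on [[0, A']]; for [u <= 0] the function is 0. The inverse [rho] is Lipschitz because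
    [g >= sqrt c0]. *)
Lemma fdual_lip m A : exists2 L : R, 0 <= L &
  forall s t, s <= A -> t <= A -> `|fdual m s - fdual m t| <= L * `|s - t|.
Proof.
pose A' := Num.max (rho A) 0 + 1.
have M0 : 0 <= Num.max (rho A) 0 by rewrite le_max lexx orbT.
have A'0 : 0 < A' by rewrite /A'; lra.
have cphi' u : cat (phid' m) u.
  rewrite /phid'; apply: catM; last first.
    by apply: catV; [rewrite gt_eqF// gext_gt0|exact: cat_gext].
  have c1 : cat (ppow (p - 1)) u by apply: cat_ppow.
  have c2 : cat kapp u.
    rewrite /kapp; apply: catM.
      by have c1' := dv_cat (dpsi u); have c2' := dv_cat (dpsi' u); catt.
    apply: catV; first by rewrite gt_eqF// mulr_gt0// aext_gt0.
    by have := cat_aext u => c; catt.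
  by catt.
have [c /= _ hc] := evt_max (ltW A'0) (fun x _ => cat_norm (cphi' x)).
have phi_lt u v : u < v -> v <= A' -> `|phid m u - phid m v| <= `|phid' m c| * `|u - v|.
  move=> uv vA.
  have phi0 x : x <= 0 -> phid m x = 0 by move=> x0; rewrite /phid hdual_le0// mul0r.
  have cphi x : cat (phid m) x.
    rewrite /phid; apply: catM; first exact: cat_hdual.
    by apply: catV; [rewrite gt_eqF// gext_gt0|exact: cat_gext].
  have main x : 0 <= x -> x < v -> `|phid m x - phid m v| <= `|phid' m c| * (v - x).
    move=> x0 xv; have [y /andP[y1 y2] e] := mvt xv (fun z _ => cphi z)
      (fun z hz => dv_phid m (le_lt_trans x0 (proj1 (andP hz)))).
    rewrite distrC e normrM (gtr0_norm (_ : 0 < v - x)); last by rewrite subr_gt0.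
    apply: ler_wpM2r; first by rewrite subr_ge0 ltW.
    by apply: hc; apply/andP; split; lra.
  have vu : `|u - v| = v - u by rewrite distrC gtr0_norm// subr_gt0.
  rewrite vu; have [v0|v0] := leP v 0.
    rewrite !phi0 ?subrr ?normr0//; last by lra.
    by apply: mulr_ge0 => //; lra.
  have [u0|u0] := leP u 0; last by apply: main => //; exact: ltW.
  rewrite (phi0 u u0) -(phi0 0 (lexx 0)); apply: le_trans (main 0 (lexx 0) v0) _.
  by apply: ler_wpM2l => //; lra.
have gi u : (gext u)^-1 <= (Num.sqrt c0)^-1.
  rewrite lef_pV2 ?posrE ?gext_gt0 ?sqrtr_gt0//.
  by rewrite /gext ler_wsqrtr// aext_ge.
have sc0 : 0 <= (Num.sqrt c0)^-1 by rewrite invr_ge0 sqrtr_ge0.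
have L0 : 0 <= `|phid' m c| * (Num.sqrt c0)^-1 by exact: mulr_ge0.
exists (`|phid' m c| * (Num.sqrt c0)^-1) => //.
have key s t : s < t -> t <= A ->
    `|fdual m s - fdual m t| <= `|phid' m c| * (Num.sqrt c0)^-1 * `|s - t|.
  move=> st tA.
  have rst : rho s < rho t by rewrite rho_lt.
  have rtA : rho t <= A'.
    have : rho t <= rho A by rewrite rho_le.
    have : rho A <= Num.max (rho A) 0 by rewrite le_max lexx.
    by rewrite /A'; lra.
  apply: le_trans (phi_lt _ _ rst rtA) _; rewrite -mulrA; apply: ler_wpM2l => //.
  have [y _ e] := mvt st (fun z _ => cat_rho z) (fun z _ => dv_rho z).
  rewrite distrC e normrM [`|s - t|]distrC; apply: ler_wpM2r => //.
  by rewrite gtr0_norm ?invr_gt0 ?gext_gt0.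
move=> s t sA tA; have [st|ts|->] := ltgtP s t; last by rewrite !subrr normr0 mulr0.
- exact: key.
- by rewrite distrC [`|s - t|]distrC; exact: key.
Qed.

Lemma dual_nonlin0 m : 0 < m ->
  nonlin0 (fdual m) (Fdual m) (Rr (um m)) (Rr (ubt m)).
Proof.
move=> m0; have mbt : 0 < (p + 1) / 2 * m by apply: mulr_gt0 => //; have := p1; lra.
split.
- exact: cat_fdual.
- by move=> s; rewrite -rho_le0 => u0; rewrite /fdual /phid hdual_le0// mul0r.
- by apply: Rr_gt0; exact: um_gt0.
- by rewrite Rr_lt um_ubt.
- rewrite /fdual RrK /phid hdualE ?um_gt0// /T ppow_gt0 ?um_gt0// /um.
  by rewrite -powRrM mulVf ?gt_eqF// powRr1 ?subrr ?mulr0 ?mul0r// ltW.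
- move=> s s0 sb; have u0 : 0 < rho s by rewrite rho_gt0.
  rewrite /fdual /phid pmulr_llt0 ?invr_gt0 ?gext_gt0// hdualE// pmulr_rlt0//.
  by rewrite subr_lt0 T_lt// -/(um m) -Rr_lt rhoK.
- move=> s sb; have s0 : 0 < s by apply: lt_trans sb; apply: Rr_gt0; exact: um_gt0.
  have u0 : 0 < rho s by rewrite rho_gt0.
  rewrite /fdual /phid; apply: divr_gt0; last exact: gext_gt0.
  rewrite hdualE//; apply: mulr_gt0 => //.
  by rewrite subr_gt0 T_gt// -/(um m) -Rr_lt rhoK.
- exact: dv_Fdual.
- move=> s; rewrite -rho_le0 => u0; rewrite /Fdual /Gdual !ppow_le0//.
    by rewrite mul0r mulr0 mul0r subrr.
  by rewrite gt_eqF//; have := p1; lra.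
- move=> s s0 sb; have u0 : 0 < rho s by rewrite rho_gt0.
  rewrite /Fdual GdualE// pmulr_rlt0 ?exprn_gt0// subr_lt0.
  have pp : 0 < p + 1 by have := p1; lra.
  rewrite ltr_pdivrMr// (_ : m / 2 * (p + 1) = (p + 1) / 2 * m); last by ring.
  by rewrite T_lt// -/(ubt m) -Rr_lt rhoK.
- exact: fdual_lip.
Qed.

(** The quotient [w f' / f] at [w = Rr u], for [u > um m]. *)
Let Ku m u := Rr u / (u * gext u) *
  (p - k / 2 + (p - 1) * m / (u `^ (p - 1) - m) + kapp u).

(** The derivative has the sign of [(- J + kapp R) B + R u kapp' - R u Z], where [B] is the second
    factor of [Ku]. Here [J >= Jdef 1] and [B >= del = p - k / 2], while beyond [U0] both
    [kapp R <= Jdef 1 / 2] and [R |u kapp'| <= Jdef 1 * del / 2]. The parameter [m] enters only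
    through [B] and [Z >= 0], both favourably, so [U0] does not depend on it. *)
Lemma dual_K_decr : exists U0, 1 <= U0 /\ forall m, 0 < m -> forall u v,
  U0 <= u -> um m < u -> u <= v -> Ku m v <= Ku m u.
Proof.
have [cu cu0 hcu] := Rr_le_X; have J0 := Jdef1.
pose del := p - k / 2.
have del0 : 0 < del by rewrite /del; have := kp; lra.
have e10 : 0 < Jdef 1 / (2 * cu) by apply: divr_gt0 => //; exact: mulr_gt0.
have e20 : 0 < Jdef 1 * del / (2 * cu).
  by apply: divr_gt0; exact: mulr_gt0.
have [U0 U01 hU] := evI (evI hcu (kapp_small e10)) (kapp'_small e20).
exists U0; split => // m m0 u v Uu mu uv.
apply: (@nincr _ (Ku m) (fun x =>
  (- Jdef x + kapp x * Rr x) / (x ^+ 2 * gext x) *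
    (p - k / 2 + (p - 1) * m / (x `^ (p - 1) - m) + kapp x) +
  Rr x / (x * gext x) * (- ((p - 1) ^+ 2 * m * x `^ (p - 1) / x /
    (x `^ (p - 1) - m) ^+ 2) + kapp' x)) u v uv) => x.
- move=> /andP[ux _]; have x0 : 0 < x by lra.
  have Tm : 0 < x `^ (p - 1) - m.
    by rewrite subr_gt0 -ppow_gt0// T_gt// (lt_le_trans mu).
  have c1 := dv_cat (dRr x); have c2 := cat_gext x; have c3 := dv_cat (dv_kapp x0).
  have c4 : cat (fun x => x `^ (p - 1)) x by exact: dv_cat (dv_powR (p - 1) x0 (dv_id x)).
  rewrite /Ku; apply: catM.
    apply: catM => //; apply: catV; last by catt.
    by rewrite gt_eqF// mulr_gt0// gext_gt0.
  apply: catD => //; apply: catD; first by catt.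
  by apply: catM; [catt|apply: catV; [rewrite gt_eqF|catt]].
- move=> /andP[ux _]; have x0 : 0 < x by lra.
  have Tm : 0 < x `^ (p - 1) - m.
    by rewrite subr_gt0 -ppow_gt0// T_gt// (lt_trans mu).
  have d1 := dRr x; have d2 := dv_gext x0; have d3 := dv_kapp x0; have g0 := gext_gt0 x.
  have d4 := dv_powR (p - 1) x0 (dv_id x).
  have n1 : x * gext x != 0 by rewrite gt_eqF// mulr_gt0.
  have n2 : x `^ (p - 1) - m != 0 by rewrite gt_eqF.
  have d5 := dv_div (f := Rr) (g := fun y => y * gext y) n1 d1 (dvM (dv_id x) d2).
  have d6 := dv_div (f := fun=> (p - 1) * m) (g := fun y => y `^ (p - 1) - m) n2
    (dv_cst _ x) (dvB d4 (dv_cst m x)).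
  rewrite /Ku; apply: (dv_eq (dvM d5 (dvD (dvD (dv_cst _ _) d6) d3))).
  have -> : x `^ (p - 1 - 1) = x `^ (p - 1) / x.
    have := @mulr_powRB1 _ x (p - 1) (ltW x0) pm1 => <-.
    by field; rewrite gt_eqF.
  by rewrite /Jdef; field; rewrite n2 !gt_eqF.
- move=> /andP[ux _]; have x0 : 0 < x by lra.
  have Ux : U0 <= x by lra.
  have [[h1 h2] h3] := hU x Ux.
  have Tm : 0 < x `^ (p - 1) - m.
    by rewrite subr_gt0 -ppow_gt0// T_gt// (lt_trans mu).
  have g0 := gext_gt0 x; have R0 := Rr_gt0 x0; have Xs := Xp x0.
  have kx := kapp_ge0 (ltW x0).
  have kR : kapp x * Rr x <= Jdef 1 / 2.
    apply: le_trans (ler_wpM2l kx h1) _.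
    have : kapp x * X x * cu <= Jdef 1 / (2 * cu) * cu by apply: ler_wpM2r => //; exact: ltW.
    have -> : Jdef 1 / (2 * cu) * cu = Jdef 1 / 2 by field; rewrite gt_eqF.
    by rewrite (_ : kapp x * X x * cu = kapp x * (cu * X x)); last by ring.
  have k'R : Rr x * `|x * kapp' x| <= Jdef 1 * del / 2.
    apply: le_trans (ler_wpM2r (normr_ge0 _) h1) _.
    have : `|x * kapp' x| * X x * cu <= Jdef 1 * del / (2 * cu) * cu.
      by apply: ler_wpM2r => //; exact: ltW.
    have -> : Jdef 1 * del / (2 * cu) * cu = Jdef 1 * del / 2 by field; rewrite gt_eqF.
    by rewrite (_ : `|x * kapp' x| * X x * cu = cu * X x * `|x * kapp' x|); last by ring.
  have Jx : Jdef 1 <= Jdef x by apply: Jdef_ndecr => //; lra.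
  set B := p - k / 2 + _ + kapp x.
  have Bd : del <= B.
    rewrite /B /del -addrA lerDl; apply: addr_ge0 => //.
    by apply: divr_ge0; [apply: mulr_ge0; exact: ltW|exact: ltW].
  set Z := (p - 1) ^+ 2 * m * x `^ (p - 1) / x / (x `^ (p - 1) - m) ^+ 2.
  have Z0 : 0 <= Z.
    have xp := powR_ge0 x (p - 1); rewrite /Z.
    by pos.
  have -> : (- Jdef x + kapp x * Rr x) / (x ^+ 2 * gext x) * B +
    Rr x / (x * gext x) * (- Z + kapp' x) =
    ((- Jdef x + kapp x * Rr x) * B + Rr x * (x * kapp' x) - Rr x * x * Z) /
      (x ^+ 2 * gext x) by field; rewrite !gt_eqF.
  apply: mulr_le0_ge0; last first.
    by rewrite invr_ge0; apply: mulr_ge0; [exact: sqr_ge0|exact: ltW].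
  have t1 : (- Jdef x + kapp x * Rr x) * B <= - (Jdef 1 / 2) * del.
    have h : (Jdef 1 / 2) * del <= (Jdef x - kapp x * Rr x) * B.
      by apply: ler_pM; [lra|exact: ltW|lra|].
    by lra.
  have t2 : Rr x * (x * kapp' x) <= Jdef 1 * del / 2.
    by apply: le_trans k'R; apply: ler_wpM2l; [exact: ltW|exact: ler_norm].
  have t3 : 0 <= Rr x * x * Z by apply: mulr_ge0 => //; apply: mulr_ge0; exact: ltW.
  by lra.
Qed.

Lemma dual_nonlin : exists2 m0, 0 < m0 & forall m, m0 <= m ->
  nonlin (fdual m) (fdual' m) (Fdual m) (Rr (um m)) (Rr (ubt m)).
Proof.
have [U0 [U01 hU]] := dual_K_decr.
(* [m >= U0 ^ (p - 1)] means [um m >= U0], so that every [w > b] corresponds to some [u >= U0]; the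
   1 keeps [m] positive. *)
exists (Num.max 1 (U0 `^ (p - 1))); first by rewrite lt_max ltr01.
move=> m; rewrite ge_max => /andP[m1 mU].
have m0 : 0 < m by lra.
have Um : U0 <= um m.
  have -> : U0 = (U0 `^ (p - 1)) `^ (p - 1)^-1.
    by rewrite -powRrM mulfV ?gt_eqF// powRr1//; lra.
  apply: ge0_ler_powR => //; first by rewrite invr_ge0 ltW.
    by rewrite nnegrE powR_ge0.
  by rewrite nnegrE ltW.
split; first exact: dual_nonlin0.
  by move=> s; exact: dv_fdual.
have KE s : Rr (um m) < s -> s * fdual' m s / fdual m s = Ku m (rho s).
  move=> bs; have s0 : 0 < s by apply: lt_trans bs; apply: Rr_gt0; exact: um_gt0.
  have u0 : 0 < rho s by rewrite rho_gt0.
  have mu : um m < rho s by rewrite -Rr_lt rhoK.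
  have Tm : 0 < (rho s) `^ (p - 1) - m by rewrite subr_gt0 -ppow_gt0// T_gt.
  have g0 := gext_gt0 (rho s).
  rewrite -{1}(rhoK s) /fdual' /fdual /phid' /phid hdualE// /T /Ku !ppow_gt0//.
  by field; rewrite !gt_eqF.
move=> s t bs st; rewrite !KE//; last exact: lt_le_trans st.
have mu : um m < rho s by rewrite -Rr_lt rhoK.
apply: hU => //; last by rewrite rho_le.
exact: le_trans (ltW mu).
Qed.

(** Beyond [S] one has [J' = kapp g <= e' g], so [J] is at most a constant plus [e' R], and [R] is
    at most of order [X], hence of [s g]. In other words [R / (s g)] tends to [2 / (k + 2)], which
    decides the sign of Pohozaev's density at infinity. *)
Lemma Jdef_small e : 0 < e -> ev (fun s => Jdef s <= e * (s * gext s)).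
Proof.
move=> e0; have [cu cu0 hcu] := Rr_le_X.
have sa : 0 < Num.sqrt a1 by rewrite sqrtr_gt0.
pose e' := e * Num.sqrt a1 / (2 * cu).
have e'0 : 0 < e' by apply: divr_gt0; exact: mulr_gt0.
have [S S1 hS] := kapp_small e'0.
have k22 : 0 < (k + 2) / 2 by have := k2; lra.
apply: evS (evI (evI (ev_ge S) hcu) (ev_powR_ge (2 * Jdef S / (e * Num.sqrt a1)) k22)).
move=> s s1 [[Ss h1] h2]; have s0 : 0 < s by lra.
rewrite -/(X s) in h2; have S0 : 0 < S by lra.
have eS : 0 < e * Num.sqrt a1 by exact: mulr_gt0.
rewrite ler_pdivrMr// in h2.
have hJ : Jdef s <= Jdef S + e' * Rr s.
  have : Jdef s - e' * Rr s <= Jdef S - e' * Rr S.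
    apply: (@nincr _ (fun x => Jdef x - e' * Rr x) (fun x => (kapp x - e') * gext x) S s Ss) => x.
    - by move=> _; have c1 := cat_Jdef x; have c2 := dv_cat (dRr x); catt.
    - move=> /andP[x1 _]; have d1 := dv_Jdef (lt_trans S0 x1); have d2 := dRr x.
      by der; ring.
    - move=> /andP[x1 _]; apply: mulr_le0_ge0; last exact/ltW/gext_gt0.
      rewrite subr_le0; apply: le_trans (hS x (ltW x1)).
      rewrite ler_peMr//; first by apply: kapp_ge0; lra.
      rewrite -[X in X <= _](powRr0 x); apply: ler_powR; first by lra.
      exact: ltW.
  have : 0 <= e' * Rr S by apply: mulr_ge0; [exact: ltW|exact/ltW/Rr_gt0].
  by lra.
have hg : Num.sqrt a1 * X s <= s * gext s.
  have := gext_ge s0; move=> /(ler_wpM2l (ltW s0)); apply: le_trans.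
  rewrite mulrCA /X le_eqVlt; apply/orP; left; apply/eqP; congr (_ * _).
  rewrite -[X in _ = X * _](powRr1 (ltW s0)) -powRD; last by rewrite (gt_eqF s0) implybT.
  by congr (_ `^ _); field.
have h3 : e' * Rr s <= e * Num.sqrt a1 / 2 * X s.
  apply: le_trans (ler_wpM2l (ltW e'0) h1) _.
  by rewrite le_eqVlt; apply/orP; left; apply/eqP; rewrite /e'; field; rewrite gt_eqF.
have : e * (Num.sqrt a1 * X s) <= e * (s * gext s) by apply: ler_wpM2l => //; exact: ltW.
by lra.
Qed.

(** In terms of [u], [w] is of order [u ^ ((k + 2) / 2)] and [f] of order [u ^ (p - k / 2)], whence
    the exponent [q]. For the density, [w f] is written as [w / (u g)] times [u h], and the first
    factor is close to [2 / (k + 2)]. *)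
Lemma dual_growth m (n : nat) (q := (2 * p - k) / (k + 2)) : 0 < m -> (2 <= n)%N ->
  q * (n%:R - 1) < n%:R + 3 -> exists c1 c2 C3 W0 M0 : R,
  [/\ 0 < c1, 0 < c2, 0 < C3, 1 <= W0 & Rr (um m) <= W0] /\
  [/\ forall s, W0 <= s -> c1 * s `^ q <= fdual m s,
      forall A s, W0 <= A -> s <= A -> fdual m s <= C3 * A `^ q,
      forall s, W0 <= s -> c2 * s `^ (q + 1) <=
        (n%:R + 1) * Fdual m s - (n%:R - 1) / 2 * s * fdual m s,
      0 <= M0 & forall s, - M0 <= fdual m s].
Proof.
move=> m0 n2 qn; have H0 := dual_nonlin0 m0.
have kk2 : 0 < k + 2 by have := k2; lra.
have q0 : 0 < q by apply: divr_gt0 => //; have := kp; lra.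
have sa : 0 < Num.sqrt a1 by rewrite sqrtr_gt0.
have G10 : 0 < Num.sqrt (a1 + 1) by rewrite sqrtr_gt0; have := a10; lra.
have n1R : (0 : R) < n%:R - 1 by rewrite subr_gt0 ltr1n.
have nR : (0 : R) < n%:R by lra.
have [cu cu0 hcu] := Rr_le_X.
set G1 := Num.sqrt (a1 + 1) in G10.
pose cl := 2 * Num.sqrt a1 / (k + 2).
have cl0 : 0 < cl by apply: divr_gt0 => //; exact: mulr_gt0.
have Xq u : 0 < u -> X u `^ q = u `^ (p - k / 2).
  by move=> u0; rewrite /X -powRrM; congr (_ `^ _); rewrite /q; field; rewrite gt_eqF.
have uT u : 0 < u -> u * T u = u `^ (p - k / 2) * u `^ (k / 2).
  move=> u0; rewrite /T ppow_gt0// (mulr_powRB1 (ltW u0)); last by have := p1; lra.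
  rewrite -powRD; last by rewrite (gt_eqF u0) implybT.
  by congr (_ `^ _); ring.
(* The coefficient of [u ^ (p + 1)] in the density at infinity; after clearing denominators its
   positivity is the hypothesis on [q]. *)
pose D := (n%:R + 1) / (p + 1) - (n%:R - 1) / (k + 2).
have pp : 0 < p + 1 by have := p1; lra.
have D0 : 0 < D.
  have -> : D = ((n%:R + 1) * (k + 2) - (n%:R - 1) * (p + 1)) / ((p + 1) * (k + 2)).
    by rewrite /D; field; rewrite !gt_eqF.
  apply: divr_gt0; last exact: mulr_gt0.
  by move: qn; rewrite /q mulrAC ltr_pdivrMr//; lra.
(* This relative error in [w / (u g)] costs half of [D]; the terms in [m] may take another quarter,
   which is the last threshold imposed on [S]. *)
pose e := D / (n%:R - 1) * (k + 2) / 2.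
have e0 : 0 < e by apply: divr_gt0 => //; apply: mulr_gt0 => //; exact: divr_gt0.
have pm1' := pm1.
have [S S1 hS] := evI (evI (evI gext_le hcu) (Jdef_small e0))
  (evI (ev_powR_ge (2 * m) pm1') (ev_powR_ge (2 * (n%:R + 1) * m / D) pm1')).
pose W0 := Num.max 1 (Num.max (Rr S) (Rr (um m))).
have W01 : 1 <= W0 by rewrite /W0 le_max lexx.
have W0S : Rr S <= W0 by rewrite /W0 !le_max lexx orbT.
have W0b : Rr (um m) <= W0 by rewrite /W0 !le_max lexx !orbT.
have cq : 0 < cu `^ q by exact: powR_gt0.
have cq1 : 0 < cu `^ (q + 1) by exact: powR_gt0.
have clq : 0 < cl `^ q by exact: powR_gt0.
have b0 := Rr_gt0 (um_gt0 m0).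
have [c _ hc] := evt_min (ltW b0) (fun x _ => cat_fdual m x).
exists (1 / (2 * G1 * cu `^ q)), (D / 4 / cu `^ (q + 1)), (1 / (Num.sqrt a1 * cl `^ q)), W0,
  `|fdual m c|.
have big s : W0 <= s -> [/\ 0 < s, 0 < rho s, S <= rho s & s = Rr (rho s)].
  move=> Ws; have s0 : 0 < s by lra.
  by split => //; [rewrite rho_gt0|rewrite -Rr_le rhoK; exact: le_trans Ws].
split; split => //.
- by apply: divr_gt0 => //; apply: mulr_gt0 => //; exact: mulr_gt0.
- by apply: divr_gt0 => //; lra.
- by apply: divr_gt0 => //; exact: mulr_gt0.
- move=> s Ws; have [s0 u0 Su es] := big s Ws.
  have [[[h1 h2] _] [h4 _]] := hS _ Su.
  set u := rho s in u0 Su es h1 h2 h4.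
  have Xu := Xp u0; have Yk : 0 < u `^ (k / 2) by exact: powR_gt0.
  have sq : s `^ q <= cu `^ q * u `^ (p - k / 2).
    rewrite -Xq// -powRM ?(ltW cu0) ?(ltW Xu)//.
    by apply: ge0_ler_powR; rewrite ?nnegrE ?(ltW q0) ?(ltW s0)//;
      [apply: mulr_ge0; exact: ltW|rewrite {1}es].
  have fl : u `^ (p - k / 2) / (2 * G1) <= fdual m s.
    rewrite /fdual -/u /phid ler_pdivlMr ?gext_gt0//.
    apply: (@le_trans _ _ (u * T u / 2)).
      rewrite uT// ler_pdivlMr//.
      have : gext u / (2 * G1) * 2 <= u `^ (k / 2).
        rewrite (_ : _ * 2 = gext u / G1); last by field; rewrite gt_eqF.
        by rewrite ler_pdivrMr// mulrC.
      move=> h; have -> : u `^ (p - k / 2) / (2 * G1) * gext u * 2 =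
        u `^ (p - k / 2) * (gext u / (2 * G1) * 2) by ring.
      by apply: ler_wpM2l => //; exact: powR_ge0.
    rewrite hdualE// -mulrA; apply: ler_wpM2l; first exact: ltW.
    by rewrite /T ppow_gt0//; lra.
  apply: le_trans fl; rewrite mulrAC mul1r ler_pdivrMr//; last first.
    by apply: mulr_gt0 => //; exact: mulr_gt0.
  apply: le_trans sq _; rewrite le_eqVlt; apply/orP; left; apply/eqP.
  by field; rewrite !gt_eqF.
- move=> A s WA sA.
  have A0 : 0 < A by lra.
  have [s0|s0] := leP s 0.
    rewrite (nl_le0 H0 s0); apply: mulr_ge0; last exact: powR_ge0.
    by apply: divr_ge0 => //; apply: mulr_ge0; [exact: ltW|exact: powR_ge0].
  have u0 : 0 < rho s by rewrite rho_gt0.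
  set u := rho s in u0; have es : s = Rr u by rewrite /u rhoK.
  have Yk : 0 < u `^ (k / 2) by exact: powR_gt0.
  have f1 : fdual m s <= u `^ (p - k / 2) / Num.sqrt a1.
    rewrite /fdual -/u /phid ler_pdivrMr ?gext_gt0//.
    apply: (@le_trans _ _ (u * T u)).
      rewrite hdualE//; apply: ler_wpM2l; first exact: ltW.
      by rewrite gerDl oppr_le0 ltW.
    rewrite uT// -mulrA; apply: ler_wpM2l; first exact: powR_ge0.
    by rewrite ler_pdivlMl// gext_ge.
  have f2 : cl `^ q * u `^ (p - k / 2) <= A `^ q.
    rewrite -Xq// -powRM ?(ltW cl0) ?powR_ge0//.
    apply: ge0_ler_powR; rewrite ?nnegrE ?(ltW q0) ?(ltW A0)//.
      by apply: mulr_ge0; [exact: ltW|exact: powR_ge0].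
    by apply: le_trans sA; rewrite es; exact: Rr_ge.
  apply: le_trans f1 _.
  rewrite ler_pdivrMr//.
  rewrite (_ : 1 / (Num.sqrt a1 * cl `^ q) * A `^ q * Num.sqrt a1 = A `^ q / cl `^ q); last first.
    by field; rewrite !gt_eqF.
  by rewrite ler_pdivlMr// mulrC.
- move=> s Ws; have [s0 u0 Su es] := big s Ws.
  have [[[h1 h2] h3] [h4 h5]] := hS _ Su.
  set u := rho s in u0 Su es h1 h2 h3 h4 h5.
  clear clq cl0 cq W01 W0S W0b b0 S1 sa G10 Su hS hc big Ws h1.
  have Xu := Xp u0; have g0 := gext_gt0 u.
  have Xq1 : X u `^ (q + 1) = u ^+ 2 * T u.
    rewrite /T ppow_gt0// -powR_mulrn; last exact: ltW.
    rewrite -powRD; last by rewrite (gt_eqF u0) implybT.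
    by rewrite /X -powRrM; congr (_ `^ _); rewrite /q; field; rewrite gt_eqF.
  have sq : s `^ (q + 1) <= cu `^ (q + 1) * (u ^+ 2 * T u).
    rewrite -Xq1 -powRM ?(ltW cu0) ?(ltW Xu)//.
    apply: ge0_ler_powR; rewrite ?nnegrE ?(ltW s0)//; first by lra.
      by apply: mulr_ge0; exact: ltW.
    by rewrite {1}es.
  have Tu : T u = u `^ (p - 1) by rewrite /T ppow_gt0.
  rewrite -Tu in h4 h5; rewrite ler_pdivrMr// in h5.
  have sig : s / (u * gext u) <= 2 / (k + 2) * (1 + e).
    rewrite ler_pdivrMr; last exact: mulr_gt0.
    rewrite [leRHS](_ : _ = 2 * (1 + e) * (u * gext u) / (k + 2)); last by ring.
    rewrite ler_pdivlMr//; by move: h3; rewrite /Jdef -es; lra.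
  have sf : s * fdual m s = s / (u * gext u) * (u ^+ 2 * (T u - m)).
    by rewrite /fdual -/u /phid hdualE//; field; rewrite !gt_eqF.
  have Tm : 0 <= T u - m by have := m0; lra.
  have u2T : 0 <= u ^+ 2 * (T u - m) by apply: mulr_ge0 => //; exact: sqr_ge0.
  rewrite -(mulrA ((n%:R - 1) / 2)) sf /Fdual -/u GdualE//.
  have t1 : s / (u * gext u) * (u ^+ 2 * (T u - m)) <=
      2 / (k + 2) * (1 + e) * (u ^+ 2 * (T u - m)) by exact: ler_wpM2r.
  have t2 : (n%:R - 1) / 2 * (s / (u * gext u) * (u ^+ 2 * (T u - m))) <=
      (n%:R - 1) / 2 * (2 / (k + 2) * (1 + e) * (u ^+ 2 * (T u - m))).
    by apply: ler_wpM2l => //; lra.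
  apply: (@le_trans _ _ (D / 4 * (u ^+ 2 * T u))).
    rewrite mulrAC ler_pdivrMr// -[X in _ <= X]mulrA; apply: ler_wpM2l; first by lra.
    by rewrite mulrC.
  apply: (@le_trans _ _ ((n%:R + 1) * (u ^+ 2 * (T u / (p + 1) - m / 2)) -
    (n%:R - 1) / 2 * (2 / (k + 2) * (1 + e) * (u ^+ 2 * (T u - m))))); last by lra.
  have -> : (n%:R + 1) * (u ^+ 2 * (T u / (p + 1) - m / 2)) -
    (n%:R - 1) / 2 * (2 / (k + 2) * (1 + e) * (u ^+ 2 * (T u - m))) =
    u ^+ 2 * (D / 2 * T u + (n%:R - 1) / (k + 2) * (1 + e) * m - (n%:R + 1) / 2 * m).
    by rewrite /e /D; field; rewrite !gt_eqF.
  rewrite mulrCA; apply: ler_wpM2l; first exact: sqr_ge0.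
  have : 0 <= (n%:R - 1) / (k + 2) * (1 + e) * m.
    by apply: mulr_ge0; [apply: mulr_ge0; [apply: divr_ge0; exact: ltW|lra]|exact: ltW].
  by lra.
- move=> s; have [sb|bs] := leP s (Rr (um m)).
    have [s0|s0] := leP s 0; first by rewrite (nl_le0 H0 s0) oppr_le0.
    apply: (@le_trans _ _ (fdual m c)); first by rewrite lerNl -normrN ler_norm.
    by apply: hc; rewrite (ltW s0).
  by apply: le_trans (ltW (nl_pos H0 bs)); rewrite oppr_le0.
Qed.

Lemma fdual_le_linear m : 0 < m -> exists ka e : R, [/\ 0 < ka, 0 < e &
  forall s, 0 < s -> s < e -> fdual m s <= - ka * s].
Proof.
move=> m0; have [c _ hc] := evt_max ler01 (fun x _ => cat_gext x).
pose G := gext c; have G0 : 0 < G := gext_gt0 c.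
pose u0 := Num.min 1 ((m / 2) `^ (p - 1)^-1).
have m2 : 0 < m / 2 by lra.
have u00 : 0 < u0 by rewrite /u0 lt_min ltr01 powR_gt0.
exists (m / 2 / G ^+ 2), (Rr u0); split; [by apply: divr_gt0 => //; exact: exprn_gt0|exact: Rr_gt0|].
move=> s s0 su; have up : 0 < rho s by rewrite rho_gt0.
set u := rho s in up; have es : s = Rr u by rewrite /u rhoK.
have uu : u < u0 by rewrite -Rr_lt -es.
have u1 : u <= 1 by apply/ltW/(lt_le_trans uu); rewrite /u0 ge_min lexx.
have uT2 : T u < m / 2.
  by rewrite T_lt//; apply: lt_le_trans uu _; rewrite /u0 ge_min lexx orbT.
have gG : gext u <= G by apply: hc; rewrite (ltW up).
have sG : s <= G * u.
  rewrite es; have [x /andP[x0 xu] e] := mvt up (fun x _ => dv_cat (dRr x)) (fun x _ => dRr x).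
  move: e; rewrite Rr0 !subr0 => ->; apply: ler_wpM2r; first exact: ltW.
  by apply: hc; apply/andP; split; lra.
rewrite /fdual -/u /phid hdualE// ler_pdivrMr ?gext_gt0//.
have t1 : m / 2 / G ^+ 2 * s * gext u <= m / 2 / G ^+ 2 * (G * u) * G.
  apply: ler_pM; [|exact/ltW/gext_gt0| |exact: gG].
    by apply: mulr_ge0; [apply: divr_ge0; [exact: ltW|exact: sqr_ge0]|exact: ltW].
  by apply: ler_wpM2l => //; apply: divr_ge0; [exact: ltW|exact: sqr_ge0].
have t2 : m / 2 / G ^+ 2 * (G * u) * G = m / 2 * u by field; rewrite gt_eqF.
have t3 : u * (T u - m) <= u * (- (m / 2)) by apply: ler_wpM2l; [exact: ltW|lra].
by lra.
Qed.

End dual.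

(** * Integration on R^N *)

Section measurability.
Context (R : realType) (n : nat).
Implicit Types (x y : 'rV[R]_n) (h : 'rV[R]_n -> R).

Definition rV_box (A : 'I_n -> set R) : set 'rV[R]_n := [set x | forall i, A i (x 0 i)].

Lemma measurable_rV_box (A : 'I_n -> set (measurableTypeR R)) :
  (forall i, measurable (A i)) -> measurable (rV_box A).
Proof.
move=> mA; rewrite (_ : rV_box A =
    \bigcap_(i : 'I_n) ((fun x : 'rV[R]_n => x 0%R i) @^-1` A i)).
  apply: fin_bigcap_measurable => // i _.
  by rewrite -[X in measurable X]setTI; exact: measurable_coord.
by apply/seteqP; split=> x /= h i; [move=> _|]; exact: h.
Qed.

(* an open set is the union of the boxes with rational centre and radius
   that it contains *)
Lemma open_measurable_rV (O : set 'rV[R]_n) : open O -> measurable O.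
Proof.
move=> oO.
pose box (c : {ffun 'I_n -> rat}) (k : nat) := rV_box (fun i =>
  (`]ratr (c i) - k.+1%:R^-1, ratr (c i) + k.+1%:R^-1[%classic : set R)).
pose E (j : nat) := if unpickle j is Some (c, k) then
  (if `[< box c k `<=` O >] then box c k else set0) else set0.
have -> : O = \bigcup_j E j.
  apply/seteqP; split => [x Ox|x [j _]]; last first.
    by rewrite /E; case: unpickle => // -[c k]; case: asboolP => // sub /sub.
  have /nbhs_ballP[e /= e0 he] : nbhs x O by exact: open_nbhs_nbhs.
  pose k := Num.truncn (2 / e).
  have ke : (k.+1%:R : R)^-1 < e / 2.
    rewrite -[e / 2]invrK ltf_pV2 ?posrE ?invr_gt0 ?divr_gt0// invf_div.
    exact: truncnS_gt.
  have k0 : 0 < (k.+1%:R : R)^-1 by rewrite invr_gt0.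
  have hc i : exists c : rat, x 0 i - k.+1%:R^-1 < ratr c /\ ratr c < x 0 i + k.+1%:R^-1.
    have [|c] := @rat_in_itvoo R (x 0 i - k.+1%:R^-1) (x 0 i + k.+1%:R^-1).
      by move: k0; set d := _^-1; lra.
    by rewrite in_itv/= => /andP[]; exists c.
  have [c cP] := choice hc.
  exists (pickle ([ffun i => c i], k)) => //; rewrite /E pickleK.
  move: ke k0 cP; rewrite /box /rV_box; set d := k.+1%:R^-1 => ke k0 cP.
  case: asboolP => [_ i|].
    by rewrite /= in_itv/= ffunE; have [c1 c2] := cP i; apply/andP; split; lra.
  case=> y hy; apply: he; split => // i j; rewrite ord1.
  have := hy j; rewrite /= in_itv/= ffunE => /andP[y1 y2]; have [c1 c2] := cP j.
  by rewrite /ball/= ltr_norml; apply/andP; split; lra.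
apply: bigcupT_measurable => j; rewrite /E; case: unpickle => // -[c k].
case: ifP => _; last exact: measurable0.
by apply: measurable_rV_box => i; exact: measurable_itv.
Qed.

Lemma continuous_measurable_rV h : continuous h -> measurable_fun setT h.
Proof.
move=> ch; apply: (measurability _ (RGenInftyO.measurableE R)).
move=> /= _ [_ [a ->]] <-; rewrite setTI; apply: open_measurable_rV.
have -> : h @^-1` `]-oo, a[ = h @^-1` [set y | y < a].
  by apply/seteqP; split => x /=; rewrite in_itv.
by apply: open_comp => // x _; exact: ch.
Qed.

End measurability.

Section box_support.
Context (R : realType).

Definition cube {n} (M : R) : set 'rV[R]_n := rV_box (fun=> `[- M, M]%classic).

Lemma measurable_cube n (M : R) : measurable (cube M : set 'rV[R]_n).
Proof. by apply: measurable_rV_box => i; exact: measurable_itv. Qed.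

Lemma cube_lty n (M : R) : (lebesgue_rV R n (cube M) < +oo)%E.
Proof.
rewrite lebesgue_rV_box; last by move=> i; exact: measurable_itv.
rewrite lebesgue_measure_itv/=; set c := (if _ then _ else _).
have [v ->] : exists v : R, c = v%:E.
  by rewrite /c; case: ifP => _; [exists (M - - M)|exists 0].
have [u ->] : exists u : R, (\prod_(i < n) v%:E = u%:E)%E.
  elim/big_ind: _ => [|_ _ [a ->] [b ->]|_ _]; [by exists 1|by exists (a * b)|by exists v].
exact: ltry.
Qed.

Lemma cube_lebesgue n (h : 'rV[R]_n -> R) M : continuous h ->
  (forall x, ~ cube M x -> h x = 0) ->
  (lebesgue_rV R n).-integrable setT (EFin \o h).
Proof.
move=> ch h0.
have cM : compact (cube M : set 'rV[R]_n).
  by apply: rV_compact => i; exact: segment_compact.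
have [B [_ hB]] := compact_bounded (continuous_compact (continuous_subspaceT ch) cM).
have mh := continuous_measurable_rV ch.
apply: (@le_integrable _ _ _ _ _ _ _ (fun x => (B + 1)%:E * (\1_(cube M) x)%:E)%E) => //.
- exact/measurable_EFinP.
- move=> x _ /=; rewrite indicE; have [xM|xM] := boolP (x \in cube M).
    rewrite mulr1 lee_fin (le_trans _ (ler_norm _))//.
    by apply: (hB (B + 1)); [rewrite ltrDl|exists x => //; rewrite inE in xM].
  by rewrite h0 ?normr0 ?mulr0 ?normr0//; move: xM; rewrite notin_setE.
- apply: integrableZl => //.
  apply/integrableP; split; first by apply/measurable_EFinP; apply: measurable_indic; exact: measurable_cube.
  rewrite (eq_integral (fun x => (\1_(cube M) x)%:E)); last first.
    by move=> x _; rewrite /= ger0_norm.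
  rewrite integral_indic ?setIT//; [exact: cube_lty|exact: measurable_cube].
Qed.

End box_support.

(** * Partial derivatives along lines, Fubini's theorem and integration of a derivative *)

Section lines.
Context (R : realType) (n : nat).
Implicit Types (x v : 'rV[R]_n) (f : 'rV[R]_n -> R).

(** Partial derivatives become derivatives in one real variable, so that the [dv] rules apply to
    them. *)
Lemma is_derive_line f x v (l : R) :
  is_derive x v f l <-> dv (fun t : R => f (t *: v + x)) (0 : R) l.
Proof.
have e : (fun h : R => h^-1 *: ((f \o shift x) (h *: v) - f x)) =
    (fun h : R => h^-1 *: (((fun t : R => f (t *: v + x)) \o shift 0) (h *: 1) -
      (fun t : R => f (t *: v + x)) 0)).
  by apply/funext => h /=; rewrite addr0 scale0r add0r /GRing.scale/= mulr1.
by split=> -[d1 d2]; constructor; move: d1 d2; rewrite /derivable /derive e.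
Qed.

Lemma derivable_line f x v (t : R) l : is_derive (t *: v + x) v f l ->
  dv (fun t : R => f (t *: v + x)) t l.
Proof.
move=> /is_derive_line d; have d1 : dv (fun s : R => s - t) t 1.
  by apply: (dv_eq (dvB (dv_id t) (dv_cst t t))); rewrite subr0.
have d0 : dv (fun s : R => f (s *: v + (t *: v + x))) (t - t) l by rewrite subrr.
have := dv_comp (g := fun s : R => s - t) d0 d1; rewrite mulr1.
apply: dv_on; first exact: filterT.
by move=> s _; rewrite addrA -scalerDl subrK.
Qed.

End lines.

Section fubini.
Context (R : realType) (n : nat).
Local Open Scope ereal_scope.
Implicit Types f : 'rV[R]_n.+1 -> \bar R.

Let leb := @lebesgue_measure R.
Let mu := lebesgue_rV R n.

Let integral_consE f :
  \int[lebesgue_rV R n.+1]_x f x = \int[pushforward (leb \x mu) (@rV_cons R n)]_x f x.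
Proof. by []. Qed.

Lemma tonelli_rV f : measurable_fun setT f -> (forall x, 0 <= f x) ->
  \int[lebesgue_rV R n.+1]_x f x = \int[leb]_t \int[mu]_x f (rV_cons (t, x)).
Proof.
move=> mf f0; rewrite integral_consE ge0_integral_pushforward//; last exact: measurable_rV_cons.
rewrite preimage_setT fubini_tonelli1//; last by move=> z; exact: f0.
by apply: measurableT_comp mf _; exact: measurable_rV_cons.
Qed.

Let integrable_cons f : (lebesgue_rV R n.+1).-integrable setT f ->
  (leb \x mu).-integrable setT (f \o @rV_cons R n).
Proof.
move=> /integrableP[mf fi]; have mc := @measurable_rV_cons R n.
apply/integrableP; split; first exact: measurableT_comp.
move: fi; rewrite integral_consE ge0_integral_pushforward ?preimage_setT//.
exact: measurableT_comp.
Qed.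

Let integral_cons f : (lebesgue_rV R n.+1).-integrable setT f ->
  \int[lebesgue_rV R n.+1]_x f x = \int[leb \x mu]_z (f \o @rV_cons R n) z.
Proof.
move=> /[dup] fi /integrableP[mf _].
rewrite integral_consE integral_pushforward ?preimage_setT//; first exact: measurable_rV_cons.
exact: integrable_cons.
Qed.

Lemma fubini_rV1 f : (lebesgue_rV R n.+1).-integrable setT f ->
  \int[lebesgue_rV R n.+1]_x f x = \int[leb]_t \int[mu]_x f (rV_cons (t, x)).
Proof. by move=> fi; rewrite integral_cons// -integral12_prod_meas1//; exact: integrable_cons. Qed.

Lemma fubini_rV2 f : (lebesgue_rV R n.+1).-integrable setT f ->
  \int[lebesgue_rV R n.+1]_x f x = \int[mu]_x \int[leb]_t f (rV_cons (t, x)).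
Proof. by move=> fi; rewrite integral_cons// -integral21_prod_meas1//; exact: integrable_cons. Qed.

End fubini.

Section divergence_theorem.
Context (R : realType).
Implicit Types n : nat.

Lemma continuous_rV_cons n (h : 'rV[R]_n.+1 -> R) : continuous h ->
  (forall t : R, continuous (fun x : 'rV[R]_n => h (rV_cons (t, x)))) /\
  (forall x : 'rV[R]_n, continuous (fun t : R => h (rV_cons (t, x)))).
Proof.
have bl (t s : R) (x y : 'rV[R]_n) e : ball t e s -> ball x e y ->
    ball (rV_cons (t, x)) e (rV_cons (s, y)).
  move=> ts [e0 xy]; split => // i j; rewrite ord1.
  have [k ->|->] := unliftP ord0 j; first by rewrite !rV_consS.
  by rewrite !rV_cons0.
move=> ch; split => [t x|x t].
  apply: (continuous_comp (f := fun y => rV_cons (t, y)) _ (ch _)) => A /nbhs_ballP[e /= e0 he].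
  apply/nbhs_ballP; exists e => //= y xy; apply: he; apply: bl => //.
  exact: ballxx.
apply: (continuous_comp (f := fun s => rV_cons (s, x)) _ (ch _)) => A /nbhs_ballP[e /= e0 he].
apply/nbhs_ballP; exists e => //= y xy; apply: he; apply: bl => //.
exact: ballxx.
Qed.

Lemma integral_line0 (k l : R -> R) (M : R) : 0 < M -> continuous l ->
  (forall t : R, dv k t (l t)) -> (forall t : R, ~ (- M <= t <= M) -> k t = 0 /\ l t = 0) ->
  (\int[@lebesgue_measure R]_t (l t)%:E = 0)%E.
Proof.
move=> M0 cl dk kl0; pose a := - M - 1; pose b := M + 1.
have ab : a < b by rewrite /a /b; lra.
have ka : k a = 0 by apply: (proj1 (kl0 _ _)); rewrite /a => /andP[]; lra.
have kb : k b = 0 by apply: (proj1 (kl0 _ _)); rewrite /b => /andP[]; lra.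
have ck x : {for x, continuous k} by exact: catE (dv_cat (dk x)).
have := @continuous_FTC2 R l k a b ab (continuous_subspaceT cl) _ _.
rewrite ka kb subee// => <-.
- rewrite [RHS]integral_mkcond; apply: eq_integral => x _.
  rewrite patchE; case: ifP => // /negbT; rewrite notin_setE /= in_itv /= => xab.
  rewrite (proj2 (kl0 x _))// => /andP[x1 x2]; apply: xab.
  by apply/andP; rewrite /a /b; split; lra.
- split; first by move=> x _; have [] := dk x.
  + exact: cvg_at_right_filter (ck a).
  + exact: cvg_at_left_filter (ck b).
- by move=> x _; rewrite derive1E; have [_ ->] := dk x.
Qed.

Lemma line_coord n (i j : 'I_n) (s : R) (x : 'rV[R]_n) :
  (s *: delta_mx 0 i + x) 0 j = s * (j == i)%:R + x 0 j.
Proof. by rewrite !mxE eqxx. Qed.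

Lemma rV_cons_line0 n (s t : R) (x : 'rV[R]_n) :
  rV_cons (s + t, x) = s *: delta_mx 0 ord0 + rV_cons (t, x).
Proof.
apply/rowP => j; rewrite [RHS]line_coord; have [k ->|->] := unliftP ord0 j.
  by rewrite !rV_consS eq_sym (negbTE (neq_lift _ _)) mulr0 add0r.
by rewrite !rV_cons0 !eqxx mulr1.
Qed.

Lemma rV_cons_lineS n (j : 'I_n) (s t : R) (x : 'rV[R]_n) :
  rV_cons (t, s *: delta_mx 0 j + x) = s *: delta_mx 0 (lift ord0 j) + rV_cons (t, x).
Proof.
apply/rowP => i; rewrite [RHS]line_coord; have [k ->|->] := unliftP ord0 i.
  by rewrite !rV_consS /= line_coord (inj_eq lift_inj).
by rewrite !rV_cons0 (negbTE (neq_lift _ _)) mulr0 add0r.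
Qed.

(** Induction on the dimension. A derivative in the first coordinate is integrated along that
    coordinate first, where the fundamental theorem gives 0; for any other coordinate the first one
    is frozen and the induction hypothesis applies on each slice. *)
Lemma integral_partial0 n (i : 'I_n) (g h : 'rV[R]_n -> R) (M : R) : 0 < M ->
  continuous h -> (forall x, is_derive x (delta_mx 0 i) g (h x)) ->
  (forall x, ~ cube M x -> g x = 0 /\ h x = 0) ->
  (\int[lebesgue_rV R n]_x (h x)%:E = 0)%E.
Proof.
move=> M0; elim: n i g h => [[]//|n IH] i g h ch dg gh0.
have hi := cube_lebesgue ch (fun x hx => proj2 (gh0 x hx)).
have [ch1 ch2] := continuous_rV_cons ch.
have cubeS t (x : 'rV[R]_n) : cube M (rV_cons (t, x)) -> (- M <= t <= M) /\ cube M x.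
  move=> c; split.
    by have := c ord0; rewrite rV_cons0 /= in_itv.
  by move=> j; have := c (lift ord0 j); rewrite rV_consS.
have [j ei|ei] := unliftP ord0 i; rewrite {}ei in dg.
- rewrite (fubini_rV1 hi); apply: integral0_eq => t _ /=.
  apply: (IH j (fun x => g (rV_cons (t, x)))) => //.
  + move=> x; apply/is_derive_line.
    have /is_derive_line := dg (rV_cons (t, x)).
    by apply: dv_on; [exact: filterT|move=> s _; rewrite rV_cons_lineS].
  + by move=> x cx; apply: gh0 => /cubeS[].
- rewrite (fubini_rV2 hi); apply: integral0_eq => x _ /=.
  apply: (integral_line0 (k := fun t => g (rV_cons (t, x))) M0) => //.
  + move=> t; have d : is_derive (t *: delta_mx 0 ord0 + rV_cons (0, x)) (delta_mx 0 ord0) g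
        (h (rV_cons (t, x))).
      by rewrite -rV_cons_line0 addr0.
    have := derivable_line d.
    by apply: dv_on; [exact: filterT|move=> s _; rewrite -rV_cons_line0 addr0].
  + by move=> t ct; apply: gh0 => /cubeS[].
Qed.

End divergence_theorem.

(** * Classical derivatives as weak derivatives *)

Section weak_gradient.
Context (R : realType) (N : nat).
Implicit Types (u phi : 'rV[R]_N -> R) (x : 'rV[R]_N).

Lemma coord_le_norm x i : `|x 0 i| <= `|x|.
Proof.
rewrite [leRHS]/Num.norm/= mx_normrE.
by apply: le_trans (le_bigmax _ (fun ij => `|x ij.1 ij.2|) (0, i)).
Qed.

Lemma test_function_support phi : test_function phi ->
  exists2 M : R, 0 < M & forall x, ~ cube M x ->
    phi x = 0 /\ forall i, partial i phi x = 0.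
Proof.
move=> [phiC supp]; have [B [_ hB]] := compact_bounded supp.
have n0 := normr_ge0 B; exists (`|B| + 1); first by lra.
have BM : B < `|B| + 1 by have := ler_norm B; lra.
move=> x xM; have xS : ~ closure [set x | phi x != 0] x.
  move=> xS; apply: xM => i; have := hB _ BM x xS.
  by rewrite /= in_itv /= -ler_norml; apply: le_trans; exact: coord_le_norm.
have near0 : \forall y \near x, phi y = 0.
  have oc : open (~` closure [set x | phi x != 0]) by exact/closed_openC/closed_closure.
  apply: filterS (open_nbhs_nbhs (conj oc xS)) => y yS.
  by apply/eqP; apply: contrapT => /negP h; apply: yS; exact: subset_closure.
split; first exact: nbhs_singleton near0.
move=> i; rewrite /partial -(derive_cst (0 : R) x (delta_mx 0 i)).
by apply: near_eq_derive; near=> y; near: y.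
Unshelve. all: by end_near. Qed.

(** The integral of [partial i (u * phi)] vanishes because the product is supported in a cube; the
    product rule splits it into the two sides. *)
Lemma classical_weak_gradient u : continuous u ->
  (forall x i, derivable u x (delta_mx 0 i)) -> (forall i, continuous (partial i u)) ->
  weak_gradient u (grad u).
Proof.
move=> cu du cdu phi tphi i; have [M M0 hM] := test_function_support tphi.
have [phiC _] := tphi; have [cphi /(_ i)[dphi cdphi]] := phiC 1%N.
have c1 : continuous (fun x => u x * partial i phi x).
  by move=> x; exact: (continuousM (cu x) (cdphi x)).
have c2 : continuous (fun x => partial i u x * phi x).
  by move=> x; exact: (continuousM (cdu i x) (cphi x)).
have s1 x : ~ cube M x -> u x * partial i phi x = 0.
  by move=> /hM[_ ->]; rewrite mulr0.
have s2 x : ~ cube M x -> partial i u x * phi x = 0.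
  by move=> /hM[-> _]; rewrite mulr0.
have i1 := cube_lebesgue c1 s1; have i2 := cube_lebesgue c2 s2.
have := @integral_partial0 R N i (fun x => u x * phi x)
  (fun x => u x * partial i phi x + partial i u x * phi x) M M0.
have -> : (fun x => grad u x 0 i * phi x) = (fun x => partial i u x * phi x).
  by apply/funext => x; rewrite mxE.
move=> h; apply/eqP; rewrite -addr_eq0 -RintegralD//; apply/eqP.
rewrite /Rintegral (_ : (\int[_]_x _)%E = 0%E)//; apply: h.
- by move=> x; exact: (continuousD (c1 x) (c2 x)).
- move=> x; have d1 := derivableP (du x i); have d2 := derivableP (dphi x).
  move: d1 d2 => /is_derive_line d1 /is_derive_line d2; apply/is_derive_line.
  apply: (dv_eq (dvM d1 d2)); rewrite !scale0r !add0r /partial; ring.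
- by move=> x xM; rewrite s1// s2// addr0 (proj1 (hM x xM)) mulr0.
Qed.

End weak_gradient.

(** * Integrability from exponential decay *)

Section integrability.
Context (R : realType).

Lemma continuous_sumr (T : topologicalType) (I : Type) (r : seq I) (F : I -> T -> R) :
  (forall i, continuous (F i)) -> continuous (fun x => \sum_(i <- r) F i x).
Proof.
move=> cF; elim: r => [|i r IH].
  rewrite (_ : (fun x => _) = cst 0); first exact: cst_continuous.
  by apply/funext => x; rewrite big_nil.
rewrite (_ : (fun x => _) = (fun x => F i x + \sum_(j <- r) F j x)).
  by move=> x; exact: (continuousD (cF i x) (IH x)).
by apply/funext => x; rewrite big_cons.
Qed.

Lemma continuous_comp1 (T : topologicalType) (f : R -> R) (g : T -> R) :
  continuous g -> (forall x, cat f (g x)) -> continuous (fun x => f (g x)).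
Proof. by move=> cg cf x; exact: (continuous_comp (cg x) (catE (cf x))). Qed.

Lemma continuous_coord n (i : 'I_n) : continuous (fun x : 'rV[R]_n => x 0 i).
Proof. exact: coord_continuous. Qed.

Lemma continuous_enorm n : continuous (@enorm R n).
Proof.
apply: (@continuous_comp1 _ Num.sqrt (fun x : 'rV[R]_n => \sum_(i < n) x 0 i ^+ 2)).
  apply: continuous_sumr => i.
  apply: (@continuous_comp1 _ (fun t : R => t ^+ 2)); first exact: continuous_coord.
  by move=> x; exact: catX (cat_id _).
by move=> x; apply: (cat_sqrt (f := id)); exact: cat_id.
Qed.

Lemma enorm_ge0 n (x : 'rV[R]_n) : 0 <= enorm x. Proof. exact: sqrtr_ge0. Qed.

Lemma enorm_sqr n (x : 'rV[R]_n) : enorm x ^+ 2 = \sum_(i < n) x 0 i ^+ 2.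
Proof. by rewrite sqr_sqrtr//; apply: sumr_ge0 => i _; exact: sqr_ge0. Qed.

Lemma coord_le_enorm n (x : 'rV[R]_n) i : `|x 0 i| <= enorm x.
Proof.
rewrite -(@ler_pXn2r _ 2)// ?nnegrE ?enorm_ge0// enorm_sqr real_normK ?num_real//.
by rewrite (bigD1 i)//= lerDl; apply: sumr_ge0 => j _; exact: sqr_ge0.
Qed.

Lemma sum_coord_le_enorm n (x : 'rV[R]_n) : \sum_(i < n) `|x 0 i| <= n%:R * enorm x.
Proof.
apply: (@le_trans _ _ (\sum_(i < n) enorm x)).
  by apply: ler_sum => i _; exact: coord_le_enorm.
by rewrite sumr_const card_ord mulr_natl.
Qed.

(** By symmetry it suffices to integrate over the half-line, where the integrand is [1 / c] times
    the density of the exponential law. *)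
Lemma integral_expR_lty (c : R) : 0 < c ->
  (\int[@lebesgue_measure R]_t (expR (- (c * `|t|)))%:E < +oo)%E.
Proof.
move=> c0; rewrite ge0_symfun_integralT; first last.
- by move=> t /=; rewrite normrN.
- by move=> t; apply: catE; apply: cat_comp; [exact: cat_expR|]; apply: catN; apply: catM;
    [exact: cat_cst|apply: cat_norm; exact: cat_id].
- by move=> t; exact: expR_ge0.
rewrite -set_itvcy (_ : (\int[_]_(x in _) _)%E =
  (\int[@lebesgue_measure R]_(t in `[0%R, +oo[) ((c^-1)%:E * (exponential_pdf c t)%:E))%E); last first.
  apply: eq_integral => t; rewrite inE /= in_itv /= andbT => t0.
  rewrite -EFinM /exponential_pdf patchE mem_set/= ?in_itv/= ?andbT//.
  by rewrite mulKf ?gt_eqF// (ger0_norm t0) mulNr.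
have i1 : (@lebesgue_measure R).-integrable `[0, +oo[ (EFin \o exponential_pdf c).
  by apply: integrableS (integrable_exponential_pdf c0).
apply: lte_mul_pinfty => //; apply: integrable_lty => //.
exact: (integrableZl _ _ i1).
Qed.

Lemma measurable_EFin_rV n (h : 'rV[R]_n -> R) : continuous h ->
  measurable_fun setT (fun x : 'rV[R]_n => (h x)%:E).
Proof. by move=> ch; apply/measurable_EFinP; exact: continuous_measurable_rV. Qed.

(** A majorant that factorizes over the coordinates, so that Tonelli's theorem reduces its integral
    to dimension one. *)
Let esum n (c : R) (x : 'rV[R]_n) := expR (- (c * \sum_(i < n) `|x 0 i|)).

Let continuous_esum n c : continuous (@esum n c).
Proof.
apply: (@continuous_comp1 _ (fun t => expR (- (c * t))) (fun x : 'rV[R]_n => \sum_(i < n) `|x 0 i|)).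
  apply: continuous_sumr => i; apply: (@continuous_comp1 _ (fun t : R => `|t|)).
    exact: continuous_coord.
  by move=> x; exact: cat_norm (cat_id _).
by move=> x; catt.
Qed.

Lemma integral_expR_sum_lty n (c : R) : 0 < c ->
  (\int[lebesgue_rV R n]_x (esum c x)%:E < +oo)%E.
Proof.
move=> c0; elim: n => [|n IH].
  have mE : measurable_fun setT (fun x : 'rV[R]_0 => (esum c x : R)%:E : \bar R).
    exact: measurable_EFin_rV (@continuous_esum 0 c).
  rewrite [X in (X < _)%E](integral_dirac _ _ mE)//.
  by rewrite diracE mem_set// mul1e ltry.
rewrite tonelli_rV; first last.
- by move=> x; rewrite lee_fin expR_ge0.
- exact: measurable_EFin_rV (@continuous_esum _ c).
have mI : measurable_fun setT (fun x : 'rV[R]_n => (esum c x)%:E).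
  exact: measurable_EFin_rV (@continuous_esum n c).
have I0 : (0 <= \int[lebesgue_rV R n]_x (esum c x)%:E)%E.
  by apply: integral_ge0 => x _; rewrite lee_fin expR_ge0.
rewrite (_ : (\int[_]_t _)%E = (\int[@lebesgue_measure R]_t
  ((\int[lebesgue_rV R n]_x (esum c x)%:E) * (expR (- (c * `|t|)))%:E))%E); last first.
  apply: eq_integral => t _; rewrite muleC -ge0_integralZl//; [|by move=> x _; rewrite lee_fin expR_ge0].
  apply: eq_integral => x _; rewrite -EFinM /esum big_ord_recl rV_cons0 /=.
  rewrite mulrDr opprD expRD; congr (_ * expR (- (c * _)))%:E.
  by apply: eq_bigr => i _; rewrite rV_consS.
rewrite ge0_integralZl//; last first.
- have ce : continuous (fun t : R => expR (- (c * `|t|))).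
    move=> t; apply: catE; apply: (cat_comp (f := expR)); first exact: cat_expR.
    by apply: catN; apply: catM; [exact: cat_cst|apply: cat_norm; exact: cat_id].
  by apply/measurable_EFinP; exact: (continuous_measurable_fun ce).
by apply: lte_mul_pinfty => //; [rewrite ge0_fin_numE|exact: integral_expR_lty].
Qed.

Lemma integral_bound_lty n (f : 'rV[R]_n -> R) (C c : R) : 0 <= C -> 0 < c -> continuous f ->
  (forall x, 0 <= f x <= C * expR (- (c * enorm x))) ->
  (\int[lebesgue_rV R n]_x (f x)%:E < +oo)%E.
Proof.
(* The sum of the [|x_i|] is at most [n * enorm x]; dividing by [n.+1] rather than [n] also covers
   dimension 0. *)
move=> C0 c0 cf hf; pose d := c / n.+1%:R; have d0 : 0 < d by rewrite divr_gt0.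
apply: (@le_lt_trans _ _ (\int[lebesgue_rV R n]_x (C%:E * (esum d x)%:E))%E).
  apply: ge0_le_integral => //.
  - by move=> x _; rewrite lee_fin; case/andP: (hf x).
  - exact: (measurable_EFin_rV cf).
  - apply/measurable_EFinP; apply: measurable_funM => //.
    exact: (continuous_measurable_rV (@continuous_esum n d)).
  - move=> x _; rewrite -EFinM lee_fin; have /andP[_ h] := hf x; apply: le_trans h _.
    apply: ler_wpM2l => //; rewrite ler_expR lerN2 /d mulrAC ler_pdivrMr// mulrAC -mulrA.
    rewrite ler_pM2l//; apply: le_trans (sum_coord_le_enorm x) _.
    by rewrite ler_wpM2r ?enorm_ge0// ler_nat.
rewrite ge0_integralZl//.
- by apply: lte_mul_pinfty => //; exact: integral_expR_sum_lty.
- exact: measurable_EFin_rV (@continuous_esum n d).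
- by move=> x _; rewrite lee_fin expR_ge0.
Qed.

Lemma Lfun2_of_bound n (f : 'rV[R]_n -> R) (C c : R) : 0 <= C -> 0 < c -> continuous f ->
  (forall x, `|f x| <= C * expR (- (c * enorm x))) -> f \in Lfun (lebesgue_rV R n) 2%:E.
Proof.
move=> C0 c0 cf hf; rewrite inE; apply/andP; split; rewrite inE/=.
  exact: continuous_measurable_rV.
rewrite /finite_norm unlock; apply: poweR_lty.
rewrite (eq_integral (fun x => (f x ^+ 2)%:E)); last first.
  by move=> x _; rewrite /= powR_mulrn// real_normK ?num_real.
have c20 : 0 < 2 * c by rewrite mulr_gt0.
apply: (integral_bound_lty (sqr_ge0 C) c20).
  by move=> x; exact: (continuousM (cf x) (cf x)).
move=> x; rewrite sqr_ge0/= -[f x ^+ 2]real_normK ?num_real//.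
have -> : - (2 * c * enorm x) = - (c * enorm x) + - (c * enorm x) by ring.
rewrite expRD -expr2 -exprMn.
by rewrite ler_pXn2r// nnegrE mulr_ge0// expR_ge0.
Qed.

Lemma Lfun1_of_bound n (f : 'rV[R]_n -> R) (C c : R) : 0 <= C -> 0 < c -> continuous f ->
  (forall x, `|f x| <= C * expR (- (c * enorm x))) -> f \in Lfun (lebesgue_rV R n) 1%:E.
Proof.
move=> C0 c0 cf hf; apply/Lfun1_integrable/integrableP; split.
  exact: (measurable_EFin_rV cf).
apply: (integral_bound_lty C0 c0 (f := fun x => `|f x|)).
  by apply: (@continuous_comp1 _ (fun t : R => `|t|)) => // x; exact: cat_norm (cat_id _).
by move=> x; rewrite normr_ge0 hf.
Qed.

End integrability.

(** * Decay of square-integrable functions with a Lipschitz profile *)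

Section decay.
Context (R : realType) (n : nat).
Local Notation mu := (lebesgue_rV R n.+1).

Let box (c : 'rV[R]_n.+1) (eta : R) : set 'rV[R]_n.+1 :=
  rV_box (fun i => `[c 0 i - eta, c 0 i + eta]%classic).

Let box_measure c (eta : R) : 0 <= eta -> mu (box c eta) = ((2 * eta) ^+ n.+1)%:E.
Proof.
move=> eta0; rewrite lebesgue_rV_box; last by move=> i; exact: measurable_itv.
rewrite (eq_bigr (fun=> (2 * eta)%:E)); last first.
  move=> i _; rewrite lebesgue_measure_itv/= lte_fin.
  case: ifP => [_|]; first by rewrite -EFinD; congr (_%:E); ring.
  move=> /negbT; rewrite -leNgt => h; congr (_%:E); lra.
elim: n.+1 => [|k IH]; first by rewrite big_ord0 expr0.
by rewrite big_ord_recl IH exprS EFinM.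
Qed.

(** The set [S] where [|v| >= e / 2] has finite measure by Chebyshev's inequality, so its parts
    [T k] in the half-spaces [x_0 >= k] have measure tending to 0. If the profile reached [e] at
    arbitrarily large radii, each [T k] would contain a box of fixed size. *)
Lemma Lfun2_profile_lim (v : 'rV[R]_n.+1 -> R) (x0 : 'rV[R]_n.+1) (phi : R -> R) (L : R) :
  v \in Lfun mu 2%:E -> (forall x, v x = phi (enorm (x - x0))) -> 0 < L ->
  (forall r s : R, 0 <= r -> 0 <= s -> `|phi r - phi s| <= L * `|r - s|) ->
  forall e : R, 0 < e -> exists r0 : R, forall r : R, r0 <= r -> phi r < e.
Proof.
move=> v2 vphi L0 lip e e0; apply: contrapT => nlim.
have {}nlim r0 : exists2 r : R, r0 <= r & e <= phi r.
  apply: contrapT => h; apply: nlim; exists r0 => r r0r; rewrite ltNge.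
  by apply/negP => er; apply: h; exists r.
have vi := Lfun2_integrable_sqr v2.
have [mv vlt] := integrableP _ _ _ vi.
pose a := (e / 2) ^+ 2; have a0 : 0 < a by apply: exprn_gt0; lra.
pose S : set 'rV[R]_n.+1 := [set: 'rV[R]_n.+1] `&` [set x | (a%:E <= `|(v x ^+ 2)%:E|)%E].
have mS : measurable S.
  by apply: emeasurable_fun_c_infty => //; exact: measurableT_comp.
have Slt : (mu S < +oo)%E.
  have : (a%:E * mu S <= \int[mu]_x `|(v x ^+ 2)%:E|)%E.
    exact: (@le_integral_comp_abse _ _ _ mu setT measurableT (fun x => (v x ^+ 2)%:E) a id).
  move=> /le_lt_trans -/(_ _ vlt) h.
  have : (0 <= mu S)%E by []; move: h; rewrite -/S; case: (mu S) => [s _ _|+ _|//].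
    exact: ltry.
  by rewrite gt0_muley ?lte_fin.
pose T (k : nat) := S `&` [set x : 'rV[R]_n.+1 | k%:R <= x 0 ord0].
have mT k : measurable (T k).
  apply: measurableI => //; rewrite -[X in measurable X]setTI.
  have -> : [set x : 'rV[R]_n.+1 | k%:R <= x 0 ord0] =
    (fun x : 'rV[R]_n.+1 => x 0 ord0) @^-1` `[k%:R, +oo[%classic.
    by apply/seteqP; split => x /=; rewrite in_itv/= andbT.
  exact: measurable_coord.
have capT : \bigcap_k T k = set0.
  apply/seteqP; split => // x Tx; have [_ /=] := Tx (Num.truncn `|x 0 ord0|).+1 I.
  rewrite leNgt => /negP; apply; apply: le_lt_trans (truncnS_gt _); exact: ler_norm.
have lim0 : mu \o T @ \oo --> 0%E.
  rewrite -(measure0 mu) -capT; apply: nonincreasing_cvg_mu => //.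
  - apply: le_lt_trans Slt; apply: le_measure; rewrite ?inE//.
    by move=> x [].
  - by rewrite capT; exact: measurable0.
  - move=> k l kl; apply/subsetPset => x [Sx /= lx]; split => //=.
    by apply: le_trans lx; rewrite ler_nat.
(* In a box of half-width [eta] around a point at distance [r] from [x0] on the first axis, the
   distance to [x0] differs from [r] by at most [eta * (n + 1)], and over that length the profile
   varies by at most [e / 2]. *)
pose eta := e / (2 * L) / n.+1%:R.
have eta0 : 0 < eta by do 2! apply: divr_gt0 => //; exact: mulr_gt0.
have Leta : L * (eta * n.+1%:R) = e / 2.
  by rewrite /eta; field; rewrite !gt_eqF//= nat1r.
have big k : (((2 * eta) ^+ n.+1)%:E <= mu (T k))%E.
  (* The first bound puts the box inside [x_0 >= k], the second keeps [r - eta] nonnegative. *)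
  have [r] := nlim (Num.max (k%:R - x0 0 ord0 + eta) eta).
  rewrite ge_max => /andP[rk re] er; have r0 : 0 <= r by lra.
  rewrite -(box_measure (r *: delta_mx 0 ord0 + x0) (ltW eta0)).
  apply: le_measure; rewrite ?inE.
  - by apply: measurable_rV_box => i; exact: measurable_itv.
  - exact: mT.
  move=> x bx.
  have b0 : r - eta <= (x - x0) 0 ord0 <= r + eta.
    have := bx ord0; rewrite /= in_itv/= line_coord eqxx mulr1 !mxE.
    by move=> /andP[? ?]; apply/andP; split; lra.
  have bS i : `|(x - x0) 0 (lift ord0 i)| <= eta.
    have := bx (lift ord0 i); rewrite /= in_itv/= line_coord eq_sym (negbTE (neq_lift _ _)).
    by rewrite mulr0 add0r !mxE ler_norml => /andP[? ?]; apply/andP; split; lra.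
  have y1 : r - eta <= enorm (x - x0).
    apply: le_trans (coord_le_enorm _ ord0); apply: le_trans (ler_norm _).
    by case/andP: b0.
  have y2 : enorm (x - x0) <= r + eta * n.+1%:R.
    rewrite -(@ler_pXn2r _ 2)// ?nnegrE ?enorm_ge0//; last first.
      by apply: addr_ge0 => //; apply: mulr_ge0 => //; exact: ltW.
    rewrite enorm_sqr big_ord_recl.
    have : \sum_(i < n) (x - x0) 0 (lift ord0 i) ^+ 2 <= n%:R * eta ^+ 2.
      apply: (@le_trans _ _ (\sum_(i < n) eta ^+ 2)); last first.
        by rewrite sumr_const card_ord mulr_natl.
      apply: ler_sum => i _; rewrite -[X in X <= _]real_normK ?num_real//.
      by rewrite ler_pXn2r// ?nnegrE// ltW.
    have : (x - x0) 0 ord0 ^+ 2 <= (r + eta) ^+ 2.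
      by case/andP: b0 => ? ?; rewrite ler_pXn2r// nnegrE; lra.
    have nn : (0 : R) <= n%:R by [].
    have t1 : 0 <= r * (n%:R * eta) by apply: mulr_ge0 => //; apply: mulr_ge0 => //; exact: ltW.
    have t2 : 0 <= n%:R * eta ^+ 2 by apply: mulr_ge0 => //; exact: sqr_ge0.
    by have := sqr_ge0 (n%:R * eta); rewrite -natr1; lra.
  have vx : e / 2 <= v x.
    rewrite vphi; have := lip (enorm (x - x0)) r (enorm_ge0 _) r0.
    have d : `|enorm (x - x0) - r| <= eta * n.+1%:R.
      have : eta <= eta * n.+1%:R by rewrite ler_peMr ?ler1n// ltW.
      by rewrite ler_norml => ?; apply/andP; split; lra.
    have := ler_wpM2l (ltW L0) d; rewrite Leta ler_norml => h1 /andP[h2 _]; lra.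
  split => /=.
    split => //=; rewrite lee_fin ger0_norm ?sqr_ge0// ler_pXn2r ?nnegrE//; lra.
  by case/andP: b0; rewrite !mxE; lra.
have c0 : 0 < (2 * eta) ^+ n.+1 by apply: exprn_gt0; exact: mulr_gt0.
have : (((2 * eta) ^+ n.+1)%:E <= 0)%E by apply: (cvge_to_ge lim0); exact: nearW.
by rewrite lee_fin; lra.
Qed.

End decay.

(** * Radial functions on R^N *)

Section radial.
Context (R : realType) (N : nat).
Implicit Types (x y : 'rV[R]_N) (i j : 'I_N) (f g : R -> R).

Local Notation e_ i := (delta_mx 0 i : 'rV[R]_N).

Lemma enorm_line x i (t : R) :
  enorm (t *: e_ i + x) ^+ 2 = enorm x ^+ 2 + 2 * t * x 0 i + t ^+ 2.
Proof.
rewrite !enorm_sqr (bigD1 i)//= [in RHS](bigD1 i)//= line_coord eqxx mulr1.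
rewrite (eq_bigr (fun j => x 0 j ^+ 2)); last first.
  by move=> j /negbTE ji; rewrite line_coord ji mulr0 add0r.
by ring.
Qed.

Lemma enorm0 : enorm (0 : 'rV[R]_N) = 0.
Proof. by rewrite /enorm big1 ?sqrtr0// => i _; rewrite mxE expr0n. Qed.

Lemma enorm_eq0 x : enorm x = 0 -> x = 0.
Proof.
move=> x0; apply/rowP => i; have := coord_le_enorm x i.
by rewrite x0 normr_le0 mxE => /eqP.
Qed.

Lemma enorm_line0 i (t : R) : enorm (t *: e_ i) = `|t|.
Proof.
apply/eqP; rewrite -(@eqrXn2 _ 2)// ?enorm_ge0// real_normK ?num_real//.
by rewrite -[_ *: _]addr0 enorm_line enorm0 mxE; apply/eqP; ring.
Qed.

Lemma enormZ (c : R) x : enorm (c *: x) = `|c| * enorm x.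
Proof.
apply/eqP; rewrite -(@eqrXn2 _ 2)// ?enorm_ge0 ?mulr_ge0 ?enorm_ge0//.
rewrite exprMn real_normK ?num_real// !enorm_sqr mulr_sumr; apply/eqP/eq_bigr => i _.
by rewrite mxE exprMn.
Qed.

Lemma dv_enorm_line x i : 0 < enorm x ->
  dv (fun t : R => enorm (t *: e_ i + x)) (0 : R) (x 0 i / enorm x).
Proof.
move=> x0; pose q (t : R) := enorm x ^+ 2 + 2 * t * x 0 i + t ^+ 2.
have q0 : q 0 = enorm x ^+ 2 by rewrite /q; ring.
have qp : 0 < q 0 by rewrite q0 exprn_gt0.
have dq : dv q (0 : R) (2 * x 0 i) by rewrite /q; der => /=; ring.
apply: (dv_on (f := fun t => Num.sqrt (q t)) (P := fun=> True)); first exact: filterT.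
  by move=> t _; rewrite /q -enorm_line sqrtr_sqr ger0_norm// enorm_ge0.
apply: (dv_eq (dv_sqrt qp dq)); rewrite q0 sqrtr_sqr gtr0_norm//.
by field; rewrite gt_eqF.
Qed.

Lemma is_derive_radial f x i (l : R) : 0 < enorm x -> dv f (enorm x) l ->
  is_derive x (e_ i) (fun y => f (enorm y)) (l * (x 0 i / enorm x)).
Proof.
move=> x0 df; apply/is_derive_line.
apply: (dv_comp (f := f)); last exact: dv_enorm_line.
by rewrite scale0r add0r.
Qed.

Lemma is_derive_radial0 f i (l : R) : dv (fun t : R => f `|t|) (0 : R) l ->
  is_derive (0 : 'rV[R]_N) (e_ i) (fun y => f (enorm y)) l.
Proof.
move=> df; apply/is_derive_line.
apply: dv_on df; first exact: filterT.
by move=> t _; rewrite addr0 enorm_line0.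
Qed.

Lemma dv_coord_line x i j : dv (fun t : R => (t *: e_ j + x) 0 i) (0 : R) (i == j)%:R.
Proof.
apply: (dv_on (f := fun t => t * (i == j)%:R + x 0 i) (P := fun=> True)); first exact: filterT.
  by move=> t _; rewrite line_coord.
by der; ring.
Qed.

Lemma dv_mul_id g : cat g 0 -> dv (fun t : R => t * g t) (0 : R) (g 0).
Proof.
move=> cg; apply/is_derive1_caratheodory; exists g; split => //; last exact: catE cg.
by move=> z; rewrite mul0r !subr0 mulrC.
Qed.

Lemma is_derive_field f x i j (l : R) : 0 < enorm x -> dv f (enorm x) l ->
  is_derive x (e_ j) (fun y => y 0 i * f (enorm y))
    ((i == j)%:R * f (enorm x) + x 0 i * (l * (x 0 j / enorm x))).
Proof.
move=> x0 df; apply/is_derive_line.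
have /is_derive_line d := is_derive_radial j x0 df.
apply: (dv_eq (dvM (dv_coord_line x i j) d)).
by rewrite scale0r add0r.
Qed.

Lemma is_derive_field0 f i j : cat f 0 ->
  is_derive (0 : 'rV[R]_N) (e_ j) (fun y => y 0 i * f (enorm y)) ((i == j)%:R * f 0).
Proof.
move=> cf; apply/is_derive_line.
have cg : cat (fun t : R => f `|t|) 0.
  by apply: (cat_comp (f := f)); [rewrite normr0|apply: cat_norm; exact: cat_id].
have d := dvM (dv_cst (i == j)%:R 0) (dv_mul_id cg).
apply: (dv_on (f := fun t : R => (i == j)%:R * (t * f `|t|)) (P := fun=> True)).
- exact: filterT.
- by move=> t _; rewrite line_coord addr0 enorm_line0 mxE addr0; ring.
- by apply: (dv_eq d); rewrite normr0; ring.
Qed.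

Lemma continuous_radial f : (forall r : R, 0 <= r -> cat f r) ->
  continuous (fun x => f (enorm x)).
Proof.
move=> cf; apply: continuous_comp1; first exact: continuous_enorm.
by move=> x; apply: cf; exact: enorm_ge0.
Qed.

(** The slope [r * g r] is of order [r], so the difference quotient of [f |t|] at 0 is bounded by a
    multiple of [|t|]: the even extension has no corner. *)
Lemma dv_even0 f g : (forall r : R, 0 <= r -> cat f r) -> (forall r : R, 0 <= r -> cat g r) ->
  (forall r : R, 0 < r -> dv f r (r * g r)) -> dv (fun t : R => f `|t|) (0 : R) 0.
Proof.
move=> cf cg df; have [c /= _ hc] := evt_max ler01 (f := fun r => `|g r|)
  (fun r hr => cat_norm (cg r (proj1 (andP hr)))).
apply/is_derive1_caratheodory; exists (fun t => (f `|t| - f 0) / t); split.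
- move=> t; rewrite normr0 subr0; have [->|t0] := eqVneq t 0.
    by rewrite normr0 subrr mulr0.
  by rewrite divfK.
- apply: catE; apply: (@lipschitz_cat _ _ _ `|g c|) => t; rewrite subr0 => t1.
  rewrite invr0 mulr0 subr0; have [->|t0] := eqVneq t 0.
    by rewrite normr0 invr0 !mulr0 normr0.
  have nt : 0 < `|t| by rewrite normr_gt0.
  have [s /andP[s0 st] e] := mvt nt (fun r hr => cf r (proj1 (andP hr)))
    (fun r hr => df r (proj1 (andP hr))).
  rewrite e subr0 normrM normrM normr_id normfV mulfK ?gt_eqF// normrM mulrC (gtr0_norm s0).
  apply: ler_pM => //; [exact: ltW| |exact: ltW].
  by apply: hc; rewrite (ltW s0)/=; lra.
- by rewrite invr0 mulr0.
Qed.

Section C2.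
Context (phi A C : R -> R).
Context (cphi : forall r : R, 0 <= r -> cat phi r) (cA : forall r : R, 0 <= r -> cat A r).
Context (cC : forall r : R, 0 <= r -> cat C r) (C0 : C 0 = 0).
Context (dphi : forall r : R, 0 < r -> dv phi r (- (r * A r))).
Context (dA : forall r : R, 0 < r -> dv A r (C r / r)).

Let u x := phi (enorm x).

Lemma is_derive_radialC1 x i : is_derive x (e_ i) u (- (x 0 i * A (enorm x))).
Proof.
have [x0|] := ltP 0 (enorm x).
  have d := is_derive_radial i x0 (dphi x0).
  suff -> : - (x 0 i * A (enorm x)) = - (enorm x * A (enorm x)) * (x 0 i / enorm x) by [].
  by field; rewrite gt_eqF.
rewrite le_eqVlt ltNge enorm_ge0 orbF => /eqP/enorm_eq0 ->.
rewrite mxE mul0r oppr0; apply: is_derive_radial0.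
apply: (@dv_even0 phi (fun r => - A r)) => // r r0; first exact: catN (cA r0).
by rewrite mulrN; exact: dphi.
Qed.

Lemma partial_radial i : partial i u = fun x => - (x 0 i * A (enorm x)).
Proof. by apply/funext => x; case: (is_derive_radialC1 x i). Qed.

Lemma is_derive_radialC2 x i j : is_derive x (e_ j) (fun y => - (y 0 i * A (enorm y)))
  (- ((i == j)%:R * A (enorm x) + x 0 i * x 0 j * C (enorm x) / enorm x ^+ 2)).
Proof.
suff d : is_derive x (e_ j) (fun y => y 0 i * A (enorm y))
    ((i == j)%:R * A (enorm x) + x 0 i * x 0 j * C (enorm x) / enorm x ^+ 2).
  exact: is_deriveN d.
have [x0|] := ltP 0 (enorm x).
  have d := is_derive_field i j x0 (dA x0).
  suff -> : x 0 i * x 0 j * C (enorm x) / enorm x ^+ 2 =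
    x 0 i * (C (enorm x) / enorm x * (x 0 j / enorm x)) by [].
  by field; rewrite gt_eqF.
rewrite le_eqVlt ltNge enorm_ge0 orbF => /eqP/enorm_eq0 ->.
rewrite enorm0 mxE !mul0r addr0.
exact: is_derive_field0 (cA (lexx 0)).
Qed.

Lemma continuous_hessian i j :
  continuous (fun x => x 0 i * x 0 j * C (enorm x) / enorm x ^+ 2).
Proof.
have cCe := continuous_radial cC.
have cc := @continuous_coord R N.
suff h (x : 'rV[R]_N) : (fun x : 'rV[R]_N => x 0 i * x 0 j * C (enorm x) / enorm x ^+ 2) @ x -->
    x 0 i * x 0 j * C (enorm x) / enorm x ^+ 2 by exact: h.
have [x0|] := ltP 0 (enorm x).
  have cn : {for x, continuous (fun y : 'rV[R]_N => (enorm y ^+ 2)^-1)}.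
    have c2 : cat (fun r : R => (r ^+ 2)^-1) (enorm x).
      by apply: catV; [rewrite gt_eqF// exprn_gt0|apply: catX; exact: cat_id].
    exact: (continuous_comp (@continuous_enorm R N x) (catE c2)).
  exact: (continuousM (continuousM (continuousM (cc i x) (cc j x)) (cCe x)) cn).
rewrite le_eqVlt ltNge enorm_ge0 orbF => /eqP/enorm_eq0 ->.
have F0 : Filter (nbhs (0 : 'rV[R]_N)) by exact: nbhs_filter.
apply/cvgrPdist_lt => e e0.
have : (fun x : 'rV[R]_N => C (enorm x)) @ (0 : 'rV[R]_N) --> C (enorm (0 : 'rV[R]_N)).
  exact: cCe.
move=> /cvgrPdist_lt /(_ e e0).
rewrite enorm0 C0; apply: filterS => y; apply: le_lt_trans.
rewrite !(mxE, mul0r) !sub0r !normrN.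
have [y0|] := ltP 0 (enorm y); last first.
  rewrite le_eqVlt ltNge enorm_ge0 orbF => /eqP/enorm_eq0 ->.
  by rewrite !mxE !mul0r normr0.
rewrite !normrM normfV ler_pdivrMr ?normr_gt0 ?gt_eqF ?exprn_gt0//.
rewrite [leRHS]mulrC (ger0_norm (sqr_ge0 _)) expr2; apply: ler_wpM2r => //.
by apply: ler_pM => //; exact: coord_le_enorm.
Qed.

(** With [phi' = - r A] and [r A' = C], the second partial derivatives are
    [- (delta_ij A + x_i x_j C / r ^ 2)]. They are continuous at the origin because
    [x_i x_j / r ^ 2] is bounded and [C] vanishes there. *)
Lemma Ck2_radial : Ck 2 u.
Proof.
have c0 := continuous_radial cphi; have c1 := continuous_radial cA.
have cc := @continuous_coord R N.
split => // i; split; first by move=> x; have [] := is_derive_radialC1 x i.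
rewrite partial_radial; split.
  by move=> x; exact: (continuousN (continuousM (cc i x) (c1 x))).
move=> j; split; first by move=> x; have [] := is_derive_radialC2 x i j.
rewrite (_ : partial j _ = fun x =>
  - ((i == j)%:R * A (enorm x) + x 0 i * x 0 j * C (enorm x) / enorm x ^+ 2)).
  have ch := @continuous_hessian i j.
  have cdA : continuous (fun x => (i == j)%:R * A (enorm x)).
    by apply: (continuous_radial (f := fun r => (i == j)%:R * A r)) => r r0; catt.
  by move=> x; exact: (continuousN (continuousD (cdA x) (ch x))).
by apply/funext => x; case: (is_derive_radialC2 x i j).
Qed.

End C2.

Lemma divergence_radial (D : R -> R) x (l : R) : 0 < enorm x -> dv D (enorm x) l ->
  divergence (fun y => - D (enorm y) *: y) x = - (N%:R * D (enorm x) + enorm x * l).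
Proof.
move=> x0 dD; rewrite /divergence.
rewrite (eq_bigr (fun i => - (D (enorm x) + l / enorm x * x 0 i ^+ 2))); last first.
  move=> i _; rewrite /partial.
  rewrite (_ : (fun y : 'rV[R]_N => _) = (fun y => - (y 0 i * D (enorm y)))); last first.
    by apply/funext => y; rewrite mxE; ring.
  have [_ ->] := is_deriveN (is_derive_field i i x0 dD).
  by rewrite eqxx mul1r; field; rewrite gt_eqF.
rewrite sumrN big_split/= -mulr_sumr -enorm_sqr sumr_const card_ord -[D _ *+ N]mulr_natl.
by congr (- (_ + _)); field; rewrite gt_eqF.
Qed.

Lemma divergence_radial0 (D : R -> R) : cat D 0 ->
  divergence (fun y => - D (enorm y) *: y) (0 : 'rV[R]_N) = - (N%:R * D 0).
Proof.
move=> cD; rewrite /divergence (eq_bigr (fun i => - D 0)); last first.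
  move=> i _; rewrite /partial.
  rewrite (_ : (fun y : 'rV[R]_N => _) = (fun y => - (y 0 i * D (enorm y)))); last first.
    by apply/funext => y; rewrite mxE; ring.
  have [_ ->] := is_deriveN (is_derive_field0 i i cD).
  by rewrite eqxx mul1r.
by rewrite sumr_const card_ord -[_ *+ N]mulr_natl mulrN.
Qed.

Lemma partial_shift (f : 'rV[R]_N -> R) i (c x : 'rV[R]_N) :
  partial i (fun y => f (y + c)) x = partial i f (x + c).
Proof.
have e : (fun h : R => h^-1 *: (((fun y => f (y + c)) \o shift x) (h *: e_ i) - f (x + c))) =
    (fun h : R => h^-1 *: ((f \o shift (x + c)) (h *: e_ i) - f (x + c))).
  by apply/funext => h /=; rewrite addrA.
by rewrite /partial /derive e.
Qed.

End radial.

(** * Radial solutions and ground states *)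

Section flux_quotient.
Context (R : realType) (f : R -> R) (n : nat) (w P : R -> R).
Context (cf : forall s : R, cat f s) (sol : radial_sol f n w P).
Implicit Types (r s t e : R).

(** [P / r], continued through 0 by its limit: for small [r] the flux is close to
    [f (w 0) * r ^ (n + 1) / (n + 1)]. *)
Definition flux_quotient r := if r <= 0 then f (w 0) / n.+1%:R else P r / r.

Lemma flux_quotientE r : 0 < r -> flux_quotient r = P r / r.
Proof. by rewrite /flux_quotient leNgt => ->. Qed.

Lemma flux_quotient0 : flux_quotient 0 = f (w 0) / n.+1%:R.
Proof. by rewrite /flux_quotient lexx. Qed.

(** Near 0 the flux is squeezed between those of the constant sources [f (w 0) - e] and
    [f (w 0) + e]; the sign [s] in the proof treats both sides at once. *)
Lemma flux_quotient_lt e : 0 < e -> exists2 d : R, 0 < d &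
  forall r, 0 < r -> r < d -> `|P r / r - f (w 0) / n.+1%:R| <= e / n.+1%:R.
Proof.
pose N : R := n.+1%:R; rewrite -/N => e0; have [cw cP P0 dw dP] := sol.
have cfw : cat (fun r => f (w r)) 0 by apply: cat_comp (cw 0); exact: cf.
have nN : n%:R = N - 1 by rewrite /N -natr1; ring.
have n0 : 0 < N by rewrite /N.
clearbody N.
have [d d0 hd] : exists2 d : R, 0 < d & forall r, - d < r < d -> `|f (w r) - f (w 0)| < e.
  have c1 : cat (fun r => `|f (w r) - f (w 0)|) 0.
    by apply: cat_norm; apply: catB => //; exact: cat_cst.
  have [|d d0 hd] := near_ball (cat_lt c1 (_ : _ < e)); first by rewrite subrr normr0.
  by exists d => // r hr; apply: hd; rewrite sub0r add0r.
exists d => // r r0 rd.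
have rn : 0 < r ^+ n by exact: exprn_gt0.
have key (s : R) : `|s| <= 1 -> 0 <= r ^+ n * r * (e + s * f (w 0)) / N - s * (r ^+ n * P r) ->
  s * (P r / r) <= (e + s * f (w 0)) / N.
  move=> _ h; rewrite -subr_ge0.
  have -> : (e + s * f (w 0)) / N - s * (P r / r) =
    (r ^+ n * r * (e + s * f (w 0)) / N - s * (r ^+ n * P r)) / (r ^+ n * r).
    by field; rewrite !gt_eqF.
  by apply: divr_ge0 => //; apply: mulr_ge0; exact: ltW.
have mono (s : R) : s = 1 \/ s = -1 ->
    0 <= r ^+ n * r * (e + s * f (w 0)) / N - s * (r ^+ n * P r).
  move=> hs.
  have := @ndecr _ (fun t => t ^+ n * t * (e + s * f (w 0)) / N - s * (t ^+ n * P t))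
    (fun t => t ^+ n * (e + s * f (w 0) - s * f (w t))) 0 r (ltW r0).
  rewrite P0 !(mulr0, mul0r, subr0); apply.
  - by move=> t _; catt.
  - move=> t /andP[t0 tr]; have d1 := @flux_deriv _ _ (fun t => f (w t)) _ _ t0 (dP t t0).
    have d2 := dv_expn n t0.
    by der; rewrite nN; field; rewrite !gt_eqF.
  - move=> t /andP[t0 tr]; apply: mulr_ge0; first by apply: exprn_ge0; exact: ltW.
    have /hd : - d < t < d by apply/andP; split; lra.
    by rewrite ltr_norml => /andP[h1 h2]; case: hs => ->; lra.
have h1 := key 1 _ (mono 1 (or_introl erefl)).
have h2 := key (-1) _ (mono (-1) (or_intror erefl)).
rewrite ler_norml; apply/andP; split.
- have := h2 _; rewrite normrN normr1 => /(_ (lexx _)).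
  by rewrite mulrDl; lra.
- by have := h1 _; rewrite normr1 => /(_ (lexx _)); rewrite mulrDl; lra.
Qed.

Lemma cat_flux_quotient r : 0 <= r -> cat flux_quotient r.
Proof.
have [cw cP P0 dw dP] := sol.
rewrite le_eqVlt => /predU1P[<-|r0]; last first.
  apply: (cat_near (f := fun t => P t / t)).
    by near=> t; rewrite flux_quotientE//; near: t; exact: near_gt.
  by apply: catM => //; apply: catV; [rewrite gt_eqF|exact: cat_id].
constructor; apply/cvgrPdist_le => e e0.
have n0 : (0 : R) < n.+1%:R by [].
have [d d0 hd] := flux_quotient_lt (mulr_gt0 e0 n0).
near=> t; rewrite flux_quotient0; have [t0|t0] := leP t 0.
  by rewrite /flux_quotient t0 subrr normr0 ltW.
rewrite flux_quotientE// distrC; apply: le_trans (hd t t0 _) _; last by rewrite mulfK ?gt_eqF.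
by near: t; exact: near_lt.
Unshelve. all: by end_near. Qed.

Lemma dv_flux_quotient r : 0 < r ->
  dv flux_quotient r ((f (w r) - n.+1%:R * flux_quotient r) / r).
Proof.
have [cw cP P0 dw dP] := sol; move=> r0.
apply: (dv_on (f := fun t => P t / t) (P := fun t => 0 < t)); first exact: near_gt.
  by move=> t t0; rewrite flux_quotientE.
have d := dP r r0; have rn : r != 0 by rewrite gt_eqF.
apply: (dv_eq (dv_div (f := P) (g := fun t => t) rn d (dv_id r))).
by rewrite flux_quotientE// -natr1; field.
Qed.

End flux_quotient.

(** * The partial differential equation for radial functions *)

Section pde.
Context (R : realType) (n : nat) (p m : R) (a g gu : R -> R).
Context (ag : forall s : R, 0 < s -> a s = g s ^+ 2) (g0 : forall s : R, 0 < s -> 0 < g s).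
Context (dg : forall s : R, 0 < s -> dv g s (gu s)).
Implicit Types (r s t : R).

Lemma derive1_sqr s : 0 < s -> derive1 a s = 2 * g s * gu s.
Proof.
move=> s0; have d : dv a s (2 * g s * gu s).
  apply: (dv_on (f := fun t => g t ^+ 2) (P := fun t => 0 < t)); first exact: near_gt.
    by move=> t /ag ->.
  by have d := dg s0; der => /=; ring.
by rewrite derive1E; case: d.
Qed.

Section radial_pde.
Context (V : 'rV[R]_n.+1 -> R) (phi A : R -> R).
Context (Vphi : forall y, V y = phi (enorm y)) (phi0 : forall r, 0 <= r -> 0 < phi r).
Context (dV : forall i y, partial i V y = - (y 0 i * A (enorm y))).

Let gradV y : grad V y = - A (enorm y) *: y.
Proof. by apply/rowP => i; rewrite !mxE dV; ring. Qed.

Let agradV : (fun y => a (V y) *: grad V y) =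
  (fun y => - (g (phi (enorm y)) ^+ 2 * A (enorm y)) *: y).
Proof.
apply/funext => y; rewrite gradV Vphi ag ?phi0 ?enorm_ge0// scalerA.
by congr (_ *: _); ring.
Qed.

Definition pde_at x := - divergence (fun y => a (V y) *: grad V y) x
        + 2^-1 * derive1 a (V x) * enorm (grad V x) ^+ 2 + m * V x = V x `^ p.

(** With [a = g ^ 2] and [P = - g phi'], differentiating [g ^ 2] in the divergence produces a
    quadratic gradient term of which [a' |Du| ^ 2 / 2] cancels exactly the part not contained in
    [P']. What remains is [g * (P' + n P / r)]. *)
Lemma pde_ode x (P : R -> R) (l : R) (r := enorm x) : 0 < r ->
  dv phi r (- (r * A r)) -> (forall s, 0 < s -> P s = g (phi s) * (s * A s)) -> dv P r l ->
  pde_at x <-> l = (phi r `^ p - m * phi r) / g (phi r) - n%:R * P r / r.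
Proof.
move=> r0 dphi PE dP; have ph := phi0 (ltW r0); have gp := g0 ph.
have d1 := dv_comp (dg ph) dphi.
have rn : r != 0 by rewrite gt_eqF.
have dD : dv (fun s => g (phi s) ^+ 2 * A s) r
    ((gu (phi r) * - (r * A r) * P r + g (phi r) * l) / r - g (phi r) * P r / r ^+ 2).
  apply: (dv_on (f := fun s => g (phi s) * P s / s) (P := fun s => 0 < s)); first exact: near_gt.
    by move=> s s0; rewrite PE//; field; rewrite gt_eqF.
  apply: (dv_eq (dv_div (f := fun s => g (phi s) * P s) (g := fun s => s) rn (dvM d1 dP) (dv_id r))).
  by field.
have Ar : A r = P r / (g (phi r) * r) by rewrite PE//; field; rewrite rn gt_eqF.
rewrite /pde_at agradV (divergence_radial r0 dD) gradV enormZ exprMn Vphi derive1_sqr//.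
rewrite real_normK ?num_real// sqrrN -/r opprK.
have -> : n.+1%:R * (g (phi r) ^+ 2 * A r) + r * ((gu (phi r) * - (r * A r) * P r +
    g (phi r) * l) / r - g (phi r) * P r / r ^+ 2) + 2^-1 * (2 * g (phi r) * gu (phi r)) *
    (A r ^+ 2 * r ^+ 2) = g (phi r) * (l + n%:R * P r / r).
  by rewrite Ar -natr1; field; rewrite rn gt_eqF.
split => [e|->].
  have -> : l = (g (phi r) * (l + n%:R * P r / r) + m * phi r - m * phi r) / g (phi r) -
    n%:R * P r / r by field; rewrite rn gt_eqF.
  by rewrite e.
by field; rewrite rn gt_eqF.
Qed.

(** The origin is treated apart: the gradient vanishes there, and the divergence of the field is
    read off from the continuity of its radial factor. *)
Lemma pde_ode0 : cat phi 0 -> cat g (phi 0) -> cat A 0 ->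
  n.+1%:R * g (phi 0) ^+ 2 * A 0 = phi 0 `^ p - m * phi 0 -> pde_at 0.
Proof.
move=> cphi cg cA e; have cD : cat (fun s => g (phi s) ^+ 2 * A s) 0.
  by apply: catM => //; apply: catX; apply: (cat_comp (f := g)).
rewrite /pde_at agradV (divergence_radial0 _ cD) gradV scaler0 enorm0 expr0n /= mulr0 addr0.
by rewrite Vphi enorm0 opprK mulrA e subrK.
Qed.

End radial_pde.

End pde.

Lemma primitive_ge (R : realType) (f F : R -> R) (b bt : R) (s : R) :
  nonlin0 f F b bt -> F b <= F s.
Proof.
move=> H; have b0 := nl_b0 H; have cF x := dv_cat (nl_F H x).
have neg (x y : R) : 0 <= x -> x <= y -> y <= b -> F y <= F x.
  move=> x0' xy yb; apply: (@nincr _ F f x y xy) => t.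
  - by move=> _; exact: cF.
  - by move=> _; exact: (nl_F H).
  - by move=> /andP[t1 t2]; apply: ltW; apply: (nl_neg H); lra.
have [s0|s0] := leP s 0.
  by rewrite (nl_F0 H s0) -(nl_F0 H (lexx 0)); apply: neg => //; exact: ltW.
have [sb|bs] := leP s b; first by apply: neg => //; exact: ltW.
apply: (@ndecr _ F f b s (ltW bs)) => t.
- by move=> _; exact: cF.
- by move=> _; exact: (nl_F H).
- by move=> /andP[t1 _]; apply: ltW; exact: (nl_pos H).
Qed.

(** * Correspondence between ground states and solutions *)

Section correspondence.
Context (R : realType) (n : nat) (p m c : R) (a g gu f Rr rho : R -> R).
Context (ag : forall s : R, 0 < s -> a s = g s ^+ 2) (g0 : forall s : R, 0 < g s).
Context (dg : forall s : R, 0 < s -> dv g s (gu s)) (cgu : forall s : R, 0 < s -> cat gu s).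
Context (gi : forall s : R, (g s)^-1 <= c).
Context (dRr : forall s : R, dv Rr s (g s)) (Rr0 : Rr 0 = 0).
Context (drho : forall s : R, dv rho s (g (rho s))^-1).
Context (rhoK : forall s : R, Rr (rho s) = s) (RrK : forall s : R, rho (Rr s) = s).
Context (rho_gt0 : forall s : R, 0 < s -> 0 < rho s).
Context (cf : forall s : R, cat f s).
Context (fE : forall s : R, 0 < s -> f s = (rho s `^ p - m * rho s) / g (rho s)).
Implicit Types (r s t e : R) (x y : 'rV[R]_n.+1).

Let Rr_lt s t : s < t -> Rr s < Rr t.
Proof.
move=> st; apply: (@incr _ Rr g s t st) => r _; [exact: dv_cat (dRr r)|exact: g0].
Qed.

Let Rr_gt0 s : 0 < s -> 0 < Rr s. Proof. by move=> /Rr_lt; rewrite Rr0. Qed.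

Let rho_le s : 0 < s -> rho s <= c * s.
Proof.
move=> s0; have rho00 : rho 0 = 0 by rewrite -{1}Rr0 RrK.
have [t _] := mvt s0 (fun r _ => dv_cat (drho r)) (fun r _ => drho r).
by rewrite rho00 !subr0 => ->; apply: ler_wpM2r; [exact: ltW|exact: gi].
Qed.

Let c0 : 0 < c. Proof. by apply: lt_le_trans (gi 0); rewrite invr_gt0. Qed.

Section existence.
Context (w P : R -> R) (gs : ground_state f n w P) (Ppos : forall r, 0 < r -> 0 < P r).

Let phi r := rho (w r).
Let A r := flux_quotient f n w P r / g (phi r).
(** This is [r A'], as [Ck2_radial] requires: the first term comes from the flux quotient, the
    second from [phi' = - P / g] in the denominator of [A]. *)
Let C r := (f (w r) - n.+1%:R * flux_quotient f n w P r) / g (phi r) +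
  P r ^+ 2 * gu (phi r) / g (phi r) ^+ 3.
Let u x := phi (enorm x).

Let sol := gs_sol gs.
Let cw r : cat w r. Proof. by case: sol. Qed.
Let cP r : cat P r. Proof. by case: sol. Qed.
Let P0 : P 0 = 0. Proof. by case: sol. Qed.
Let dw r : 0 < r -> dv w r (- P r). Proof. by case: sol => _ _ _ h _; exact: h. Qed.

Let phi0 r : 0 <= r -> 0 < phi r.
Proof. by move=> r0; apply: rho_gt0; exact: (gs_pos gs r0). Qed.

Let cphi r : cat phi r.
Proof. by apply: (cat_comp (f := rho)); [exact: dv_cat (drho _)|exact: cw]. Qed.

Let gn r : g (phi r) != 0. Proof. by rewrite gt_eqF. Qed.

Let cgphi r : 0 <= r -> cat (fun s => g (phi s)) r.
Proof. by move=> /phi0 h; apply: (cat_comp (f := g)) (cphi r); exact: dv_cat (dg h). Qed.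

Let rA r : 0 <= r -> r * A r = P r / g (phi r).
Proof.
rewrite le_eqVlt => /predU1P[<-|r0]; first by rewrite P0 !mul0r.
by rewrite /A flux_quotientE//; field; rewrite gn gt_eqF.
Qed.

Let cA r : 0 <= r -> cat A r.
Proof.
move=> r0; apply: catM; first exact: (cat_flux_quotient cf sol r0).
by apply: catV; [exact: gn|exact: cgphi].
Qed.

Let cC r : 0 <= r -> cat C r.
Proof.
move=> r0; have c1 := cat_flux_quotient cf sol r0; have c2 := cgphi r0.
have c3 : cat (fun s => f (w s)) r by apply: cat_comp (cw r); exact: cf.
have c4 : cat (fun s => gu (phi s)) r by apply: (cat_comp (f := gu)) (cphi r); exact/cgu/phi0.
have c5 := cP r; rewrite /C; apply: catD; apply: catM.
- by catt.
- exact: catV.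
- by catt.
- by apply: catV; [rewrite expf_neq0|exact: catX].
Qed.

Let dphi r : 0 < r -> dv phi r (- (r * A r)).
Proof.
move=> r0; apply: (dv_eq (dv_comp (f := rho) (drho _) (dw r0))).
by rewrite rA ?ltW// mulrN mulrC.
Qed.

Let dA r : 0 < r -> dv A r (C r / r).
Proof.
move=> r0; have d1 := dv_flux_quotient sol r0.
have d2 := dv_comp (f := g) (dg (phi0 (ltW r0))) (dphi r0).
apply: (dv_eq (dv_div (g := fun s => g (phi s)) (gn r) d1 d2)).
rewrite rA ?ltW// /C flux_quotientE//.
by field; rewrite gn gt_eqF.
Qed.

Let C0 : C 0 = 0.
Proof.
rewrite /C P0 flux_quotient0 expr0n /= !mul0r addr0.
by rewrite mulrCA mulfV ?mulr1 ?subrr ?mul0r// pnatr_eq0.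
Qed.

Let du i : partial i u = fun x => - (x 0 i * A (enorm x)).
Proof. exact: (partial_radial (fun r _ => cphi r) cA dphi). Qed.

Lemma ground_state_C2 : Ck 2 u.
Proof. by apply: (@Ck2_radial R n.+1 phi A C) => // r _; exact: cphi. Qed.

Lemma ground_state_solution : solution a p m u.
Proof.
have dV i y : partial i u y = - (y 0 i * A (enorm y)) by rewrite du.
have uphi y : u y = phi (enorm y) by [].
split; last by exists 0 => x y; rewrite !subr0 /u => ->.
- move=> x; have [x0|] := ltP 0 (enorm x); last first.
    rewrite le_eqVlt ltNge enorm_ge0 orbF => /eqP/enorm_eq0 ->.
    have ph := phi0 (lexx 0); apply: (pde_ode0 ag uphi phi0 dV (cphi 0)).
    + exact: dv_cat (dg ph).
    + exact: cA.
    + have w0 := gs_pos gs (lexx 0).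
      have := fE w0; rewrite -/(phi 0) /A flux_quotient0 => ->.
      have N0 : (n.+1%:R : R) != 0 by rewrite pnatr_eq0.
      by move: N0; move: (n.+1%:R : R) => N N0; field; rewrite gn N0.
  have PE s : 0 < s -> P s = g (phi s) * (s * A s).
    by move=> s0; rewrite rA ?ltW//; field; rewrite gn.
  have [_ _ _ _ dP] := sol.
  apply/(pde_ode p m ag (fun s _ => g0 s) dg uphi phi0 dV x0 (dphi x0) PE (dP _ x0)).
  by rewrite fE//; apply: (gs_pos gs); exact: ltW.
- by move=> x; exact/phi0/enorm_ge0.
Qed.

Context (C1 lam : R) (C10 : 0 < C1) (lam0 : 0 < lam).
Context (decay : forall r, 0 <= r ->
  w r <= C1 * expR (- (lam * r)) /\ P r <= C1 * expR (- (lam * r))).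

(** [|Du| = P / g], so [a (u) |Du| ^ 2] is exactly [P ^ 2]. The decay of [w] and [P] together with
    [1 / g <= c] gives all the integrability. *)
Lemma ground_state_space_X : space_X a u.
Proof.
have [cu] : Ck 2 u := ground_state_C2.
move=> Cu; have cdu i : continuous (partial i u) by case: (Cu i) => _ [].
have Cc0 : 0 <= c * C1 by apply: mulr_ge0; exact: ltW.
have Pge r : 0 <= r -> 0 <= P r.
  by rewrite le_eqVlt => /predU1P[<-|/Ppos/ltW//]; rewrite P0.
have P2 x : a (u x) * enorm (grad u x) ^+ 2 = P (enorm x) ^+ 2.
  have -> : grad u x = - A (enorm x) *: x.
    by apply/rowP => i; rewrite !mxE du; ring.
  rewrite enormZ normrN exprMn real_normK ?num_real// ag ?phi0 ?enorm_ge0//.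
  have := rA (enorm_ge0 x); set r := enorm x => h.
  have -> : g (phi r) ^+ 2 * (A r ^+ 2 * r ^+ 2) = (g (phi r) * (r * A r)) ^+ 2 by ring.
  by rewrite h mulrCA mulfV ?mulr1.
exists (grad u); first split.
- apply: (Lfun2_of_bound Cc0 lam0 cu) => x.
  have ph := phi0 (enorm_ge0 x); rewrite /u (gtr0_norm ph).
  apply: le_trans (rho_le (gs_pos gs (enorm_ge0 x))) _; rewrite -mulrA.
  by apply: ler_wpM2l; [exact: ltW|case: (decay (enorm_ge0 x))].
- move=> i; have -> : (fun x => grad u x 0 i) = partial i u by apply/funext => x; rewrite mxE.
  apply: (Lfun2_of_bound Cc0 lam0 (cdu i)) => x; rewrite du normrN normrM.
  have h := rA (enorm_ge0 x); have [_ hP] := decay (enorm_ge0 x).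
  have P0x := Pge _ (enorm_ge0 x).
  have A0 : 0 <= enorm x * A (enorm x) by rewrite h; apply: divr_ge0 => //; exact: ltW.
  apply: (@le_trans _ _ (enorm x * `|A (enorm x)|)).
    by apply: ler_wpM2r => //; exact: coord_le_enorm.
  rewrite -{1}[enorm x]ger0_norm ?enorm_ge0// -normrM ger0_norm// h mulrC -mulrA.
  by apply: ler_pM => //; rewrite invr_ge0 ltW.
- apply: classical_weak_gradient => //.
  by move=> x i; case: (Cu i).
- rewrite (_ : (fun x => _) = (fun x => P (enorm x) ^+ 2)); last by apply/funext.
  have c2 : continuous (fun x => P (enorm x) ^+ 2).
    by apply: (continuous_radial (f := fun r => P r ^+ 2)) => r _; exact: catX (cP r).
  have l2 : 0 < 2 * lam by exact: mulr_gt0.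
  apply: (Lfun1_of_bound (sqr_ge0 C1) l2 c2) => x.
  have [_ hP] := decay (enorm_ge0 x); rewrite ger0_norm ?sqr_ge0//.
  have -> : - (2 * lam * enorm x) = - (lam * enorm x) + - (lam * enorm x) by ring.
  rewrite expRD -expr2 -exprMn ler_pXn2r// nnegrE; first exact/Pge/enorm_ge0.
  by apply: mulr_ge0; [exact: ltW|exact: expR_ge0].
Qed.

End existence.

Section profile.
Context (F : R -> R) (b bt : R) (H : nonlin0 f F b bt).
Context (v : 'rV[R]_n.+1 -> R) (x0 : 'rV[R]_n.+1).
Context (v2 : v \in Lfun (lebesgue_rV R n.+1) 2%:E) (Cv : Ck 2 v).
Context (pdev : forall x, - divergence (fun y => a (v y) *: grad v y) x
        + 2^-1 * derive1 a (v x) * enorm (grad v x) ^+ 2 + m * v x = v x `^ p).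
Context (v0 : forall x, 0 < v x).
Context (vrad : forall x y, enorm (x - x0) = enorm (y - x0) -> v x = v y).

Let e0 : 'rV[R]_n.+1 := delta_mx 0 ord0.
(** The profile is read along a full line through the centre, so it is differentiable on all of the
    real line; being even, it has slope 0 at the centre, which yields [P 0 = 0]. *)
Let phi t := v (t *: e0 + x0).
Let phi1 t := partial ord0 v (t *: e0 + x0).
Let phi2 t := partial ord0 (partial ord0 v) (t *: e0 + x0).
Let w t := Rr (phi t).
Let P t := - (g (phi t) * phi1 t).

Let dphi t : dv phi t (phi1 t).
Proof. by apply: derivable_line; apply: derivableP; case: Cv => _ /(_ ord0)[]. Qed.

Let dphi1 t : dv phi1 t (phi2 t).
Proof.
apply: (derivable_line (f := partial ord0 v)); apply: derivableP.
by case: Cv => _ /(_ ord0)[_ [_ /(_ ord0)[]]].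
Qed.

Let v_phi x : v x = phi (enorm (x - x0)).
Proof. by apply: vrad; rewrite addrK enorm_line0 ger0_norm// enorm_ge0. Qed.

Let phi_abs t : phi `|t| = phi t.
Proof. by apply: vrad; rewrite !addrK !enorm_line0 normr_id. Qed.

Let phi10 : phi1 0 = 0.
Proof.
have d : dv phi (0 : R) (phi1 (- 0) * - 1).
  apply: (dv_on (f := fun t => phi (- t)) (P := fun=> True)); first exact: filterT.
    by move=> t _; rewrite -phi_abs normrN phi_abs.
  exact: (dv_comp (f := phi) (dphi _) (dvN (dv_id _))).
have [_ e1] := dphi 0; have [_] := d; rewrite e1 oppr0 mulrN1; lra.
Qed.

Let V y := v (y + x0).
Let A r := - phi1 r / r.

Let V_phi y : V y = phi (enorm y).
Proof. by rewrite /V v_phi addrK. Qed.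

Let dV i y : partial i V y = - (y 0 i * A (enorm y)).
Proof.
have -> : V = fun y => phi (enorm y) by apply/funext.
have [y0|] := ltP 0 (enorm y).
  case: (is_derive_radial i y0 (dphi (enorm y))) => _; rewrite /partial => ->.
  by rewrite /A; field; rewrite gt_eqF.
rewrite le_eqVlt ltNge enorm_ge0 orbF => /eqP/enorm_eq0 ->.
rewrite mxE mul0r oppr0; have d : dv (fun t : R => phi `|t|) (0 : R) 0.
  by have := dphi 0; rewrite phi10; apply: dv_on; [exact: filterT|move=> t _; rewrite phi_abs].
by case: (is_derive_radial0 i d).
Qed.

Let phi_gt0 r : 0 < phi r. Proof. exact: v0. Qed.

Let pdeV x : pde_at p m a V x.
Proof.
have gV y : grad V y = grad v (y + x0).
  by apply/rowP => i; rewrite !mxE /V partial_shift.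
rewrite /pde_at.
have -> : (fun y => a (V y) *: grad V y) = (fun y => a (v (y + x0)) *: grad v (y + x0)).
  by apply/funext => y; rewrite gV.
have dE : divergence (fun y => a (v (y + x0)) *: grad v (y + x0)) x =
    divergence (fun y => a (v y) *: grad v y) (x + x0).
  by apply: eq_bigr => i _; exact: (partial_shift (fun y => (a (v y) *: grad v y) 0 i)).
by rewrite dE gV; exact: pdev.
Qed.

Let cP r : cat P r.
Proof.
have c1 := dv_cat (dphi1 r); apply: catN; apply: catM => //.
by apply: (cat_comp (f := g)) (dv_cat (dphi r)); exact: dv_cat (dg (phi_gt0 r)).
Qed.

Lemma profile_sol : radial_sol f n w P.
Proof.
split.
- by move=> r; apply: cat_comp (dv_cat (dphi r)); exact: dv_cat (dRr _).
- exact: cP.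
- by rewrite /P phi10 mulr0 oppr0.
- by move=> r r0; apply: (dv_eq (dv_comp (dRr _) (dphi r))); rewrite /P opprK.
- move=> r r0; have d1 := dv_comp (dg (phi_gt0 r)) (dphi r); have d2 := dphi1 r.
  have rE : enorm (r *: e0) = r by rewrite enorm_line0 gtr0_norm.
  have dP : dv P r (- (gu (phi r) * phi1 r * phi1 r + g (phi r) * phi2 r)).
    by rewrite /P; der.
  apply: (dv_eq dP).
  have xr : 0 < enorm (r *: e0) by rewrite rE.
  have dphir : dv phi (enorm (r *: e0)) (- (enorm (r *: e0) * A (enorm (r *: e0)))).
    by rewrite rE; apply: (dv_eq (dphi r)); rewrite /A; field; rewrite gt_eqF.
  have PE s : 0 < s -> P s = g (phi s) * (s * A s).
    by move=> s0; rewrite /P /A; field; rewrite gt_eqF.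
  have dPr : dv P (enorm (r *: e0)) (- (gu (phi r) * phi1 r * phi1 r + g (phi r) * phi2 r)).
    by rewrite rE.
  have := pdeV (r *: e0).
  move=> /(pde_ode p m ag (fun s _ => g0 s) dg V_phi (fun s _ => phi_gt0 s) dV xr dphir PE dPr).
  by rewrite rE => ->; rewrite fE ?RrK//; exact: Rr_gt0.
Qed.

Lemma solution_profile : ground_state f n w P /\ forall x, v x = rho (w (enorm (x - x0))).
Proof.
have sol := profile_sol.
split; last by move=> x; rewrite /w RrK; exact: v_phi.
split => //; first by move=> r _; exact/Rr_gt0/phi_gt0.
(* [F] is minimal at [b], so the initial energy [F (w 0)] bounds [P ^ 2 / 2] by [F (w 0) - F b]. *)
pose K := Num.sqrt (2 * (F (w 0) - F b)).
have PK r : 0 <= r -> `|P r| <= K.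
  move=> r0; have := energy_nincr H sol (lexx 0) r0.
  have [_ _ P0 _ _] := sol; rewrite /energy P0 expr0n /= mul0r add0r => h.
  have hF := primitive_ge (w r) H; rewrite -sqrtr_sqr ler_wsqrtr//; lra.
have K0 : 0 <= K := sqrtr_ge0 _.
have phi1K r : 0 <= r -> `|phi1 r| <= K * c.
  move=> r0; have := PK r r0; rewrite /P normrN normrM (gtr0_norm (g0 _)) => h.
  have -> : `|phi1 r| = g (phi r) * `|phi1 r| * (g (phi r))^-1 by field; rewrite gt_eqF.
  by apply: ler_pM => //; [apply: mulr_ge0 => //; exact: ltW|rewrite invr_ge0 ltW].
have L0 : 0 < K * c + 1 by apply: ltr_wpDl => //; apply: mulr_ge0 => //; exact: ltW.
have lip r s : 0 <= r -> 0 <= s -> `|phi r - phi s| <= (K * c + 1) * `|r - s|.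
  wlog rs : r s / r < s => [hw r0 s0|r0 s0].
    have [rs|sr|->] := ltgtP r s; [exact: hw| |by rewrite !subrr normr0 mulr0].
    by rewrite distrC [`|r - s|]distrC; exact: hw.
  have [t /andP[rt ts] e] := mvt rs (fun z _ => dv_cat (dphi z)) (fun z _ => dphi z).
  rewrite distrC [`|r - s|]distrC e normrM; apply: ler_wpM2r => //.
  have t0 : 0 <= t by lra.
  by have := phi1K t t0; lra.
have lim := Lfun2_profile_lim v2 v_phi L0 lip.
move=> e e0'; have [r0 hr0] := lim (rho e) (rho_gt0 e0').
by exists r0 => r /hr0 /Rr_lt; rewrite rhoK.
Qed.

End profile.

End correspondence.

(** * The hypotheses in quantitative form, and the conclusion *)

Lemma ev_of_lim (R : realType) (d : R) (h h0 : R -> R) :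
  (forall s : R, 1 <= s -> h0 s = s `^ (- d) * h s) -> h0 s @[s --> +oo%R] --> (0 : R) ->
  forall e : R, 0 < e -> ev (fun s => `|h s| <= e * s `^ d).
Proof.
move=> hE /cvgrPdist_lt h00 e e0; have [M [_ hM]] := h00 e e0.
exists (Num.max 1 (M + 1)); first by rewrite le_max lexx.
move=> s; rewrite ge_max => /andP[s1 Ms]; have s0 : 0 < s by lra.
have : M < s by lra.
move=> /hM /=; rewrite sub0r normrN hE// powRN normrM normfV.
have sd : 0 < s `^ d by exact: powR_gt0.
by rewrite (gtr0_norm sd) mulrC ltr_pdivrMr// => /ltW.
Qed.

Lemma ereal_inf_gt0 (R : realType) (h : R -> R) :
  (0 < ereal_inf [set (h s)%:E | s in [set s | (0 <= s)%R]])%E ->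
  exists2 c0 : R, 0 < c0 & forall s : R, 0 <= s -> c0 <= h s.
Proof.
set S := [set _ | _ in _] => S0.
have lb (s : R) : 0 <= s -> (ereal_inf S <= (h s)%:E)%E.
  by move=> s0; apply: ereal_inf_lbound; exists s.
have lb0 := lb 0 (lexx 0).
move: lb0 S0 lb; case: (ereal_inf S) => [c|//|//] _.
by rewrite lte_fin => c0 lb; exists c => // s /lb; rewrite lee_fin.
Qed.

Lemma ereal_inf_ge0 (R : realType) (h : R -> R) :
  (0 <= ereal_inf [set (h s)%:E | s in [set s | (0 <= s)%R]])%E ->
  forall s : R, 0 <= s -> 0 <= h s.
Proof.
move=> h0 s s0; rewrite -lee_fin; apply: le_trans h0 _.
by apply: ereal_inf_lbound; exists s.
Qed.

(** A slope of at least [c] makes [f] reach the value [t] within distance [|t - f 0| / c] of 0. *)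
Lemma right_inverse_exists (R : realType) (f f' : R -> R) (c : R) : 0 < c ->
  (forall s : R, dv f s (f' s)) -> (forall s : R, c <= f' s) ->
  exists g : R -> R, forall t, f (g t) = t.
Proof.
move=> c0 df fc; have cf x := dv_cat (df x).
suff h (t : R) : exists s : R, f s = t by have [h1 h2] := choice h; exists h1.
have slope (a b : R) : a <= b -> c * (b - a) <= f b - f a.
  rewrite le_eqVlt => /predU1P[->|ab]; first by rewrite !subrr mulr0.
  have [x _ ->] := mvt ab (fun x _ => cf x) (fun x _ => df x).
  by apply: ler_wpM2r; [rewrite subr_ge0 ltW|].
pose M := `|t - f 0| / c; have M0 : 0 <= M by apply: divr_ge0 => //; exact: ltW.
have h1 := slope 0 M M0; have NM0 : - M <= 0 by lra.
have h2 := slope (- M) 0 NM0.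
have cM : c * M = `|t - f 0| by rewrite /M; field; rewrite gt_eqF.
have t1 := ler_norm (t - f 0); have t2 := ler_norm (- (t - f 0)); rewrite normrN in t2.
have NMM : - M <= M by lra.
have [|s _ e] := ivt NMM (fun x _ => cf x) (v := t); last by exists s.
by apply/andP; split; lra.
Qed.

Section main.
Context (R : realType) (n : nat) (a1 k p : R) (psi psi' psi'' a : R -> R) (c0 : R).
Context (n2 : (2 <= n)%N) (a10 : 0 < a1) (k2 : 2 < k) (kp : k < 2 * p) (p1 : 1 < p).
Context (qn : (2 * p - k) / (k + 2) * (n%:R - 1) < n%:R + 3) (c00 : 0 < c0).
Context (dpsi : forall s : R, dv psi s (psi' s)).
Context (dpsi' : forall s : R, dv psi' s (psi'' s)).
Context (psi_ge : forall s : R, 0 <= s -> c0 <= psi s).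
Context (psi_k : forall s : R, 0 <= s -> 0 <= k * psi s - s * psi' s).
Context (psi0y : forall e : R, 0 < e -> ev (fun s => `|psi s| <= e * s `^ ((k - 2) / 2))).
Context (psi1y : forall e : R, 0 < e -> ev (fun s => `|s * psi' s| <= e * s `^ ((k - 2) / 2))).
Context (psi2y : forall e : R, 0 < e -> ev (fun s => `|s ^+ 2 * psi'' s| <= e * s `^ ((k - 2) / 2))).
Context (ha : forall s, a s = a1 * `|s| `^ k + psi s).

Lemma exists_unique_solution :
  exists2 m0 : R, 0 < m0 & forall m : R, m0 <= m ->
    exists u : 'rV[R]_n.+1 -> R,
      [/\ space_X a u, Ck 2 u, solution a p m u &
          forall v : 'rV[R]_n.+1 -> R, space_X a v -> Ck 2 v -> solution a p m v ->
            exists y : 'rV[R]_n.+1, forall x, v x = u (x - y)].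
Proof.
pose g : R -> R := gext a1 k psi.
have g0 s : 0 < g s := gext_gt0 k a10 c00 psi_ge s.
have cg s : cat g s := cat_gext a1 k2 dpsi s.
have [Rr [dRr Rr0]] := primitive cg.
have sc0 : 0 < Num.sqrt c0 by rewrite sqrtr_gt0.
have gc s : Num.sqrt c0 <= g s by rewrite /g /gext ler_wsqrtr// aext_ge.
have gi s : (g s)^-1 <= (Num.sqrt c0)^-1 by rewrite lef_pV2 ?posrE.
have [rho rhoK] := right_inverse_exists sc0 dRr gc.
have RrK (s : R) : rho (Rr s) = s := RrK a10 c00 psi_ge dRr rhoK s.
have drho (s : R) : dv rho s (g (rho s))^-1 := dv_rho a10 c00 psi_ge dRr rhoK s.
have rho0 s : 0 < s -> 0 < rho s by rewrite (rho_gt0 a10 c00 psi_ge dRr Rr0 rhoK).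
pose gu s := g s * (k / 2 - kapp a1 k psi psi' s) / s.
have dg (s : R) : 0 < s -> dv g s (gu s) := @dv_gext _ _ _ _ _ _ a10 k2 c00 dpsi psi_ge s.
have cgu s : 0 < s -> cat gu s.
  move=> s0; have c1 := cg s; rewrite /gu; apply: catM.
    apply: catM => //; apply: catB; first exact: cat_cst.
    exact: dv_cat (dv_kapp a10 k2 c00 dpsi dpsi' psi_ge s0).
  by apply: catV; [rewrite gt_eqF|exact: cat_id].
have ag s : 0 < s -> a s = g s ^+ 2.
  move=> s0; rewrite /g (gext2 k a10 c00 psi_ge) ha /aext ppow_gt0//.
  by rewrite (gtr0_norm s0) (max_l (ltW s0)).
have [m0 m00 Hm] := dual_nonlin a10 k2 kp p1 c00 dpsi dpsi' psi_ge psi_k psi0y psi1y psi2y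
  dRr Rr0 rhoK.
exists m0 => // m mm; have {}Hm := Hm m mm; have mp : 0 < m by lra.
set f := fdual a1 k p psi rho m in Hm.
have cf s : cat f s := cat_fdual a10 k2 p1 c00 dpsi psi_ge dRr rhoK m s.
have fE s : 0 < s -> f s = (rho s `^ p - m * rho s) / g (rho s).
  move=> /rho0 r0; rewrite /f /fdual /phid /hdual !ppow_gt0// powRr1//; exact: ltW.
have q0 : 0 < (2 * p - k) / (k + 2).
  by apply: divr_gt0; [have := kp; lra|have := k2; lra].
have [c1 [c2 [C3 [W0 [M0 [[c10 c20 C30 W01 bW0] [flb fub Qlb M00 fM]]]]]]] :=
  dual_growth a10 k2 kp p1 c00 dpsi dpsi' psi_ge psi_k psi0y psi1y dRr Rr0 rhoK mp n2 qn.
have [A [btA cross]] := crossing Hm n2 q0 qn c10 c20 C30 W01 bW0 flb fub Qlb M00 fM.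
have [w [P [gs Ppos]]] := ground_state_exists Hm n2 btA cross.
have [ka [e [ka0 e0 fle]]] := fdual_le_linear a10 k2 p1 c00 dpsi psi_ge dRr Rr0 rhoK mp.
have [C [lam [C0 lam0 decay]]] := ground_state_decay gs Ppos ka0 e0 fle.
exists (fun x => rho (w (enorm x))); split.
- exact: (ground_state_space_X ag g0 dg cgu gi Rr0 drho RrK rho0 cf gs Ppos C0 lam0 decay).
- exact: (ground_state_C2 g0 dg cgu drho rho0 cf gs).
- exact: (ground_state_solution ag g0 dg drho rho0 cf fE gs).
(* The profile of [v] about its centre [x0] is a ground state of the same [f], hence equals [w]; the
   translation is by [x0]. *)
move=> v [G [v2 _ _] _] Cv [pdev v0 [x0 vrad]]; exists x0 => x.
have [gv ->] := solution_profile ag g0 dg gi dRr Rr0 rhoK RrK rho0 fE Hm v2 Cv pdev v0 vrad.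
by rewrite (ground_state_unique Hm n2 gv gs (enorm_ge0 _)).
Qed.

End main.

Theorem theorem1p1 (R : realType) (N : nat) (a1 k p : R) (psi a : R -> R)
  (hN : (3 <= N)%N) (ha1 : 0 < a1) (hpsi : C2_real psi)
  (hk : 2 < k < 2 * p)
  (hp : 1 < p < ((k + 1) * N%:R + 2) / (N%:R - 2))
  (ha : forall s, a s = a1 * `|s| `^ k + psi s)
  (hinf : (0 < ereal_inf [set (psi s)%:E | s in [set s | (0 <= s)%R]])%E)
  (hinf' : (0 <= ereal_inf
     [set (k * psi s - s * derive1 psi s)%:E | s in [set s | (0 <= s)%R]])%E)
  (hlim0 : s `^ ((2 - k) / 2) * psi s @[s --> +oo%R] --> (0 : R))
  (hlim1 : s `^ ((4 - k) / 2) * derive1 psi s @[s --> +oo%R] --> (0 : R))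
  (hlim2 : s `^ ((6 - k) / 2) * derive1n 2 psi s @[s --> +oo%R] --> (0 : R)) :
  exists2 m0 : R, 0 < m0 & forall m : R, m0 <= m ->
    exists u : 'rV[R]_N -> R,
      [/\ space_X a u, Ck 2 u, solution a p m u &
          forall v : 'rV[R]_N -> R, space_X a v -> Ck 2 v -> solution a p m v ->
            exists y : 'rV[R]_N, forall x, v x = u (x - y)].
Proof.
case: N hN hp => // n n2 /andP[p1 pN]; have /andP[k2 kp] := hk.
have [dpsi0 dpsi1 _] := hpsi.
have dpsi (s : R) : dv psi s (derive1 psi s) by constructor; [exact: dpsi0|rewrite derive1E].
have dpsi' (s : R) : dv (derive1 psi) s (derive1n 2 psi s).
  by constructor; [exact: dpsi1|rewrite -derive1E].
have [c0 c00 psi_ge] := ereal_inf_gt0 hinf; have psi_k := ereal_inf_ge0 hinf'.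
have n1 : (0 : R) < n%:R - 1 by rewrite subr_gt0 ltr1n.
apply: (@exists_unique_solution R n a1 k p psi (derive1 psi) (derive1n 2 psi) a c0) => //.
(* With denominators cleared, the bound on [p] becomes [(2 p - k) (n - 1) < (n + 3) (k + 2)], where
   [N = n + 1]. *)
- move: pN; rewrite -natr1 ltr_pdivlMr; last by lra.
  by rewrite mulrAC ltr_pdivrMr; lra.
(* All three limits say that [s ^ j] times the derivative of order [j] of [psi] is small compared
   with [s ^ ((k - 2) / 2)]. *)
- apply: (ev_of_lim (h := psi)) hlim0 => s s1; congr (_ `^ _ * _); lra.
- apply: (ev_of_lim (h := fun s => s * derive1 psi s)) hlim1 => s s1.
  have s0 : 0 < s by lra.
  have -> : (4 - k) / 2 = - ((k - 2) / 2) + 1 by field.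
  by rewrite powRD ?(gt_eqF s0) ?implybT// powRr1 ?(ltW s0)// mulrA.
- apply: (ev_of_lim (h := fun s => s ^+ 2 * derive1n 2 psi s)) hlim2 => s s1.
  have s0 : 0 < s by lra.
  have -> : (6 - k) / 2 = - ((k - 2) / 2) + 2 by field.
  by rewrite powRD ?(gt_eqF s0) ?implybT// (powR_mulrn 2 (ltW s0)) mulrA.
Qed.
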